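(* Let $\overline{pp}(n)$ be the number of plane overpartitions of size $n$, i.e. the coefficient of $q^n$ in $\prod_{m\ge1}\left(\frac{1+q^m}{1-q^m}\right)^m$. As $n\to\infty$, we have $$\overline{pp}(n)\sim\frac{e^{\zeta'(-1)}(7\zeta(3))^{\frac7{36}}}{2^{\frac79}\sqrt{3\pi}\,n^{\frac{25}{36}}}\exp\left(\frac{3}{2^{\frac43}}(7\zeta(3))^{\frac13}n^{\frac23}\right).$$
   Context: $\zeta(s)$ is the Riemann zeta function. In the paper $\overline{pp}(n):=\mathcal{A}_n(-1)$, where $\sum_{n\ge0}\mathcal{A}_n(\zeta)q^n:=\prod_{n\ge1}\left(\frac{1-\zeta q^n}{1-q^n}\right)^n$. $f(n)\sim g(n)$ means $f(n)/g(n)\to1$ as $n\to\infty$. *)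

(* Defs.v *)
From Stdlib Require Import Reals Lia Arith.
From Coquelicot Require Import Coquelicot.
Open Scope R_scope.

(** * Plane overpartitions

    A formal power series is its sequence of coefficients [nat -> R], as in
    Coquelicot's [PSeries]; the product is [PS_mult]. *)

Definition PS_one : nat -> R := fun k => if Nat.eqb k 0 then 1 else 0.

Definition one_plus_q (m : nat) : nat -> R :=
  fun k => if (Nat.eqb k 0 || Nat.eqb k m)%bool then 1 else 0.

Definition one_minus_q (m : nat) : nat -> R :=
  fun k => if Nat.eqb k 0 then 1 else if Nat.eqb k m then -1 else 0.

(** [1 / (1 - q^m) = 1 + q^m + q^(2m) + ...]; see [one_minus_q_inv]. *)
Definition inv_one_minus_q (m : nat) : nat -> R :=
  fun k => if Nat.eqb (Nat.modulo k m) 0 then 1 else 0.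

Fixpoint PS_pow (a : nat -> R) (k : nat) : nat -> R :=
  match k with
  | O => PS_one
  | S k' => PS_mult a (PS_pow a k')
  end.

Definition pp_factor (m : nat) : nat -> R :=
  PS_pow (PS_mult (one_plus_q m) (inv_one_minus_q m)) m.

(** The product of the factors [m = 1, ..., N]. *)
Fixpoint pp_partial_prod (N : nat) : nat -> R :=
  match N with
  | O => PS_one
  | S N' => PS_mult (pp_partial_prod N') (pp_factor N)
  end.

(** The factors with [m > n] are [1 + O(q^(n+1))], so the coefficient of [q^n]
    in the infinite product is that of the product of the first [n] factors;
    see [pp_partial_prod_stable]. *)
Definition pp (n : nat) : R := pp_partial_prod n n.

Lemma one_minus_q_inv (m k : nat) : (1 <= m)%nat ->
  PS_mult (one_minus_q m) (inv_one_minus_q m) k = PS_one k.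
Proof.
  intros Hm. unfold PS_mult.
  assert (Hz : forall n, (n < m)%nat -> (n <= k)%nat ->
     sum_f_R0 (fun i => one_minus_q m i * inv_one_minus_q m (k - i)) n
     = inv_one_minus_q m k).
  { induction n as [|n IH]; intros H1 H2; simpl.
    - unfold one_minus_q. simpl. rewrite Nat.sub_0_r. ring.
    - rewrite IH by lia. unfold one_minus_q.
      destruct (Nat.eqb_spec (S n) 0); [lia|].
      destruct (Nat.eqb_spec (S n) m); [lia|]. ring. }
  assert (Hbig : forall n, (m <= n)%nat -> (n <= k)%nat ->
     sum_f_R0 (fun i => one_minus_q m i * inv_one_minus_q m (k - i)) n = 0).
  { induction n as [|n IH]; intros H1 H2; [lia|]. simpl.
    destruct (Nat.eq_dec (S n) m) as [E|E].
    - rewrite Hz by lia. unfold one_minus_q.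
      destruct (Nat.eqb_spec (S n) 0); [lia|].
      destruct (Nat.eqb_spec (S n) m); [|lia].
      rewrite E. unfold inv_one_minus_q.
      replace (Nat.modulo k m) with (Nat.modulo (k - m) m); [ring|].
      replace k with ((k - m) + 1 * m)%nat at 2 by lia.
      rewrite Nat.Div0.mod_add. reflexivity.
    - rewrite IH by lia. unfold one_minus_q.
      destruct (Nat.eqb_spec (S n) 0); [lia|].
      destruct (Nat.eqb_spec (S n) m); [lia|]. ring. }
  unfold PS_one. destruct (Nat.eqb_spec k 0) as [->|Hk].
  - rewrite Hz by lia. unfold inv_one_minus_q.
    rewrite Nat.Div0.mod_0_l. reflexivity.
  - destruct (le_lt_dec m k).
    + apply Hbig; lia.
    + rewrite Hz by lia. unfold inv_one_minus_q.
      rewrite Nat.mod_small by lia.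
      destruct (Nat.eqb_spec k 0); [lia|reflexivity].
Qed.

Lemma PS_mult_one_upto (a b : nat -> R) (n : nat) :
  (forall k, (k <= n)%nat -> b k = PS_one k) -> PS_mult a b n = a n.
Proof.
  intros Hb. unfold PS_mult. destruct n as [|n].
  - simpl. rewrite Hb by lia. unfold PS_one. simpl. ring.
  - rewrite tech5. rewrite Nat.sub_diag, Hb by lia.
    rewrite (sum_eq_R0 _ n).
    + unfold PS_one. simpl. ring.
    + intros k Hk. rewrite Hb by lia. unfold PS_one.
      destruct (Nat.eqb_spec (S n - k) 0); [lia|ring].
Qed.

Lemma PS_pow_one_upto (a : nat -> R) (n j : nat) :
  (forall k, (k <= n)%nat -> a k = PS_one k) ->
  forall k, (k <= n)%nat -> PS_pow a j k = PS_one k.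
Proof.
  intros Ha. induction j as [|j IH]; intros k Hk; simpl; [reflexivity|].
  rewrite PS_mult_one_upto; [now apply Ha|]. intros i Hi. apply IH; lia.
Qed.

Lemma pp_partial_prod_stable (n N : nat) :
  (n <= N)%nat -> pp_partial_prod N n = pp n.
Proof.
  induction 1 as [|N HN IH]; [reflexivity|].
  rewrite <- IH. cbn [pp_partial_prod]. apply PS_mult_one_upto.
  apply PS_pow_one_upto. intros k Hk.
  rewrite PS_mult_one_upto.
  - unfold one_plus_q, PS_one.
    destruct (Nat.eqb_spec k 0); [reflexivity|].
    destruct (Nat.eqb_spec k (S N)); [lia|reflexivity].
  - intros i Hi. unfold inv_one_minus_q, PS_one.
    rewrite Nat.mod_small by lia. reflexivity.
Qed.

(** * The Riemann zeta function *)

Definition Cexp (z : C) : C :=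
  (exp (Re z) * cos (Im z), exp (Re z) * sin (Im z)).

(** [n^s = exp (s * log n)], for [n >= 1]. *)
Definition nat_Cpow (n : nat) (s : C) : C := Cexp (s * RtoC (ln (INR n)))%C.

Definition analytic_at (f : C -> C) (s0 : C) : Prop :=
  exists (a : nat -> C) (r : R), 0 < r /\
    forall s : C, Cmod (s - s0)%C < r ->
      is_pseries (K := C_AbsRing) (V := C_NormedModule) a (s - s0)%C (f s).

(** [zeta] is the analytic continuation to [C \ {1}] of the Dirichlet series
    [sum_{n >= 1} n^(-s)], [Re s > 1]. The value at the pole is left free. *)
Definition is_Riemann_zeta (zeta : C -> C) : Prop :=
  (forall s : C, 1 < Re s ->
     is_series (K := C_AbsRing) (V := C_NormedModule)
       (fun n => nat_Cpow (S n) (- s)%C) (zeta s)) /\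
  (forall s : C, s <> RtoC 1 -> analytic_at zeta s).

Definition asymp_equiv (f g : nat -> R) : Prop :=
  is_lim_seq (fun n => f n / g n) 1.

(* Main.v *)
Require Import Defs.
From Stdlib Require Import Reals Lra Lia Arith FunctionalExtensionality.
From Coquelicot Require Import Coquelicot.
Open Scope R_scope.

(** The proof is the saddle point method; the asymptotics of the generating
    function are needed only on the positive real axis.

    Write [F(q)] for the generating function and [q = exp (- t)].  The
    logarithmic derivative of the product shows that [n pp(n)] is a convolution
    of [pp] with explicit non-negative coefficients ([pp_rec]), whence
    [F = exp (sum c_k q^k)] on the whole disc ([pp_generating_Cexp]); on the
    positive axis, [log F] is also [sum_m m ell(m t)] with
    [ell(y) = log ((1 + e^(-y)) / (1 - e^(-y)))] ([pp_log_series]).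

    Euler-Maclaurin summation of [x ell(x t)] gives [log F] up to [o(1)] as [t]
    tends to [0] ([pp_log_asymp]).  Near the origin [ell(y)] is
    [- ln (y / 2)] up to [o(1)], so that the Euler-Maclaurin remainders converge
    to those of [- x ln x]; the leading term comes from
    [int_0^oo y ell(y) dy = 2 sum_(j odd) 1 / j^3 = (7 / 4) zeta(3)].  The sum of
    the remainders of [- x ln x] is [zeta'(-1) + 1/6] ([zeta_derive_m1]):
    Euler-Maclaurin summation of [x^(-s)] represents [zeta(s)] for [Re s > 1] by a
    series that is analytic for [Re s > -2], the representation persists along a
    path that avoids the pole, and it may be differentiated at [-1].  That a
    series of analytic functions is analytic follows from Cauchy's estimate,
    itself a consequence of the formula for Fourier coefficients.

    Together: [log F = zc / t^2 + ln (t / 2) / 12 + zeta'(-1) + o(1)] with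
    [zc = (7 / 4) zeta(3)].

    Finally [pp(n)] is the [n]-th Fourier coefficient of [F] on the circle of
    radius [exp (- t)], where [t] is chosen so that [n = 2 zc / t^3].  The first
    two Taylor coefficients of [log F] at [t] are read off from its asymptotics
    at [t] and [t +- sigma^(-1)], because the third is under control: the
    coefficients [c_k] are non-negative, so [sum k^3 c_k q^k] is at most
    [48 t^(-3) log F(exp (- t / 2))].  On the scale [sigma^(-1)] the integrand
    thus converges to the Gaussian ([saddle_fun_central]).  Away from the
    positive axis, [c_k >= 2 k] and the closed form of [sum k z^k] give an
    exponential bound on [|F|] ([circ_re_lower], [saddle_fun_tail]), and
    dominated convergence concludes ([saddle_point]). *)

(** * Complex series through their real and imaginary parts *)

(** Componentwise convergence makes the library of real series applicable;
    [is_series_Cser] compares it with convergence in the normed module [C]. *)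
Definition Cser (a : nat -> C) (l : C) : Prop :=
  is_series (fun n => Re (a n)) (Re l) /\ is_series (fun n => Im (a n)) (Im l).

Definition Csum (a : nat -> C) : C :=
  (Series (fun n => Re (a n)), Series (fun n => Im (a n))).

Lemma Cser_unique a l : Cser a l -> Csum a = l.
Proof.
  intros [H1 H2]. unfold Csum.
  rewrite (is_series_unique _ _ H1), (is_series_unique _ _ H2).
  destruct l; reflexivity.
Qed.

Lemma Cser_ext a b l : (forall n, a n = b n) -> Cser a l -> Cser b l.
Proof.
  intros H [H1 H2]; split; eapply is_series_ext; try eassumption;
  intros n; simpl; now rewrite H.
Qed.

Lemma Cser_plus a b la lb : Cser a la -> Cser b lb ->
  Cser (fun n => (a n + b n)%C) (la + lb)%C.
Proof.
  intros [H1 H2] [H3 H4]; split; simpl.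
  - exact (is_series_plus _ _ _ _ H1 H3).
  - exact (is_series_plus _ _ _ _ H2 H4).
Qed.

Lemma Cser_scal (c : C) a l : Cser a l -> Cser (fun n => (c * a n)%C) (c * l)%C.
Proof.
  intros [H1 H2]; destruct c as [x y]; split; simpl.
  - apply (is_series_minus (V := R_NormedModule) (fun n => x * Re (a n)) (fun n => y * Im (a n))).
    + exact (is_series_scal x _ _ H1).
    + exact (is_series_scal y _ _ H2).
  - apply (is_series_plus (V := R_NormedModule) (fun n => x * Im (a n)) (fun n => y * Re (a n))).
    + exact (is_series_scal x _ _ H2).
    + exact (is_series_scal y _ _ H1).
Qed.

Lemma Cser_minus a b la lb : Cser a la -> Cser b lb ->
  Cser (fun n => (a n - b n)%C) (la - lb)%C.
Proof.
  intros Ha Hb.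
  apply Cser_ext with (fun n => (a n + (- (1)) * b n)%C); [intros; ring|].
  replace (la - lb)%C with (la + (- (1)) * lb)%C by ring.
  apply Cser_plus; [assumption|]. now apply Cser_scal.
Qed.

Lemma Im_le_Cmod z : Rabs (Im z) <= Cmod z.
Proof. eapply Rle_trans; [apply Rmax_r|apply Rmax_Cmod]. Qed.

Lemma Cmod_le_sum z : Cmod z <= Rabs (Re z) + Rabs (Im z).
Proof.
  destruct z as [x y]; unfold Cmod; simpl.
  rewrite <- (sqrt_Rsqr (Rabs x + Rabs y)).
  2:{ pose proof (Rabs_pos x); pose proof (Rabs_pos y); lra. }
  apply sqrt_le_1_alt. unfold Rsqr.
  pose proof (Rabs_pos x); pose proof (Rabs_pos y).
  assert (x * x = Rabs x * Rabs x) by (rewrite <- Rabs_mult, Rabs_pos_eq; nra).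
  assert (y * y = Rabs y * Rabs y) by (rewrite <- Rabs_mult, Rabs_pos_eq; nra).
  nra.
Qed.

Lemma ex_series_dominated (b a : nat -> R) :
  (forall n, Rabs (a n) <= b n) -> ex_series b -> ex_series a.
Proof. apply (ex_series_le (V := R_CompleteNormedModule)). Qed.

Lemma ex_series_dominated_abs (b a : nat -> R) :
  (forall n, Rabs (a n) <= b n) -> ex_series b -> ex_series (fun n => Rabs (a n)).
Proof.
  intros H. apply ex_series_dominated. intros n. rewrite Rabs_Rabsolu. apply H.
Qed.

Lemma ex_series_Rscal c (a : nat -> R) : ex_series a -> ex_series (fun k => c * a k).
Proof. apply (ex_series_scal_l (K := R_AbsRing) (V := R_NormedModule)). Qed.

Lemma Csum_correct (a : nat -> C) (b : nat -> R) :
  (forall n, Cmod (a n) <= b n) -> ex_series b -> Cser a (Csum a).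
Proof.
  intros H Hb; split; simpl; apply Series_correct, (ex_series_dominated b); try assumption;
  intros n; (eapply Rle_trans; [|apply H]).
  - apply re_le_Cmod.
  - apply Im_le_Cmod.
Qed.

Lemma Re_rotate z : exists u, Cmod u = 1 /\ (Re (u * z)%C = Cmod z).
Proof.
  destruct (Req_dec (Cmod z) 0) as [E|E].
  - exists 1%C. split; [apply Cmod_1|]. apply Cmod_eq_0 in E. subst.
    rewrite Cmod_0. simpl. ring.
  - exists (Cconj z / RtoC (Cmod z))%C. split.
    + rewrite Cmod_div, Cmod_conj, Cmod_R, Rabs_pos_eq; [field; exact E|apply Cmod_ge_0|].
      intros H. apply RtoC_inj in H. contradiction.
    + replace (Cconj z / Cmod z * z)%C with (RtoC (Cmod z)); [reflexivity|].
      assert (Hz : RtoC (Cmod z) <> 0%C) by (intros H; apply RtoC_inj in H; contradiction).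
      transitivity (z * Cconj z / Cmod z)%C; [|field; exact Hz].
      rewrite <- Cmod2_conj, RtoC_pow. field. exact Hz.
Qed.

(** Rotate the sum onto the positive axis and compare real parts. *)
Lemma Cser_Cmod_le (a : nat -> C) (b : nat -> R) l lb :
  Cser a l -> (forall n, Cmod (a n) <= b n) -> is_series b lb -> Cmod l <= lb.
Proof.
  intros Ha Hab Hb. destruct (Re_rotate l) as [u [Hu Hul]].
  destruct (Cser_scal u _ _ Ha) as [H1 _]. rewrite Hul in H1.
  assert (H : forall n, Re (u * a n)%C <= b n).
  { intros n. eapply Rle_trans; [apply Rle_abs|].
    eapply Rle_trans; [apply re_le_Cmod|]. rewrite Cmod_mult, Hu, Rmult_1_l. apply Hab. }
  refine (is_lim_seq_le _ _ (Finite _) (Finite _) _ H1 Hb).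
  intros n. apply sum_n_m_le. exact H.
Qed.

Lemma sum_n_C (a : nat -> C) n :
  sum_n (G := C_AbelianMonoid) a n =
  (sum_n (fun k => Re (a k)) n, sum_n (fun k => Im (a k)) n).
Proof.
  induction n as [|n IH].
  - rewrite !sum_O. destruct (a O); reflexivity.
  - rewrite !sum_Sn, IH. reflexivity.
Qed.

Lemma is_series_Cser (a : nat -> C) l :
  is_series (K := C_AbsRing) (V := C_NormedModule) a l <-> Cser a l.
Proof.
  unfold is_series, Cser, is_series. split.
  - intros H. split.
    + intros P [eps HP].
      destruct (H (fun z => P (Re z))) as [N HN].
      { exists eps. intros y [Hy _]. apply HP. exact Hy. }
      exists N. intros n Hn. specialize (HN n Hn).
      change (sum_n (G := NormedModule.AbelianMonoid C_AbsRing C_NormedModule) a n)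
        with (sum_n (G := C_AbelianMonoid) a n) in HN.
      rewrite sum_n_C in HN. exact HN.
    + intros P [eps HP].
      destruct (H (fun z => P (Im z))) as [N HN].
      { exists eps. intros y [_ Hy]. apply HP. exact Hy. }
      exists N. intros n Hn. specialize (HN n Hn).
      change (sum_n (G := NormedModule.AbelianMonoid C_AbsRing C_NormedModule) a n)
        with (sum_n (G := C_AbelianMonoid) a n) in HN.
      rewrite sum_n_C in HN. exact HN.
  - intros [H1 H2] P [eps HP].
    destruct (H1 (ball (Re l) eps)) as [N1 HN1]; [now exists eps|].
    destruct (H2 (ball (Im l) eps)) as [N2 HN2]; [now exists eps|].
    exists (max N1 N2). intros n Hn. apply HP.
    change (sum_n (G := NormedModule.AbelianMonoid C_AbsRing C_NormedModule) a n)
      with (sum_n (G := C_AbelianMonoid) a n).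
    rewrite sum_n_C. split; [apply HN1|apply HN2]; lia.
Qed.

Lemma pow_n_Cpow (z : C) n : pow_n (K := C_Ring) z n = (z ^ n)%C.
Proof. induction n as [|n IH]; [reflexivity|]. simpl. now rewrite IH. Qed.

Lemma is_pseries_Cser (a : nat -> C) w l :
  is_pseries (K := C_AbsRing) (V := C_NormedModule) a w l <->
  Cser (fun k => (a k * w ^ k)%C) l.
Proof.
  unfold is_pseries. rewrite is_series_Cser.
  assert (E : forall n, scal (K := C_AbsRing) (V := C_NormedModule)
    (pow_n (K := C_AbsRing) w n) (a n) = (a n * w ^ n)%C).
  { intros n. rewrite Cmult_comm, <- pow_n_Cpow. reflexivity. }
  split; apply Cser_ext; intros n; [|symmetry]; apply E.
Qed.

(** * Complex exponential *)

Lemma Cexp_plus z w : Cexp (z + w)%C = (Cexp z * Cexp w)%C.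
Proof.
  destruct z as [a b], w as [c d]. unfold Cexp, Cmult; simpl.
  rewrite exp_plus, cos_plus, sin_plus. f_equal; ring.
Qed.

Lemma Cexp_0 : Cexp 0%C = 1%C.
Proof.
  unfold Cexp; simpl. rewrite exp_0, cos_0, sin_0. unfold RtoC. f_equal; ring.
Qed.

Lemma Cexp_R (x : R) : Cexp (RtoC x) = RtoC (exp x).
Proof. unfold Cexp, RtoC; simpl. rewrite cos_0, sin_0. f_equal; ring. Qed.

Lemma Cmod_Cexp z : Cmod (Cexp z) = exp (Re z).
Proof.
  destruct z as [a b]. unfold Cexp, Cmod; simpl.
  replace (exp a * cos b * (exp a * cos b * 1) + exp a * sin b * (exp a * sin b * 1))
    with ((exp a * exp a) * (Rsqr (sin b) + Rsqr (cos b))) by (unfold Rsqr; ring).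
  rewrite sin2_cos2, Rmult_1_r. apply sqrt_square. left; apply exp_pos.
Qed.

(** * Preliminaries from real analysis *)

Lemma mean_value_exists (f f' : R -> R) a b : a <= b ->
  (forall x, a <= x <= b -> is_derive f x (f' x)) ->
  exists c, a <= c <= b /\ f b - f a = f' c * (b - a).
Proof.
  intros Hab Hd.
  destruct (MVT_gen f a b f') as [c [Hc E]]; rewrite ?Rmin_left, ?Rmax_right in * by lra.
  - intros x Hx. apply Hd. lra.
  - intros x Hx. apply continuity_pt_filterlim.
    apply (ex_derive_continuous (V := R_NormedModule) f x). eexists; apply Hd; lra.
  - exists c. split; assumption.
Qed.

Lemma mean_value_inequality (f f' : R -> R) a b K : a <= b ->
  (forall x, a <= x <= b -> is_derive f x (f' x)) ->
  (forall x, a <= x <= b -> Rabs (f' x) <= K) ->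
  Rabs (f b - f a) <= K * (b - a).
Proof.
  intros Hab Hd HK. destruct (mean_value_exists f f' a b Hab Hd) as [c [Hc E]].
  rewrite E, Rabs_mult, (Rabs_pos_eq (b - a)) by lra.
  apply Rmult_le_compat_r; [lra|]. now apply HK.
Qed.

Lemma zero_derivative_const (f : R -> R) a b : a <= b ->
  (forall x, a <= x <= b -> is_derive f x 0) -> f b = f a.
Proof.
  intros Hab H. destruct (mean_value_exists f (fun _ => 0) a b Hab H) as [c [_ E]]. lra.
Qed.

(* After [auto_derive]: replace the derivatives of the functions for which a
   hypothesis is at hand. *)
Ltac subst_derive :=
  repeat match goal with H : is_derive _ ?x ?v |- context [Derive ?f ?x] =>
    rewrite (is_derive_unique f x v H) end.

Lemma is_lim_seq_bounded (a : nat -> R) (l : R) : is_lim_seq a l ->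
  exists M, forall n, Rabs (a n) <= M.
Proof.
  intros H. apply is_lim_seq_spec in H. destruct (H (mkposreal 1 Rlt_0_1)) as [N HN]. simpl in HN.
  assert (G : forall n, exists M, forall k, (k < n)%nat -> Rabs (a k) <= M).
  { induction n as [|n [M HM]]; [exists 0; intros; lia|].
    exists (Rmax M (Rabs (a n))). intros k Hk.
    destruct (Nat.eq_dec k n) as [->|]; [apply Rmax_r|].
    eapply Rle_trans; [apply HM; lia|apply Rmax_l]. }
  destruct (G N) as [M HM]. exists (Rmax M (Rabs l + 1)). intros n.
  destruct (le_lt_dec N n) as [h|h].
  - eapply Rle_trans; [|apply Rmax_r]. specialize (HN n h).
    replace (a n) with (l + (a n - l)) by ring.
    eapply Rle_trans; [apply Rabs_triang|]. lra.
  - eapply Rle_trans; [apply HM; lia|apply Rmax_l].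
Qed.

Lemma CV_radius_ge_of_bounded (a : nat -> R) r M :
  (forall n, Rabs (a n * r ^ n) <= M) -> Rbar_le r (CV_radius a).
Proof.
  intros H. destruct (CV_radius_bounded a) as [H1 _]. apply H1. exists M. exact H.
Qed.

Lemma bounded_inside_radius (a : nat -> R) r : 0 <= r -> Rbar_lt r (CV_radius a) ->
  exists M, forall n, Rabs (a n) * r ^ n <= M.
Proof.
  intros Hr H. rewrite <- (Rabs_pos_eq r Hr) in H. apply CV_disk_inside in H.
  destruct H as [l Hl].
  destruct (is_lim_seq_bounded (fun n => Rabs (a n * r ^ n)) 0) as [M HM].
  { apply (ex_series_lim_0 (fun n => Rabs (a n * r ^ n))). now exists l. }
  exists M. intros n. specialize (HM n). rewrite Rabs_Rabsolu in HM.
  rewrite Rabs_mult, <- RPow_abs, (Rabs_pos_eq r Hr) in HM. exact HM.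
Qed.

(** The margin between [Cmod u] and the radius of convergence leaves room for
    some [x > 1] with [x u] inside the disc. *)
Lemma radius_dominated (a d : nat -> R) (u : C) :
  Rbar_lt (Cmod u) (CV_radius a) ->
  (forall n, Rabs (d n) <= Rabs (a n) * Cmod u ^ n) -> Rbar_lt 1 (CV_radius d).
Proof.
  intros Hu Hd.
  assert (Hr : exists r, Cmod u < r /\ Rbar_lt r (CV_radius a)).
  { pose proof (Cmod_ge_0 u). destruct (CV_radius a) as [R0| |]; simpl in Hu.
    - exists ((Cmod u + R0) / 2). split; simpl; lra.
    - exists (Cmod u + 1). split; simpl; [lra|exact I].
    - contradiction. }
  destruct Hr as [r [Hr1 Hr2]]. pose proof (Cmod_ge_0 u) as Hu0.
  destruct (bounded_inside_radius a r) as [M HM]; [lra|assumption|].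
  apply Rbar_lt_le_trans with (Finite ((1 + r) / (1 + Cmod u))).
  - simpl. apply Rmult_lt_reg_r with (1 + Cmod u); [lra|]. field_simplify; lra.
  - apply CV_radius_ge_of_bounded with M. intros n.
    eapply Rle_trans; [|apply (HM n)].
    rewrite Rabs_mult, <- RPow_abs.
    rewrite (Rabs_pos_eq ((1 + r) / (1 + Cmod u))).
    2:{ apply Rlt_le, Rdiv_lt_0_compat; lra. }
    eapply Rle_trans.
    { apply Rmult_le_compat_r; [apply pow_le; apply Rlt_le, Rdiv_lt_0_compat; lra|apply Hd]. }
    rewrite Rmult_assoc, <- Rpow_mult_distr. apply Rmult_le_compat_l; [apply Rabs_pos|].
    apply pow_incr. split.
    + apply Rmult_le_pos; [lra|apply Rlt_le, Rdiv_lt_0_compat; lra].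
    + apply Rmult_le_reg_r with (1 + Cmod u); [lra|]. field_simplify; [nra|lra].
Qed.

Lemma PSeries_1 (a : nat -> R) : PSeries a 1 = Series a.
Proof. unfold PSeries. apply Series_ext. intros n. rewrite pow1. ring. Qed.

Lemma Re_pow_coef_le (a : nat -> R) (u : C) n :
  Rabs (a n * Re (u ^ n)%C) <= Rabs (a n) * Cmod u ^ n.
Proof.
  rewrite Rabs_mult, <- Cmod_pow. apply Rmult_le_compat_l; [apply Rabs_pos|apply re_le_Cmod].
Qed.

Lemma Im_pow_coef_le (a : nat -> R) (u : C) n :
  Rabs (a n * Im (u ^ n)%C) <= Rabs (a n) * Cmod u ^ n.
Proof.
  rewrite Rabs_mult, <- Cmod_pow. apply Rmult_le_compat_l; [apply Rabs_pos|apply Im_le_Cmod].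
Qed.

Lemma PSeries_correct_1 (a : nat -> R) : Rbar_lt 1 (CV_radius a) -> is_series a (PSeries a 1).
Proof.
  intros H. rewrite PSeries_1. apply Series_correct.
  apply (ex_series_ext (fun n => a n * 1 ^ n)); [intros n; rewrite pow1; apply Rmult_1_r|].
  rewrite <- Rabs_R1 in H. apply CV_disk_inside in H.
  apply ex_series_Rabs in H. exact H.
Qed.

(** * Exponentials of power series *)

Definition re_coef (b : nat -> R) (u : C) (n : nat) : R := b n * Re (u ^ n)%C.
Definition im_coef (b : nat -> R) (u : C) (n : nat) : R := b n * Im (u ^ n)%C.

(** Real and imaginary parts along the ray [x u] are real power series in [x],
    and the recurrence [b' = c' b] becomes a linear system for them. *)
Lemma exp_pseries_rec (b c : nat -> R) (u : C) :
  (forall n, PS_derive b n = PS_mult (PS_derive c) b n) -> forall n,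
  let br := re_coef b u in let bi := im_coef b u in
  let cr := re_coef c u in let ci := im_coef c u in
  PS_derive br n = PS_mult (PS_derive cr) br n - PS_mult (PS_derive ci) bi n /\
  PS_derive bi n = PS_mult (PS_derive cr) bi n + PS_mult (PS_derive ci) br n.
Proof.
  intros rec n br bi cr ci. pose proof (rec n) as Hn. unfold PS_mult in *.
  rewrite <- minus_sum, <- plus_sum.
  unfold PS_derive in *. unfold br, bi, cr, ci, re_coef, im_coef.
  rewrite <- !(Rmult_assoc (INR (S n))), Hn.
  rewrite !(Rmult_comm (sum_f_R0 _ n)), !scal_sum.
  split; apply sum_eq; intros k Hk.
  all: replace (u ^ S n)%C with (u ^ S k * u ^ (n - k))%C
    by (rewrite <- Cpow_add_r; f_equal; lia).
  all: destruct (u ^ S k)%C as [p q], (u ^ (n - k))%C as [p' q']; simpl; ring.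
Qed.

Lemma exp_pseries_value (b c : nat -> R) (u : C) :
  c O = 0 -> b O = 1 -> (forall n, PS_derive b n = PS_mult (PS_derive c) b n) ->
  Rbar_lt (Cmod u) (CV_radius b) -> Rbar_lt (Cmod u) (CV_radius c) ->
  let br := re_coef b u in let bi := im_coef b u in
  let cr := re_coef c u in let ci := im_coef c u in
  PSeries br 1 = exp (PSeries cr 1) * cos (PSeries ci 1) /\
  PSeries bi 1 = exp (PSeries cr 1) * sin (PSeries ci 1).
Proof.
  intros c0 b0 rec ub uc br bi cr ci.
  assert (Hbr : Rbar_lt 1 (CV_radius br))
    by (apply radius_dominated with b u; [exact ub|apply Re_pow_coef_le]).
  assert (Hbi : Rbar_lt 1 (CV_radius bi))
    by (apply radius_dominated with b u; [exact ub|apply Im_pow_coef_le]).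
  assert (Hcr : Rbar_lt 1 (CV_radius cr))
    by (apply radius_dominated with c u; [exact uc|apply Re_pow_coef_le]).
  assert (Hci : Rbar_lt 1 (CV_radius ci))
    by (apply radius_dominated with c u; [exact uc|apply Im_pow_coef_le]).
  assert (HR : forall a x, 0 <= x <= 1 -> Rbar_lt 1 (CV_radius a) -> Rbar_lt (Rabs x) (CV_radius a)).
  { intros a x Hx Ha. eapply Rbar_le_lt_trans; [|exact Ha]. simpl. rewrite Rabs_pos_eq; lra. }
  set (P := PSeries br). set (Q := PSeries bi). set (X := PSeries cr). set (Y := PSeries ci).
  assert (HP : forall x, 0 <= x <= 1 -> is_derive P x
     (PSeries (PS_derive cr) x * P x - PSeries (PS_derive ci) x * Q x)).
  { intros x Hx. unfold P, Q.
    rewrite <- !PSeries_mult by (try rewrite CV_radius_derive; apply HR; assumption).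
    rewrite <- PSeries_minus.
    2,3: apply ex_pseries_mult; try rewrite CV_radius_derive; apply HR; assumption.
    rewrite (PSeries_ext _ (PS_derive br)).
    2:{ intros n. destruct (exp_pseries_rec b c u rec n) as [E _]. symmetry; exact E. }
    apply is_derive_PSeries. apply HR; assumption. }
  assert (HQ : forall x, 0 <= x <= 1 -> is_derive Q x
     (PSeries (PS_derive cr) x * Q x + PSeries (PS_derive ci) x * P x)).
  { intros x Hx. unfold P, Q.
    rewrite <- !PSeries_mult by (try rewrite CV_radius_derive; apply HR; assumption).
    rewrite <- PSeries_plus.
    2,3: apply ex_pseries_mult; try rewrite CV_radius_derive; apply HR; assumption.
    rewrite (PSeries_ext _ (PS_derive bi)).
    2:{ intros n. destruct (exp_pseries_rec b c u rec n) as [_ E]. symmetry; exact E. }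
    apply is_derive_PSeries. apply HR; assumption. }
  assert (HX : forall x, 0 <= x <= 1 -> is_derive X x (PSeries (PS_derive cr) x))
    by (intros; apply is_derive_PSeries, HR; assumption).
  assert (HY : forall x, 0 <= x <= 1 -> is_derive Y x (PSeries (PS_derive ci) x))
    by (intros; apply is_derive_PSeries, HR; assumption).
  assert (I : P 0 = 1 /\ Q 0 = 0 /\ X 0 = 0 /\ Y 0 = 0).
  { unfold P, Q, X, Y. rewrite !PSeries_0. unfold br, bi, cr, ci, re_coef, im_coef.
    simpl. rewrite c0, b0. repeat split; ring. }
  destruct I as [I1 [I2 [I3 I4]]].
  assert (W1 : exp (- X 1) * (P 1 * cos (Y 1) + Q 1 * sin (Y 1)) = 1).
  { transitivity (exp (- X 0) * (P 0 * cos (Y 0) + Q 0 * sin (Y 0))).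
    - apply (zero_derivative_const (fun x => exp (- X x) * (P x * cos (Y x) + Q x * sin (Y x)))); [lra|].
      intros x Hx. specialize (HP x Hx); specialize (HQ x Hx); specialize (HX x Hx); specialize (HY x Hx).
      auto_derive; [repeat split; eexists; eassumption|].
      subst_derive. ring.
    - rewrite I1, I2, I3, I4, Ropp_0, exp_0, cos_0, sin_0. ring. }
  assert (W2 : exp (- X 1) * (Q 1 * cos (Y 1) - P 1 * sin (Y 1)) = 0).
  { transitivity (exp (- X 0) * (Q 0 * cos (Y 0) - P 0 * sin (Y 0))).
    - apply (zero_derivative_const (fun x => exp (- X x) * (Q x * cos (Y x) - P x * sin (Y x)))); [lra|].
      intros x Hx. specialize (HP x Hx); specialize (HQ x Hx); specialize (HX x Hx); specialize (HY x Hx).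
      auto_derive; [repeat split; eexists; eassumption|].
      subst_derive. ring.
    - rewrite I1, I2, I3, I4, Ropp_0, exp_0, cos_0, sin_0. ring. }
  assert (E : exp (X 1) * exp (- X 1) = 1) by (rewrite <- exp_plus, Rplus_opp_r, exp_0; reflexivity).
  pose proof (sin2_cos2 (Y 1)) as T. unfold Rsqr in T.
  set (e := exp (X 1)) in *. set (e' := exp (- X 1)) in *.
  set (co := cos (Y 1)) in *. set (si := sin (Y 1)) in *.
  split.
  - transitivity (e * co * (e' * (P 1 * co + Q 1 * si)) - e * si * (e' * (Q 1 * co - P 1 * si))).
    + transitivity ((e * e') * P 1 * (si * si + co * co)); [rewrite E, T|]; ring.
    + rewrite W1, W2. ring.
  - transitivity (e * si * (e' * (P 1 * co + Q 1 * si)) + e * co * (e' * (Q 1 * co - P 1 * si))).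
    + transitivity ((e * e') * Q 1 * (si * si + co * co)); [rewrite E, T|]; ring.
    + rewrite W1, W2. ring.
Qed.

(** Both sides solve the same linear differential equation along the ray [x u]:
    multiplied by the inverse of the right-hand side, the left-hand side has
    derivative zero in [x], because the hypothesis says [b' = c' b]. *)
Lemma exp_pseries (b c : nat -> R) (u : C) :
  c O = 0 -> b O = 1 -> (forall n, PS_derive b n = PS_mult (PS_derive c) b n) ->
  Rbar_lt (Cmod u) (CV_radius b) -> Rbar_lt (Cmod u) (CV_radius c) ->
  Cser (fun n => (RtoC (b n) * u ^ n)%C) (Cexp (Csum (fun n => (RtoC (c n) * u ^ n)%C))).
Proof.
  intros c0 b0 rec ub uc.
  destruct (exp_pseries_value b c u c0 b0 rec ub uc) as [H1 H2].
  set (br := re_coef b u) in *. set (bi := im_coef b u) in *.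
  set (cr := re_coef c u) in *. set (ci := im_coef c u) in *.
  assert (Hbr : Rbar_lt 1 (CV_radius br))
    by (apply radius_dominated with b u; [exact ub|apply Re_pow_coef_le]).
  assert (Hbi : Rbar_lt 1 (CV_radius bi))
    by (apply radius_dominated with b u; [exact ub|apply Im_pow_coef_le]).
  assert (E : Csum (fun n => (RtoC (c n) * u ^ n)%C) = (PSeries cr 1, PSeries ci 1)).
  { unfold Csum. rewrite !PSeries_1. unfold cr, ci, re_coef, im_coef. f_equal; apply Series_ext; intros n; destruct (u ^ n)%C; simpl; ring. }
  rewrite E. split; unfold Cexp; simpl.
  - rewrite <- H1. eapply is_series_ext; [|apply PSeries_correct_1, Hbr].
    intros n. unfold br, re_coef. destruct (u ^ n)%C; simpl. ring.
  - rewrite <- H2. eapply is_series_ext; [|apply PSeries_correct_1, Hbi].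
    intros n. unfold bi, im_coef. destruct (u ^ n)%C; simpl. ring.
Qed.

Lemma le_div_of_mul_le a b c : 0 < c -> a * c <= b -> a <= b / c.
Proof. intros Hc H. apply (Rle_div_r a b c Hc). exact H. Qed.

Lemma div_le_of_le_mul a b c : 0 < c -> a <= b * c -> a / c <= b.
Proof. intros Hc H. apply (Rle_div_l a b c Hc). exact H. Qed.

(** * The ring of formal power series and its derivation *)

Definition PS_zero : nat -> R := fun _ => 0.
Definition PS_add (a b : nat -> R) : nat -> R := fun n => a n + b n.
Definition PS_neg (a : nat -> R) : nat -> R := fun n => - a n.
Definition PS_sub (a b : nat -> R) : nat -> R := fun n => a n - b n.
Definition PS_cst (x : R) (a : nat -> R) : nat -> R := fun n => x * a n.

Lemma sum_reverse (f : nat -> R) n :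
  sum_f_R0 f n = sum_f_R0 (fun k => f (n - k)%nat) n.
Proof.
  revert f. induction n as [|n IH]; intros f; [reflexivity|].
  rewrite decomp_sum by lia. rewrite (tech5 (fun k => f (S n - k)%nat)), Nat.sub_diag.
  simpl pred. rewrite (IH (fun i => f (S i))). rewrite Rplus_comm. f_equal.
  apply sum_eq. intros k Hk. f_equal. lia.
Qed.

Lemma PS_mult_comm a b : PS_mult a b = PS_mult b a.
Proof.
  extensionality n. unfold PS_mult. rewrite sum_reverse.
  apply sum_eq. intros k Hk. replace (n - (n - k))%nat with k by lia. apply Rmult_comm.
Qed.

Lemma sum_triangle (F : nat -> nat -> R) n :
  sum_f_R0 (fun k => sum_f_R0 (fun j => F j (k - j)%nat) k) n =
  sum_f_R0 (fun j => sum_f_R0 (fun i => F j i) (n - j)) n.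
Proof.
  induction n as [|n IH]; [reflexivity|].
  rewrite tech5, IH. rewrite (tech5 (fun j => sum_f_R0 (fun i => F j i) (S n - j))), (tech5 (fun j => F j (S n - j)%nat) n).
  rewrite Nat.sub_diag. rewrite <- Rplus_assoc, <- plus_sum. simpl (sum_f_R0 _ 0). f_equal.
  apply sum_eq. intros j Hj. replace (S n - j)%nat with (S (n - j)) by lia. reflexivity.
Qed.

Lemma PS_mult_assoc a b c : PS_mult a (PS_mult b c) = PS_mult (PS_mult a b) c.
Proof.
  extensionality n. unfold PS_mult.
  transitivity (sum_f_R0 (fun k => sum_f_R0 (fun j => a j * b (k - j)%nat * c (n - j - (k - j))%nat) k) n).
  - rewrite (sum_triangle (fun j i => a j * b i * c (n - j - i)%nat)).
    apply sum_eq. intros j Hj. rewrite scal_sum. apply sum_eq. intros i Hi. ring.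
  - apply sum_eq. intros k Hk. rewrite (Rmult_comm (sum_f_R0 _ k)), scal_sum. apply sum_eq. intros j Hj.
    f_equal. f_equal. lia.
Qed.

Lemma PS_mult_1_l a : PS_mult PS_one a = a.
Proof.
  rewrite PS_mult_comm. extensionality n. apply PS_mult_one_upto. reflexivity.
Qed.

Lemma PS_mult_plus_l a b c :
  PS_mult (PS_add a b) c = PS_add (PS_mult a c) (PS_mult b c).
Proof.
  extensionality n. unfold PS_mult, PS_add. simpl.
  rewrite <- plus_sum. apply sum_eq. intros k _. ring.
Qed.


(** Pointwise equality of sequences is Leibniz equality by functional
    extensionality, so that [ring] works on formal power series. *)
Lemma PS_ring : ring_theory PS_zero PS_one PS_add PS_mult PS_sub PS_neg eq.
Proof.
  constructor; intros; try (extensionality n; unfold PS_add, PS_neg, PS_zero, PS_sub; ring).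
  - apply PS_mult_1_l.
  - apply PS_mult_comm.
  - apply PS_mult_assoc.
  - apply PS_mult_plus_l.
Qed.

Add Ring PS_ring_inst : PS_ring.

(** The derivation [q d/dq]. *)
Definition PS_D (a : nat -> R) : nat -> R := fun k => INR k * a k.

Lemma PS_D_mult a b : PS_D (PS_mult a b) = PS_add (PS_mult (PS_D a) b) (PS_mult a (PS_D b)).
Proof.
  extensionality n. unfold PS_D, PS_mult, PS_add.
  rewrite scal_sum, <- plus_sum. apply sum_eq. intros k Hk.
  replace (INR n) with (INR k + INR (n - k)) by (rewrite <- plus_INR; f_equal; lia). ring.
Qed.

(** The monomial [q^m]. *)
Definition PS_X (m : nat) : nat -> R := fun k => if Nat.eqb k m then 1 else 0.

Lemma PS_mult_X m a k :
  PS_mult (PS_X m) a k = if Nat.leb m k then a (k - m)%nat else 0.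
Proof.
  unfold PS_mult.
  assert (H : forall n, sum_f_R0 (fun i => PS_X m i * a (k - i)%nat) n =
     if Nat.leb m n then a (k - m)%nat else 0).
  { induction n as [|n IH].
    - simpl. unfold PS_X. destruct (Nat.eqb_spec 0 m) as [<-|h]; simpl; [ring|].
      destruct m; [lia|]. simpl. ring.
    - rewrite tech5, IH. unfold PS_X.
      destruct (Nat.leb_spec m n), (Nat.eqb_spec (S n) m), (Nat.leb_spec m (S n)); try lia; subst; ring. }
  apply H.
Qed.

Lemma one_minus_q_X m : (1 <= m)%nat -> one_minus_q m = PS_sub PS_one (PS_X m).
Proof.
  intros Hm. extensionality k. unfold one_minus_q, PS_sub, PS_add, PS_neg, PS_one, PS_X.
  destruct (Nat.eqb_spec k 0), (Nat.eqb_spec k m); try lia; ring.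
Qed.

Lemma one_plus_q_X m : (1 <= m)%nat -> one_plus_q m = PS_add PS_one (PS_X m).
Proof.
  intros Hm. extensionality k. unfold one_plus_q, PS_add, PS_one, PS_X.
  destruct (Nat.eqb_spec k 0), (Nat.eqb_spec k m); try lia; simpl; ring.
Qed.

Lemma PS_D_X m : PS_D (PS_X m) = PS_cst (INR m) (PS_X m).
Proof.
  extensionality k. unfold PS_D, PS_X, PS_cst.
  destruct (Nat.eqb_spec k m); subst; ring.
Qed.

Lemma PS_D_plus a b : PS_D (PS_add a b) = PS_add (PS_D a) (PS_D b).
Proof. extensionality k. unfold PS_D, PS_add. ring. Qed.

Lemma PS_D_sub a b : PS_D (PS_sub a b) = PS_sub (PS_D a) (PS_D b).
Proof. extensionality k. unfold PS_D, PS_sub. ring. Qed.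

Lemma PS_D_one : PS_D PS_one = PS_zero.
Proof.
  extensionality k. unfold PS_D, PS_one, PS_zero. destruct k; simpl; ring.
Qed.

(** * The logarithmic derivative of the generating function *)

(** The coefficients of [q d/dq log ((1 + q^m) / (1 - q^m))], that is, of
    [2 m (q^m + q^(3 m) + q^(5 m) + ...)]. *)
Definition log_der (m k : nat) : R :=
  if (Nat.eqb (k mod m) 0 && Nat.odd (k / m))%bool then 2 * INR m else 0.

Lemma log_der_small m k : (k < m)%nat -> log_der m k = 0.
Proof.
  intros H. unfold log_der. rewrite Nat.div_small by lia. simpl.
  now rewrite Bool.andb_false_r.
Qed.

Lemma log_der_shift m k : (1 <= m)%nat -> log_der m (k + 2 * m) = log_der m k.
Proof.
  intros H. unfold log_der. rewrite Nat.Div0.mod_add, Nat.div_add by lia.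
  rewrite Nat.odd_add. simpl (Nat.odd 2). now rewrite Bool.xorb_false_r.
Qed.

(** [(q^m + q^(3 m) + ...) (1 - q^(2 m)) = q^m]. *)
Lemma log_der_mult m : (1 <= m)%nat ->
  PS_mult (log_der m) (PS_mult (one_plus_q m) (one_minus_q m)) = PS_cst (2 * INR m) (PS_X m).
Proof.
  intros Hm. rewrite one_plus_q_X, one_minus_q_X by assumption.
  transitivity (PS_sub (log_der m) (PS_mult (PS_X m) (PS_mult (PS_X m) (log_der m)))); [ring|].
  extensionality k. unfold PS_sub, PS_add, PS_neg, PS_cst.
  rewrite !PS_mult_X.
  destruct (Nat.leb_spec m k) as [h|h].
  - destruct (Nat.leb_spec m (k - m)) as [h'|h'].
    + replace (log_der m k) with (log_der m (k - m - m)%nat).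
      2:{ rewrite <- (log_der_shift m (k - m - m)) by assumption. f_equal. lia. }
      unfold PS_X. destruct (Nat.eqb_spec k m); [lia|]. ring.
    + assert (E : (k / m = 1)%nat).
      { symmetry. apply Nat.div_unique with (k - m)%nat; lia. }
      assert (E' : (k mod m = k - m)%nat).
      { symmetry. apply Nat.mod_unique with 1%nat; lia. }
      unfold log_der, PS_X. rewrite E, E'.
      destruct (Nat.eqb_spec (k - m) 0), (Nat.eqb_spec k m); try lia; simpl; ring.
  - rewrite log_der_small by lia. unfold PS_X. destruct (Nat.eqb_spec k m); [lia|ring].
Qed.

Lemma one_minus_q_mult_inv m : (1 <= m)%nat -> PS_mult (one_minus_q m) (inv_one_minus_q m) = PS_one.
Proof. intros H. extensionality k. now apply one_minus_q_inv. Qed.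

(** Division is by multiplication with [inv_one_minus_q], the inverse of
    [one_minus_q]. *)
Lemma PS_D_quotient m : (1 <= m)%nat ->
  PS_D (PS_mult (one_plus_q m) (inv_one_minus_q m)) =
  PS_mult (log_der m) (PS_mult (one_plus_q m) (inv_one_minus_q m)).
Proof.
  intros Hm. pose proof (one_minus_q_mult_inv m Hm) as H1.
  pose proof (log_der_mult m Hm) as H2.
  assert (H3 : PS_add (one_plus_q m) (one_minus_q m) = PS_add PS_one PS_one).
  { rewrite one_plus_q_X, one_minus_q_X by assumption. ring. }
  assert (Hop : PS_D (one_plus_q m) = PS_cst (INR m) (PS_X m)).
  { rewrite one_plus_q_X, PS_D_plus, PS_D_one, PS_D_X by assumption. ring. }
  assert (Hom : PS_D (one_minus_q m) = PS_neg (PS_cst (INR m) (PS_X m))).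
  { rewrite one_minus_q_X by assumption. rewrite PS_D_sub, PS_D_one, PS_D_X. ring. }
  set (op := one_plus_q m) in *. set (om := one_minus_q m) in *.
  set (iv := inv_one_minus_q m) in *. set (M := PS_cst (INR m) (PS_X m)) in *.
  assert (Hw : PS_mult (log_der m) (PS_mult op om) = PS_add M M).
  { rewrite H2. unfold M. extensionality k. unfold PS_add, PS_cst. ring. }
  assert (Hiv : PS_D iv = PS_mult (PS_mult iv iv) M).
  { assert (E : PS_D (PS_mult om iv) = PS_zero) by (rewrite H1; apply PS_D_one).
    rewrite PS_D_mult, Hom in E.
    transitivity (PS_mult (PS_mult om iv) (PS_D iv)); [rewrite H1; ring|].
    transitivity (PS_mult iv (PS_sub (PS_add (PS_mult (PS_neg M) iv) (PS_mult om (PS_D iv)))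
       (PS_mult (PS_neg M) iv))); [ring|]. rewrite E. ring. }
  rewrite PS_D_mult, Hop, Hiv.
  transitivity (PS_mult (PS_mult M (PS_mult iv iv)) (PS_add op om)).
  - transitivity (PS_add (PS_mult (PS_mult M iv) (PS_mult om iv)) (PS_mult op (PS_mult (PS_mult iv iv) M))).
    + rewrite H1. ring.
    + ring.
  - rewrite H3. transitivity (PS_mult (PS_mult (PS_mult iv iv) (PS_mult (log_der m) (PS_mult op om))) PS_one).
    + rewrite Hw. ring.
    + transitivity (PS_mult (PS_mult (PS_mult (log_der m) op) iv) (PS_mult om iv)); [ring|].
      rewrite H1. ring.
Qed.

Lemma PS_D_pow a d j : PS_D a = PS_mult d a ->
  PS_D (PS_pow a j) = PS_mult (PS_cst (INR j) d) (PS_pow a j).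
Proof.
  intros H. induction j as [|j IH].
  - simpl PS_pow. rewrite PS_D_one. extensionality k. rewrite PS_mult_comm, PS_mult_1_l.
    unfold PS_zero, PS_cst. simpl. ring.
  - simpl PS_pow. rewrite PS_D_mult, IH, H.
    replace (PS_cst (INR (S j)) d) with (PS_add (PS_cst (INR j) d) d); [ring|].
    extensionality k. unfold PS_add, PS_cst.
    rewrite S_INR. ring.
Qed.

Fixpoint log_der_sum (N k : nat) : R :=
  match N with
  | O => 0
  | S N' => log_der_sum N' k + INR N * log_der N k
  end.

Lemma PS_D_partial_prod N :
  PS_D (pp_partial_prod N) = PS_mult (log_der_sum N) (pp_partial_prod N).
Proof.
  induction N as [|N IH].
  - simpl pp_partial_prod. rewrite PS_D_one, PS_mult_comm, PS_mult_1_l. reflexivity.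
  - change (pp_partial_prod (S N)) with (PS_mult (pp_partial_prod N) (pp_factor (S N))).
    rewrite PS_D_mult, IH.
    unfold pp_factor. rewrite (PS_D_pow _ (log_der (S N))) by (apply PS_D_quotient; lia).
    replace (log_der_sum (S N)) with (PS_add (log_der_sum N) (PS_cst (INR (S N)) (log_der (S N))))
      by reflexivity.
    ring.
Qed.

(** The coefficients of the logarithm of the generating function, obtained by
    integrating its logarithmic derivative; in closed form
    [(2 / k) sum m^2] over the divisors [m] of [k] with [k / m] odd. *)
Definition pp_log_coef (k : nat) : R := log_der_sum k k / INR k.

(** Only the factors with [m <= k] contribute to the coefficient of [q^k]. *)
Lemma log_der_sum_stable N k : (k <= N)%nat -> log_der_sum N k = log_der_sum k k.
Proof.
  induction 1 as [|N HN IH]; [reflexivity|].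
  simpl log_der_sum at 1. rewrite IH, log_der_small by lia. ring.
Qed.

Lemma pp_log_coef_0 : pp_log_coef 0 = 0.
Proof. unfold pp_log_coef. simpl. unfold Rdiv. ring. Qed.

Lemma pp_rec n : PS_derive pp n = PS_mult (PS_derive pp_log_coef) pp n.
Proof.
  assert (H : PS_D (pp_partial_prod (S n)) (S n) =
    PS_mult (log_der_sum (S n)) (pp_partial_prod (S n)) (S n)) by now rewrite PS_D_partial_prod.
  unfold PS_D in H. unfold PS_derive at 1. unfold pp at 1. rewrite H.
  unfold PS_mult. rewrite decomp_sum by lia. simpl (pred (S n)).
  rewrite (log_der_sum_stable (S n) 0) by lia. simpl (log_der_sum 0 0). rewrite Rmult_0_l, Rplus_0_l.
  apply sum_eq. intros k Hk. rewrite log_der_sum_stable by lia.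
  change (S n - S k)%nat with (n - k)%nat. rewrite pp_partial_prod_stable by lia.
  unfold PS_derive, pp_log_coef. field. apply not_0_INR. lia.
Qed.

Lemma log_der_nonneg m k : 0 <= log_der m k.
Proof. unfold log_der. destruct andb; [|lra]. pose proof (pos_INR m). lra. Qed.

Lemma log_der_le m k : log_der m k <= 2 * INR m.
Proof. unfold log_der. pose proof (pos_INR m). destruct andb; lra. Qed.

Lemma log_der_sum_nonneg N k : 0 <= log_der_sum N k.
Proof.
  induction N as [|N IH]; [simpl; lra|].
  change (0 <= log_der_sum N k + INR (S N) * log_der (S N) k).
  pose proof (log_der_nonneg (S N) k). pose proof (pos_INR (S N)). nra.
Qed.

Lemma log_der_sum_le N k : log_der_sum N k <= 2 * INR N * (INR N * INR N).
Proof.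
  induction N as [|N IH]; [simpl; lra|].
  pose proof (log_der_le (S N) k). pose proof (log_der_nonneg (S N) k). pose proof (pos_INR N).
  change (log_der_sum N k + INR (S N) * log_der (S N) k <= 2 * INR (S N) * (INR (S N) * INR (S N))).
  rewrite S_INR in *.
  assert ((INR N + 1) * log_der (S N) k <= (INR N + 1) * (2 * (INR N + 1))) by (apply Rmult_le_compat_l; lra).
  nra.
Qed.

(** The contribution of the divisor [m = k]. *)
Lemma pp_log_coef_ge k : 2 * INR k <= pp_log_coef k.
Proof.
  destruct k as [|k]; [rewrite pp_log_coef_0; simpl; lra|].
  unfold pp_log_coef.
  assert (E : log_der (S k) (S k) = 2 * INR (S k)).
  { unfold log_der. rewrite Nat.Div0.mod_same, Nat.div_same by lia. reflexivity. }
  change (2 * INR (S k) <= (log_der_sum k (S k) + INR (S k) * log_der (S k) (S k)) / INR (S k)).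
  rewrite E. pose proof (log_der_sum_nonneg k (S k)).
  apply (Rle_div_r (2 * INR (S k)) _ (INR (S k))); [apply lt_0_INR; lia|lra].
Qed.

Lemma pp_log_coef_nonneg k : 0 <= pp_log_coef k.
Proof. pose proof (pp_log_coef_ge k). pose proof (pos_INR k). lra. Qed.

Lemma pp_log_coef_le k : pp_log_coef k <= 2 * (INR k * INR k).
Proof.
  destruct k as [|k]; [rewrite pp_log_coef_0; simpl; lra|].
  unfold pp_log_coef. pose proof (log_der_sum_le (S k) (S k)).
  apply Rle_div_l; [apply lt_0_INR; lia|lra].
Qed.

(** * The generating function inside the unit disc *)

Lemma CV_radius_ge_1 (a : nat -> R) :
  (forall r, 0 < r < 1 -> exists M, forall n, Rabs (a n) * r ^ n <= M) ->
  Rbar_le 1 (CV_radius a).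
Proof.
  intros H.
  assert (G : forall r, 0 < r < 1 -> Rbar_le r (CV_radius a)).
  { intros r Hr. destruct (H r Hr) as [M HM]. apply CV_radius_ge_of_bounded with M.
    intros n. rewrite Rabs_mult, <- RPow_abs, (Rabs_pos_eq r) by lra. apply HM. }
  pose proof (G (/2) ltac:(lra)) as G2.
  destruct (CV_radius a) as [x| |]; simpl in *; [|exact I|contradiction].
  destruct (Rle_lt_dec 1 x) as [h|h]; [exact h|].
  specialize (G ((1 + x) / 2) ltac:(lra)). simpl in G. lra.
Qed.

Lemma lt_CV_radius (a : nat -> R) x :
  Rbar_le 1 (CV_radius a) -> Rabs x < 1 -> Rbar_lt (Rabs x) (CV_radius a).
Proof. intros H Hx. eapply Rbar_lt_le_trans; [|exact H]. exact Hx. Qed.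

Lemma CV_radius_mult_ge_1 a b :
  Rbar_le 1 (CV_radius a) -> Rbar_le 1 (CV_radius b) -> Rbar_le 1 (CV_radius (PS_mult a b)).
Proof.
  intros Ha Hb. apply CV_radius_ge_1. intros r Hr.
  assert (Hr' : Rabs r < 1) by (rewrite Rabs_pos_eq; lra).
  destruct (ex_pseries_mult a b r) as [l Hl]; try (apply lt_CV_radius; assumption).
  apply is_pseries_R in Hl.
  destruct (is_lim_seq_bounded (fun n => PS_mult a b n * r ^ n) 0) as [M HM].
  { apply (ex_series_lim_0 (fun n => PS_mult a b n * r ^ n)). now exists l. }
  exists M. intros n. specialize (HM n).
  rewrite Rabs_mult, <- RPow_abs, (Rabs_pos_eq r) in HM by lra. exact HM.
Qed.

Lemma CV_radius_bounded_ge_1 a M : (forall n, Rabs (a n) <= M) -> Rbar_le 1 (CV_radius a).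
Proof.
  intros H. apply CV_radius_ge_1. intros r Hr. exists M. intros n.
  assert (0 <= M) by (eapply Rle_trans; [apply Rabs_pos|apply (H O)]).
  assert (0 <= r ^ n <= 1).
  { split; [apply pow_le; lra|]. rewrite <- (pow1 n). apply pow_incr. lra. }
  specialize (H n). pose proof (Rabs_pos (a n)). nra.
Qed.

Lemma CV_radius_PS_one : Rbar_le 1 (CV_radius PS_one).
Proof.
  apply CV_radius_bounded_ge_1 with 1. intros n. unfold PS_one.
  destruct Nat.eqb; rewrite Rabs_pos_eq; lra.
Qed.

Lemma CV_radius_one_plus m : Rbar_le 1 (CV_radius (one_plus_q m)).
Proof.
  apply CV_radius_bounded_ge_1 with 1. intros n. unfold one_plus_q.
  destruct orb; rewrite Rabs_pos_eq; lra.
Qed.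

Lemma CV_radius_one_minus m : Rbar_le 1 (CV_radius (one_minus_q m)).
Proof.
  apply CV_radius_bounded_ge_1 with 1. intros n. unfold one_minus_q.
  destruct Nat.eqb; [|destruct Nat.eqb]; unfold Rabs; destruct Rcase_abs; lra.
Qed.

Lemma CV_radius_inv_one_minus m : Rbar_le 1 (CV_radius (inv_one_minus_q m)).
Proof.
  apply CV_radius_bounded_ge_1 with 1. intros n. unfold inv_one_minus_q.
  destruct Nat.eqb; rewrite Rabs_pos_eq; lra.
Qed.

Lemma CV_radius_PS_pow a j : Rbar_le 1 (CV_radius a) -> Rbar_le 1 (CV_radius (PS_pow a j)).
Proof.
  intros H. induction j as [|j IH]; simpl; [apply CV_radius_PS_one|].
  now apply CV_radius_mult_ge_1.
Qed.

Lemma CV_radius_quotient m :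
  Rbar_le 1 (CV_radius (PS_mult (one_plus_q m) (inv_one_minus_q m))).
Proof. apply CV_radius_mult_ge_1; [apply CV_radius_one_plus|apply CV_radius_inv_one_minus]. Qed.

Lemma CV_radius_partial_prod N : Rbar_le 1 (CV_radius (pp_partial_prod N)).
Proof.
  induction N as [|N IH]; [apply CV_radius_PS_one|].
  apply (CV_radius_mult_ge_1 (pp_partial_prod N) (pp_factor (S N)) IH).
  apply CV_radius_PS_pow, CV_radius_quotient.
Qed.

Lemma PSeries_mult_ge_1 a b x : Rbar_le 1 (CV_radius a) -> Rbar_le 1 (CV_radius b) ->
  Rabs x < 1 -> PSeries (PS_mult a b) x = PSeries a x * PSeries b x.
Proof. intros Ha Hb Hx. apply PSeries_mult; now apply lt_CV_radius. Qed.

Lemma PSeries_PS_X m x : PSeries (PS_X m) x = x ^ m.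
Proof.
  apply is_pseries_unique, is_pseries_R.
  assert (H : is_series (fun n => PS_X m n * x ^ n) (sum_n (fun n => PS_X m n * x ^ n) m)).
  { apply (is_lim_seq_ext_loc (fun _ => sum_n (fun n => PS_X m n * x ^ n) m) _ (Finite (sum_n (fun n => PS_X m n * x ^ n) m))).
    2: apply is_lim_seq_const.
    exists m. intros n Hn. induction Hn as [|n Hn IH]; [reflexivity|]. rewrite sum_Sn, <- IH. unfold PS_X.
    destruct (Nat.eqb_spec (S n) m); [lia|].
    match goal with |- ?a = _ => change (@eq R a (a + 0 * (x * x ^ n))) end.
    rewrite Rmult_0_l. symmetry. apply Rplus_0_r. }
  replace (x ^ m) with (sum_n (fun n => PS_X m n * x ^ n) m); [exact H|].
  assert (G : forall n, (n < m)%nat -> sum_n (fun n => PS_X m n * x ^ n) n = 0).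
  { induction n as [|n IH]; intros Hn.
    - rewrite sum_O. unfold PS_X. destruct (Nat.eqb_spec 0 m); [lia|]. apply Rmult_0_l.
    - rewrite sum_Sn, IH by lia. unfold PS_X. destruct (Nat.eqb_spec (S n) m); [lia|].
      change (0 + 0 * x ^ S n = 0). ring. }
  destruct m as [|m].
  - rewrite sum_O. unfold PS_X. simpl. ring.
  - rewrite sum_Sn, G by lia. unfold PS_X. rewrite Nat.eqb_refl.
    change (0 + 1 * x ^ S m = x ^ S m). ring.
Qed.

Lemma CV_radius_PS_X m : Rbar_le 1 (CV_radius (PS_X m)).
Proof.
  apply CV_radius_bounded_ge_1 with 1. intros n. unfold PS_X.
  destruct Nat.eqb; rewrite Rabs_pos_eq; lra.
Qed.

Lemma PSeries_PS_one x : PSeries PS_one x = 1.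
Proof. change PS_one with (PS_X 0). rewrite PSeries_PS_X. reflexivity. Qed.

Lemma PSeries_one_plus m x : (1 <= m)%nat -> Rabs x < 1 -> PSeries (one_plus_q m) x = 1 + x ^ m.
Proof.
  intros Hm Hx. rewrite one_plus_q_X by assumption.
  rewrite <- (PSeries_PS_X m), <- (PSeries_PS_one x).
  apply (PSeries_plus PS_one (PS_X m) x); apply CV_radius_inside, lt_CV_radius;
  auto using CV_radius_PS_one, CV_radius_PS_X.
Qed.

Lemma PSeries_one_minus m x : (1 <= m)%nat -> Rabs x < 1 -> PSeries (one_minus_q m) x = 1 - x ^ m.
Proof.
  intros Hm Hx. rewrite one_minus_q_X by assumption.
  rewrite <- (PSeries_PS_X m), <- (PSeries_PS_one x).
  apply (PSeries_minus PS_one (PS_X m) x); apply CV_radius_inside, lt_CV_radius;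
  auto using CV_radius_PS_one, CV_radius_PS_X.
Qed.

Lemma pow_S_lt_1 q m : 0 <= q < 1 -> 0 <= q ^ S m <= q.
Proof.
  intros Hq. split; [apply pow_le; lra|]. simpl.
  assert (q ^ m <= 1) by (rewrite <- (pow1 m); apply pow_incr; lra).
  assert (0 <= q ^ m) by (apply pow_le; lra). nra.
Qed.

Definition log_quot (x : R) : R := ln ((1 + x) / (1 - x)).

Lemma PSeries_quotient m q : 0 <= q < 1 ->
  PSeries (PS_mult (one_plus_q (S m)) (inv_one_minus_q (S m))) q = exp (log_quot (q ^ S m)).
Proof.
  intros Hq. assert (Hq' : Rabs q < 1) by (rewrite Rabs_pos_eq; lra).
  pose proof (pow_S_lt_1 q m Hq).
  rewrite PSeries_mult_ge_1, PSeries_one_plus by (auto using CV_radius_one_plus, CV_radius_inv_one_minus; lia).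
  unfold log_quot. rewrite exp_ln by (apply Rdiv_lt_0_compat; lra).
  unfold Rdiv. f_equal.
  assert (E : PSeries (PS_mult (one_minus_q (S m)) (inv_one_minus_q (S m))) q = 1).
  { rewrite one_minus_q_mult_inv by lia. apply PSeries_PS_one. }
  rewrite PSeries_mult_ge_1, PSeries_one_minus in E
    by (auto using CV_radius_one_minus, CV_radius_inv_one_minus; lia).
  apply Rmult_eq_reg_l with (1 - q ^ S m); [rewrite E; field|]; lra.
Qed.

Lemma PSeries_PS_pow a j x : Rbar_le 1 (CV_radius a) -> Rabs x < 1 ->
  PSeries (PS_pow a j) x = PSeries a x ^ j.
Proof.
  intros Ha Hx. induction j as [|j IH]; [apply PSeries_PS_one|].
  simpl PS_pow. rewrite PSeries_mult_ge_1, IH by (auto using CV_radius_PS_pow). reflexivity.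
Qed.

Lemma exp_le_compat x y : x <= y -> exp x <= exp y.
Proof. intros [H|H]; [left; now apply exp_increasing|right; now rewrite H]. Qed.

Lemma exp_INR_mult n x : exp x ^ n = exp (INR n * x).
Proof.
  induction n as [|n IH]; [simpl; rewrite Rmult_0_l, exp_0; reflexivity|].
  simpl pow. rewrite IH, <- exp_plus, S_INR. f_equal. ring.
Qed.

Lemma PSeries_partial_prod N q : 0 <= q < 1 ->
  PSeries (pp_partial_prod (S N)) q =
  exp (sum_f_R0 (fun i => INR (S i) * log_quot (q ^ S i)) N).
Proof.
  intros Hq. assert (Hq' : Rabs q < 1) by (rewrite Rabs_pos_eq; lra).
  assert (F : forall m, PSeries (pp_factor (S m)) q = exp (INR (S m) * log_quot (q ^ S m))).
  { intros m. unfold pp_factor. rewrite PSeries_PS_pow, PSeries_quotient by (auto using CV_radius_quotient).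
    apply exp_INR_mult. }
  assert (G : forall m, Rbar_le 1 (CV_radius (pp_factor m)))
    by (intros m; apply CV_radius_PS_pow, CV_radius_quotient).
  induction N as [|N IH].
  - change (pp_partial_prod 1) with (PS_mult PS_one (pp_factor 1)).
    rewrite PS_mult_1_l, F. reflexivity.
  - change (pp_partial_prod (S (S N))) with (PS_mult (pp_partial_prod (S N)) (pp_factor (S (S N)))).
    rewrite PSeries_mult_ge_1 by (auto using CV_radius_partial_prod).
    rewrite IH, F, <- exp_plus. reflexivity.
Qed.

Lemma log_quot_le x : 0 <= x < 1 -> log_quot x <= 2 * x / (1 - x).
Proof.
  intros Hx. unfold log_quot.
  assert (0 < (1 + x) / (1 - x)) by (apply Rdiv_lt_0_compat; lra).
  replace (2 * x / (1 - x)) with ((1 + x) / (1 - x) - 1) by (field; lra).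
  set (y := (1 + x) / (1 - x)) in *.
  pose proof (exp_ineq1_le (ln y)) as E. rewrite exp_ln in E by assumption. lra.
Qed.

Lemma log_quot_nonneg x : 0 <= x < 1 -> 0 <= log_quot x.
Proof.
  intros Hx. unfold log_quot. rewrite <- ln_1. apply Rcomplements.ln_le; [lra|].
  apply Rle_div_r; lra.
Qed.

Lemma CV_radius_INR_ge_1 : Rbar_le 1 (CV_radius (fun n => INR (S n))).
Proof.
  rewrite <- (CV_radius_ext (PS_derive (fun _ => 1))).
  - rewrite CV_radius_derive. apply CV_radius_bounded_ge_1 with 1. intros. rewrite Rabs_R1. lra.
  - intros n. unfold PS_derive. apply Rmult_1_r.
Qed.

Lemma CV_radius_INR2_ge_1 : Rbar_le 1 (CV_radius (fun n => INR (S n) * INR (S (S n)))).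
Proof.
  rewrite <- (CV_radius_ext (PS_derive (fun n => INR (S n)))).
  - rewrite CV_radius_derive. apply CV_radius_INR_ge_1.
  - intros n. reflexivity.
Qed.

Lemma sum_le_Series (a : nat -> R) N : (forall n, 0 <= a n) -> ex_series a ->
  sum_f_R0 a N <= Series a.
Proof.
  intros Ha H. rewrite <- sum_n_Reals. 
  apply (is_lim_seq_incr_compare (sum_n a) (Series a)).
  - apply Series_correct in H. exact H.
  - intros n. rewrite sum_Sn. change (sum_n a n <= sum_n a n + a (S n)). specialize (Ha (S n)). lra.
Qed.

(** [log ((1 + x) / (1 - x)) <= 2 x / (1 - x)] reduces the claim to the
    convergence of [sum m q^m]. *)
Lemma PSeries_partial_prod_bounded q : 0 <= q < 1 ->
  exists K, forall N, PSeries (pp_partial_prod (S N)) q <= K.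
Proof.
  intros Hq. assert (Hq' : Rabs q < 1) by (rewrite Rabs_pos_eq; lra).
  pose (g := fun n => INR (S n) * q ^ n).
  assert (Hg0 : forall n, 0 <= g n).
  { intros n. unfold g. apply Rmult_le_pos; [apply pos_INR|apply pow_le; lra]. }
  assert (Hg : ex_series g).
  { apply (ex_pseries_R (fun n => INR (S n)) q). apply CV_radius_inside, lt_CV_radius; auto using CV_radius_INR_ge_1. }
  exists (exp (2 / (1 - q) * Series g)). intros N. rewrite PSeries_partial_prod by assumption.
  apply exp_le_compat. eapply Rle_trans; [|apply Rmult_le_compat_l; [|apply (sum_le_Series g N Hg0 Hg)]].
  2:{ apply Rlt_le, Rdiv_lt_0_compat; lra. }
  rewrite scal_sum. apply sum_Rle. intros n _. pose proof (pow_S_lt_1 q n Hq).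
  unfold g. rewrite Rmult_assoc. apply Rmult_le_compat_l; [apply pos_INR|].
  eapply Rle_trans; [apply log_quot_le; lra|].
  assert (0 < / (1 - q)) by (apply Rinv_0_lt_compat; lra).
  assert (/ (1 - q ^ S n) <= / (1 - q)) by (apply Rinv_le_contravar; lra).
  assert (0 <= q ^ n) by (apply pow_le; lra).
  assert (q ^ S n <= q ^ n) by (simpl; nra).
  unfold Rdiv. rewrite (Rmult_comm (q ^ n)), !Rmult_assoc.
  apply Rmult_le_compat_l; [lra|]. rewrite (Rmult_comm (/ (1 - q))).
  apply Rmult_le_compat; try lra. apply Rlt_le, Rinv_0_lt_compat. lra.
Qed.

Lemma PS_mult_nonneg a b : (forall n, 0 <= a n) -> (forall n, 0 <= b n) ->
  forall n, 0 <= PS_mult a b n.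
Proof.
  intros Ha Hb n. unfold PS_mult. apply cond_pos_sum. intros k. now apply Rmult_le_pos.
Qed.

Lemma PS_pow_nonneg a j : (forall n, 0 <= a n) -> forall n, 0 <= PS_pow a j n.
Proof.
  intros Ha. induction j as [|j IH]; simpl.
  - intros n. unfold PS_one. destruct Nat.eqb; lra.
  - now apply PS_mult_nonneg.
Qed.

Lemma pp_factor_nonneg m n : 0 <= pp_factor m n.
Proof.
  apply PS_pow_nonneg. apply PS_mult_nonneg; intros k.
  - unfold one_plus_q. destruct orb; lra.
  - unfold inv_one_minus_q. destruct Nat.eqb; lra.
Qed.

Lemma pp_factor_0 m : pp_factor m 0 = 1.
Proof.
  unfold pp_factor. 
  assert (H : forall a j, a 0%nat = 1 -> PS_pow a j 0 = 1).
  { intros a j Ha. induction j as [|j IH]; [reflexivity|]. simpl. unfold PS_mult. simpl.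
    rewrite Ha, IH. ring. }
  apply H. unfold PS_mult. simpl. unfold one_plus_q, inv_one_minus_q.
  rewrite Nat.Div0.mod_0_l. simpl. ring.
Qed.

Lemma pp_partial_prod_nonneg N n : 0 <= pp_partial_prod N n.
Proof.
  revert n. induction N as [|N IH].
  - intros n. simpl. unfold PS_one. destruct Nat.eqb; lra.
  - simpl pp_partial_prod. apply PS_mult_nonneg; [exact IH|apply pp_factor_nonneg].
Qed.

Lemma pp_nonneg n : 0 <= pp n.
Proof. apply pp_partial_prod_nonneg. Qed.

Lemma pp_partial_prod_S_ge N n : pp_partial_prod N n <= pp_partial_prod (S N) n.
Proof.
  simpl pp_partial_prod. unfold PS_mult.
  assert (T : pp_partial_prod N n * pp_factor (S N) (n - n)%nat = pp_partial_prod N n)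
    by (rewrite Nat.sub_diag, pp_factor_0; ring).
  destruct n as [|n].
  - simpl. rewrite <- T at 1. simpl. lra.
  - rewrite tech5, T. 
    assert (0 <= sum_f_R0 (fun k => pp_partial_prod N k * pp_factor (S N) (S n - k)%nat) n).
    { apply cond_pos_sum. intros k. apply Rmult_le_pos; [apply pp_partial_prod_nonneg|apply pp_factor_nonneg]. }
    lra.
Qed.

Lemma pp_partial_prod_le_pp N n : pp_partial_prod N n <= pp n.
Proof.
  destruct (le_lt_dec n N) as [h|h].
  - rewrite pp_partial_prod_stable by assumption. lra.
  - unfold pp. induction h as [|k h IH]; [apply pp_partial_prod_S_ge|].
    assert (G : forall j, pp_partial_prod N (S k) <= pp_partial_prod (N + j) (S k)).
    { induction j as [|j IHj]; [rewrite Nat.add_0_r; lra|].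
      rewrite Nat.add_succ_r. eapply Rle_trans; [exact IHj|apply pp_partial_prod_S_ge]. }
    replace (S k) with (N + (S k - N))%nat at 2 by lia. apply G.
Qed.

Lemma pp_0 : pp 0 = 1.
Proof. reflexivity. Qed.

(** The coefficient of [q^n] is already that of a finite product, and finite
    products are bounded at each [q < 1]. *)
Lemma CV_radius_pp : Rbar_le 1 (CV_radius pp).
Proof.
  apply CV_radius_ge_1. intros q Hq.
  destruct (PSeries_partial_prod_bounded q ltac:(lra)) as [K HK]. exists K. intros n.
  rewrite Rabs_pos_eq by apply pp_nonneg.
  eapply Rle_trans; [|apply (HK n)].
  assert (Hc : ex_series (fun k => pp_partial_prod (S n) k * q ^ k)).
  { apply (ex_pseries_R (pp_partial_prod (S n)) q). apply CV_radius_inside, lt_CV_radius;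
    [apply CV_radius_partial_prod|rewrite Rabs_pos_eq; lra]. }
  assert (Hp : forall k, 0 <= pp_partial_prod (S n) k * q ^ k).
  { intros k. apply Rmult_le_pos; [apply pp_partial_prod_nonneg|apply pow_le; lra]. }
  unfold PSeries. eapply Rle_trans; [|apply (sum_le_Series _ n Hp Hc)].
  rewrite <- (pp_partial_prod_stable n (S n)) by lia.
  destruct n as [|n]; [simpl; lra|]. rewrite tech5.
  assert (0 <= sum_f_R0 (fun k => pp_partial_prod (S (S n)) k * q ^ k) n) by (apply cond_pos_sum; exact Hp).
  lra.
Qed.

Lemma CV_radius_pp_log_coef : Rbar_le 1 (CV_radius pp_log_coef).
Proof.
  apply CV_radius_ge_1. intros r Hr.
  destruct (bounded_inside_radius (fun n => INR (S n) * INR (S (S n))) r) as [M HM]; [lra| |].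
  { rewrite <- (Rabs_pos_eq r) by lra. apply lt_CV_radius; [apply CV_radius_INR2_ge_1|].
    rewrite Rabs_pos_eq; lra. }
  exists (2 * M). intros n. specialize (HM n).
  assert (0 <= r ^ n) by (apply pow_le; lra). pose proof (pos_INR n).
  rewrite Rabs_pos_eq in * by (try apply pp_log_coef_nonneg; apply Rmult_le_pos; apply pos_INR).
  pose proof (pp_log_coef_le n).
  assert (pp_log_coef n <= 2 * (INR (S n) * INR (S (S n)))) by (rewrite !S_INR; nra).
  apply Rle_trans with (2 * (INR (S n) * INR (S (S n))) * r ^ n); [|nra].
  apply Rmult_le_compat_r; assumption.
Qed.

Lemma pp_generating_Cexp (u : C) : Cmod u < 1 ->
  Cser (fun n => (RtoC (pp n) * u ^ n)%C)
       (Cexp (Csum (fun n => (RtoC (pp_log_coef n) * u ^ n)%C))).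
Proof.
  intros Hu. apply exp_pseries.
  - apply pp_log_coef_0.
  - apply pp_0.
  - apply pp_rec.
  - eapply Rbar_lt_le_trans; [|apply CV_radius_pp]. exact Hu.
  - eapply Rbar_lt_le_trans; [|apply CV_radius_pp_log_coef]. exact Hu.
Qed.

Lemma pp_generating_exp q : 0 <= q < 1 -> PSeries pp q = exp (PSeries pp_log_coef q).
Proof.
  intros Hq.
  assert (Hu : Cmod (RtoC q) < 1) by (rewrite Cmod_R, Rabs_pos_eq; lra).
  pose proof (Cser_unique _ _ (pp_generating_Cexp (RtoC q) Hu)) as E.
  assert (T : forall a, Csum (fun n => (RtoC (a n) * RtoC q ^ n)%C) = RtoC (PSeries a q)).
  { intros a. unfold Csum, PSeries. symmetry. unfold RtoC at 1. symmetry. f_equal.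
    - apply Series_ext. intros n. rewrite <- RtoC_pow. simpl. ring.
    - rewrite (Series_ext _ (fun n => 0 * 0)).
      + rewrite Series_scal_l. ring.
      + intros n. rewrite <- RtoC_pow. simpl. ring. }
  rewrite !T, Cexp_R in E. now apply RtoC_inj in E.
Qed.

(** The tail of the coefficients beyond [N] is all that separates the finite
    products from the infinite one, so their logarithms converge. *)
Lemma pp_log_series q : 0 <= q < 1 ->
  is_series (fun i => INR (S i) * log_quot (q ^ S i)) (PSeries pp_log_coef q).
Proof.
  intros Hq. assert (Hq' : Rabs q < 1) by (rewrite Rabs_pos_eq; lra).
  assert (Hpp : ex_series (fun n => pp n * q ^ n)).
  { apply (ex_pseries_R pp q), CV_radius_inside, lt_CV_radius; auto using CV_radius_pp. }
  assert (Hx : forall N, ex_series (fun n => pp_partial_prod N n * q ^ n)).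
  { intros N. apply (ex_pseries_R (pp_partial_prod N) q), CV_radius_inside, lt_CV_radius;
    auto using CV_radius_partial_prod. }
  assert (H : is_lim_seq (fun N => PSeries (pp_partial_prod (S N)) q) (PSeries pp q)).
  { apply is_lim_seq_le_le with (u := fun N => sum_f_R0 (fun n => pp n * q ^ n) N)
      (w := fun _ => PSeries pp q).
    - intros N. split.
      + rewrite (sum_eq _ (fun n => pp_partial_prod (S N) n * q ^ n)).
        2:{ intros i Hi. rewrite pp_partial_prod_stable by lia. reflexivity. }
        apply sum_le_Series; [|apply Hx].
        intros n. apply Rmult_le_pos; [apply pp_partial_prod_nonneg|apply pow_le; lra].
      + apply Series_le; [|exact Hpp]. intros n. split.
        * apply Rmult_le_pos; [apply pp_partial_prod_nonneg|apply pow_le; lra].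
        * apply Rmult_le_compat_r; [apply pow_le; lra|apply pp_partial_prod_le_pp].
    - apply Series_correct in Hpp. apply is_lim_seq_ext with (sum_n (fun n => pp n * q ^ n)); [|exact Hpp].
      intros n. apply sum_n_Reals.
    - apply is_lim_seq_const. }
  assert (G : is_lim_seq (fun N => ln (PSeries (pp_partial_prod (S N)) q)) (ln (PSeries pp q))).
  { apply is_lim_seq_continuous; [|exact H].
    apply derivable_continuous_pt. exists (/ PSeries pp q). apply derivable_pt_lim_ln.
    rewrite pp_generating_exp by assumption. apply exp_pos. }
  rewrite pp_generating_exp, ln_exp in G by assumption.
  change (is_lim_seq (sum_n (fun i => INR (S i) * log_quot (q ^ S i))) (PSeries pp_log_coef q)).
  eapply is_lim_seq_ext; [|exact G].
  intros N. cbv beta. rewrite PSeries_partial_prod, ln_exp, sum_n_Reals by assumption. reflexivity.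
Qed.

(** * Euler-Maclaurin summation *)

(** The Euler-Maclaurin remainder on [[x, x + 1]], with the trapezoidal rule and
    the first correction; [Phi] is meant to be a primitive of [f] and [f1] its
    derivative. *)
Definition EM (Phi f f1 : R -> R) (x : R) : R :=
  (f x + f (x + 1)) / 2 - (Phi (x + 1) - Phi x) - (f1 (x + 1) - f1 x) / 12.

(** As a function of the length of the interval, the remainder vanishes to
    second order at [0] and its second derivative is controlled by [f3]. *)
Lemma EM_bound (Phi f f1 f2 f3 : R -> R) x M :
  (forall y, x <= y <= x + 1 -> is_derive Phi y (f y)) ->
  (forall y, x <= y <= x + 1 -> is_derive f y (f1 y)) ->
  (forall y, x <= y <= x + 1 -> is_derive f1 y (f2 y)) ->
  (forall y, x <= y <= x + 1 -> is_derive f2 y (f3 y)) ->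
  (forall y, x <= y <= x + 1 -> Rabs (f3 y) <= M) ->
  Rabs (EM Phi f f1 x) <= M.
Proof.
  intros H0 H1 H2 H3 HM.
  assert (M0 : 0 <= M) by (eapply Rle_trans; [apply Rabs_pos|apply (HM x); lra]).
  pose (r := fun h => (f x + f (x + h)) / 2 * h - (Phi (x + h) - Phi x)
     - h ^ 2 / 12 * (f1 (x + h) - f1 x)).
  pose (r1 := fun h => (f x - f (x + h)) / 2 + h * f1 (x + h) / 2
     - h / 6 * (f1 (x + h) - f1 x) - h ^ 2 / 12 * f2 (x + h)).
  pose (r2 := fun h => h * f2 (x + h) / 6 - (f1 (x + h) - f1 x) / 6 - h ^ 2 / 12 * f3 (x + h)).
  assert (C : forall g g1 : R -> R, (forall y, x <= y <= x + 1 -> is_derive g y (g1 y)) ->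
    forall h, 0 <= h <= 1 -> is_derive (fun h => g (x + h)) h (g1 (x + h))).
  { intros g g1 Hg h Hh. 
    replace (g1 (x + h)) with (1 * g1 (x + h)) by ring.
    apply (is_derive_comp g (fun h => x + h)); [apply Hg; lra|].
    auto_derive; [exact I|ring]. }
  assert (D0 := C _ _ H0). assert (D1 := C _ _ H1). assert (D2 := C _ _ H2). assert (D3 := C _ _ H3).
  assert (R1 : forall h, 0 <= h <= 1 -> is_derive r h (r1 h)).
  { intros h Hh. unfold r.
    pose proof (D0 h Hh) as E0. pose proof (D1 h Hh) as E1. pose proof (D2 h Hh) as E2.
    pose (g0 := fun h => Phi (x + h)). pose (g1 := fun h => f (x + h)). pose (g2 := fun h => f1 (x + h)).
    change (is_derive (fun h => (f x + g1 h) / 2 * h - (g0 h - Phi x) - h ^ 2 / 12 * (g2 h - f1 x)) h (r1 h)).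
    match type of E0 with is_derive _ _ ?v => change (is_derive g0 h v) in E0 end.
    match type of E1 with is_derive _ _ ?v => change (is_derive g1 h v) in E1 end.
    match type of E2 with is_derive _ _ ?v => change (is_derive g2 h v) in E2 end.
    assert (K0 := eq_refl (g0 h)). assert (K1 := eq_refl (g1 h)). assert (K2 := eq_refl (g2 h)).
    unfold g0 at 2 in K0; unfold g1 at 2 in K1; unfold g2 at 2 in K2.
    clearbody g0 g1 g2.
    auto_derive; [repeat split; eexists; eassumption|].
    subst_derive.
    unfold r1. try rewrite K0; try rewrite K1; try rewrite K2; field. }
  assert (R2 : forall h, 0 <= h <= 1 -> is_derive r1 h (r2 h)).
  { intros h Hh. unfold r1.
    pose proof (D1 h Hh) as E0. pose proof (D2 h Hh) as E1. pose proof (D3 h Hh) as E2.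
    pose (g0 := fun h => f (x + h)). pose (g1 := fun h => f1 (x + h)). pose (g2 := fun h => f2 (x + h)).
    change (is_derive (fun h => (f x - g0 h) / 2 + h * g1 h / 2
     - h / 6 * (g1 h - f1 x) - h ^ 2 / 12 * g2 h) h (r2 h)).
    match type of E0 with is_derive _ _ ?v => change (is_derive g0 h v) in E0 end.
    match type of E1 with is_derive _ _ ?v => change (is_derive g1 h v) in E1 end.
    match type of E2 with is_derive _ _ ?v => change (is_derive g2 h v) in E2 end.
    assert (K0 := eq_refl (g0 h)). assert (K1 := eq_refl (g1 h)). assert (K2 := eq_refl (g2 h)).
    unfold g0 at 2 in K0; unfold g1 at 2 in K1; unfold g2 at 2 in K2.
    clearbody g0 g1 g2.
    auto_derive; [repeat split; eexists; eassumption|].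
    subst_derive.
    unfold r2. try rewrite K0; try rewrite K1; try rewrite K2; field. }
  assert (B2 : forall h, 0 <= h <= 1 -> Rabs (r2 h) <= M).
  { intros h Hh.
    destruct (mean_value_exists (fun h => f1 (x + h)) (fun h => f2 (x + h)) 0 h) as [c [Hc Ec]]; [lra| |].
    { intros y Hy. apply D2. lra. }
    assert (V : Rabs (f2 (x + h) - f2 (x + c)) <= M * (h - c)).
    { apply (mean_value_inequality (fun h => f2 (x + h)) (fun h => f3 (x + h))); [lra| |].
      - intros y Hy. apply D3. lra.
      - intros y Hy. apply HM. lra. }
    rewrite Rplus_0_r in Ec. unfold r2. rewrite Ec.
    replace (h * f2 (x + h) / 6 - f2 (x + c) * (h - 0) / 6 - h ^ 2 / 12 * f3 (x + h))
      with (h / 6 * (f2 (x + h) - f2 (x + c)) + h ^ 2 / 12 * - f3 (x + h)) by field.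
    eapply Rle_trans; [apply Rabs_triang|].
    rewrite !Rabs_mult, Rabs_Ropp, (Rabs_pos_eq (h / 6)), (Rabs_pos_eq (h ^ 2 / 12)) by nra.
    specialize (HM (x + h) ltac:(lra)).
    apply Rle_trans with (1 * M / 6 + 1 * M / 12); [|lra].
    apply Rplus_le_compat.
    - apply Rle_trans with (h / 6 * (M * (h - c))); [apply Rmult_le_compat_l; lra|].
      assert (h * (h - c) <= 1) by nra. nra.
    - apply Rle_trans with (h ^ 2 / 12 * M); [apply Rmult_le_compat_l; nra|].
      assert (h ^ 2 <= 1) by nra. nra. }
  assert (B1 : forall h, 0 <= h <= 1 -> Rabs (r1 h) <= M).
  { intros h Hh. replace (r1 h) with (r1 h - r1 0).
    2:{ unfold r1. rewrite Rplus_0_r. field. }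
    apply Rle_trans with (M * (h - 0)); [|nra].
    apply (mean_value_inequality r1 r2); [lra| |]; intros y Hy; [apply R2|apply B2]; lra. }
  replace (EM Phi f f1 x) with (r 1 - r 0).
  2:{ unfold r, EM. rewrite Rplus_0_r. field. }
  apply Rle_trans with (M * (1 - 0)); [|lra].
  apply (mean_value_inequality r r1); [lra| |]; intros y Hy; [apply R1|apply B1]; lra.
Qed.

(** The boundary terms telescope. *)
Lemma EM_sum (Phi f f1 : R -> R) N :
  sum_f_R0 (fun i => f (INR (S i))) (S N) =
  (f 1 + f (INR (S (S N)))) / 2 + (Phi (INR (S (S N))) - Phi 1)
  + (f1 (INR (S (S N))) - f1 1) / 12 + sum_f_R0 (fun i => EM Phi f f1 (INR (S i))) N.
Proof.
  assert (E : forall n, INR (S n) + 1 = INR (S (S n))) by (intros; rewrite !S_INR; ring).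
  induction N as [|N IH].
  - simpl sum_f_R0. unfold EM. simpl (INR 1). replace (INR 2) with (1 + 1) by (simpl; ring). field.
  - rewrite tech5, IH, (tech5 _ N). unfold EM. rewrite !E. field.
Qed.

Lemma EM_series (Phi f f1 : R -> R) (p E : R) :
  is_series (fun i => EM Phi f f1 (INR (S i))) E ->
  is_lim_seq (fun n => f (INR n)) 0 -> is_lim_seq (fun n => f1 (INR n)) 0 ->
  is_lim_seq (fun n => Phi (INR n)) p ->
  is_series (fun i => f (INR (S i))) (f 1 / 2 + (p - Phi 1) - f1 1 / 12 + E).
Proof.
  intros HE Hf Hf1 HP.
  change (is_lim_seq (sum_n (fun i => f (INR (S i)))) (f 1 / 2 + (p - Phi 1) - f1 1 / 12 + E)).
  apply is_lim_seq_incr_1.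
  apply is_lim_seq_ext with (fun N => (f 1 + f (INR (S (S N)))) / 2 + (Phi (INR (S (S N))) - Phi 1)
  + (f1 (INR (S (S N))) - f1 1) / 12 + sum_n (fun i => EM Phi f f1 (INR (S i))) N).
  { intros N. rewrite !sum_n_Reals. symmetry. apply EM_sum. }
  replace (f 1 / 2 + (p - Phi 1) - f1 1 / 12 + E) with
    ((f 1 + 0) / 2 + (p - Phi 1) + (0 - f1 1) / 12 + E) by field.
  apply (is_lim_seq_incr_n _ 2) in Hf. apply (is_lim_seq_incr_n _ 2) in Hf1.
  apply (is_lim_seq_incr_n _ 2) in HP.
  assert (A2 : forall n, (n + 2 = S (S n))%nat) by (intros; lia).
  eapply is_lim_seq_ext in Hf; [|intros n; rewrite A2; reflexivity].
  eapply is_lim_seq_ext in Hf1; [|intros n; rewrite A2; reflexivity].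
  eapply is_lim_seq_ext in HP; [|intros n; rewrite A2; reflexivity].
  apply is_lim_seq_plus'; [|exact HE].
  apply is_lim_seq_plus'; [apply is_lim_seq_plus'|].
  - apply (is_lim_seq_scal_r _ (/2) (f 1 + 0)).
    apply is_lim_seq_plus'; [apply is_lim_seq_const|exact Hf].
  - apply is_lim_seq_minus'; [exact HP|apply is_lim_seq_const].
  - apply (is_lim_seq_scal_r _ (/12) (0 - f1 1)).
    apply is_lim_seq_minus'; [exact Hf1|apply is_lim_seq_const].
Qed.

(** * Dominated convergence of series *)

Lemma ex_series_bounded (a : nat -> R) K : (forall n, 0 <= a n) ->
  (forall n, sum_f_R0 a n <= K) -> ex_series a.
Proof.
  intros Ha HK.
  destruct (ex_finite_lim_seq_incr (sum_n a) K) as [l Hl].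
  - intros n. rewrite sum_Sn. change (sum_n a n <= sum_n a n + a (S n)). specialize (Ha (S n)). lra.
  - intros n. rewrite sum_n_Reals. apply HK.
  - exists l. exact Hl.
Qed.

Lemma is_derive_Rpower a x : 0 < x ->
  is_derive (fun y => Rpower y a) x (a * Rpower x (a - 1)).
Proof.
  intros Hx. apply is_derive_Reals. apply derivable_pt_lim_power. exact Hx.
Qed.

Lemma Rpower_neg_decr a x y : 0 <= a -> 0 < x <= y -> Rpower y (- a) <= Rpower x (- a).
Proof.
  intros Ha Hxy. rewrite !Rpower_Ropp. apply Rinv_le_contravar; [apply exp_pos|].
  apply Rle_Rpower_l; lra.
Qed.

Lemma Rpower_1_l a : Rpower 1 a = 1.
Proof. unfold Rpower. rewrite ln_1, Rmult_0_r. apply exp_0. Qed.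

(** Compare with the telescoping series of [n^(-d) - (n + 1)^(-d)]. *)
Lemma ex_series_Rpower d : 0 < d -> ex_series (fun n => Rpower (INR (S n)) (- (1 + d))).
Proof.
  intros Hd.
  apply ex_series_bounded with (1 + (1 - 0) / d); [intros n; left; apply exp_pos|].
  assert (G : forall n, sum_f_R0 (fun n => Rpower (INR (S n)) (- (1 + d))) n <=
     1 + (1 - Rpower (INR (S n)) (- d)) / d).
  { induction n as [|n IH].
    - simpl. rewrite !Rpower_1_l. unfold Rdiv. lra.
    - rewrite tech5.
      assert (P : 0 < INR (S n)) by (apply lt_0_INR; lia).
      destruct (mean_value_exists (fun y => Rpower y (- d)) (fun y => - d * Rpower y (- d - 1))
        (INR (S n)) (INR (S (S n)))) as [c [Hc E]].
      + apply le_INR. lia.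
      + intros x Hx. apply is_derive_Rpower. lra.
      + assert (B : Rpower (INR (S (S n))) (- (1 + d)) <= Rpower c (- (1 + d)))
          by (apply Rpower_neg_decr; lra).
        replace (INR (S (S n)) - INR (S n)) with 1 in E by (rewrite (S_INR (S n)); ring).
        replace (- d - 1) with (- (1 + d)) in E by ring.
        apply Rle_trans with (1 + (1 - Rpower (INR (S n)) (- d)) / d + Rpower c (- (1 + d))); [lra|].
        replace (Rpower c (- (1 + d))) with
          ((Rpower (INR (S n)) (- d) - Rpower (INR (S (S n))) (- d)) / d).
        * right. field. lra.
        * apply Rmult_eq_reg_l with (- d); [|lra].
          transitivity (- (Rpower (INR (S n)) (- d) - Rpower (INR (S (S n))) (- d))); [field; lra|lra]. }
  intros n. eapply Rle_trans; [apply G|].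
  apply Rplus_le_compat_l. unfold Rdiv. apply Rmult_le_compat_r.
  - left. now apply Rinv_0_lt_compat.
  - pose proof (exp_pos (- d * ln (INR (S n)))). unfold Rpower. lra.
Qed.

(** Convergence to zero as the argument tends to zero from the right, in the
    form in which it is used with explicit bounds. *)
Definition small (g : R -> R) : Prop :=
  forall eps, 0 < eps -> exists d, 0 < d /\ forall t, 0 < t < d -> Rabs (g t) <= eps.

Lemma small_ext_loc g h t0 : 0 < t0 -> (forall t, 0 < t < t0 -> g t = h t) -> small g -> small h.
Proof.
  intros H0 H Hg eps He. destruct (Hg eps He) as [d [Hd H1]].
  exists (Rmin d t0). split; [now apply Rmin_glb_lt|]. intros t Ht.
  pose proof (Rmin_l d t0). pose proof (Rmin_r d t0). rewrite <- H by lra. apply H1. lra.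
Qed.

Lemma small_plus g h : small g -> small h -> small (fun t => g t + h t).
Proof.
  intros Hg Hh eps He.
  destruct (Hg (eps / 2) ltac:(lra)) as [d1 [Hd1 H1]].
  destruct (Hh (eps / 2) ltac:(lra)) as [d2 [Hd2 H2]].
  exists (Rmin d1 d2). split; [now apply Rmin_glb_lt|]. intros t Ht.
  pose proof (Rmin_l d1 d2). pose proof (Rmin_r d1 d2).
  eapply Rle_trans; [apply Rabs_triang|].
  specialize (H1 t ltac:(lra)). specialize (H2 t ltac:(lra)). lra.
Qed.

Lemma small_le g h t0 : 0 < t0 -> (forall t, 0 < t < t0 -> Rabs (g t) <= h t) -> small h -> small g.
Proof.
  intros H0 H Hh eps He. destruct (Hh eps He) as [d [Hd H1]].
  exists (Rmin d t0). split; [now apply Rmin_glb_lt|]. intros t Ht.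
  pose proof (Rmin_l d t0). pose proof (Rmin_r d t0).
  eapply Rle_trans; [apply H; lra|]. eapply Rle_trans; [apply Rle_abs|]. apply H1. lra.
Qed.

Lemma small_scal c g : small g -> small (fun t => c * g t).
Proof.
  intros Hg eps He. destruct (Hg (eps / (1 + Rabs c))) as [d [Hd H]].
  { pose proof (Rabs_pos c). apply Rdiv_lt_0_compat; lra. }
  exists d. split; [exact Hd|]. intros t Ht. rewrite Rabs_mult.
  pose proof (Rabs_pos c). specialize (H t Ht). apply Rle_div_r in H; [|lra].
  pose proof (Rabs_pos (g t)). nra.
Qed.

Lemma small_id : small (fun t => t).
Proof.
  intros eps He. exists eps. split; [exact He|]. intros t Ht. rewrite Rabs_pos_eq; lra.
Qed.

(** Tannery: the common bound makes the tails uniformly small, and finitely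
    many terms tend to zero. *)
Lemma small_Series (a : R -> nat -> R) (b : nat -> R) t0 :
  0 < t0 -> ex_series b -> (forall t n, 0 < t < t0 -> Rabs (a t n) <= b n) ->
  (forall n, small (fun t => a t n)) -> small (fun t => Series (a t)).
Proof.
  intros H0 Hb Hab Ha eps He.
  assert (b0 : forall n, 0 <= b n).
  { intros n. eapply Rle_trans; [apply Rabs_pos|apply (Hab (t0 / 2)); lra]. }
  assert (T : exists N, Series b - sum_f_R0 b N <= eps / 2).
  { pose proof (Series_correct _ Hb) as Hs.
    change (is_lim_seq (sum_n b) (Series b)) in Hs.
    apply is_lim_seq_spec in Hs. destruct (Hs (mkposreal (eps / 2) ltac:(lra))) as [N HN].
    exists N. specialize (HN N (Nat.le_refl N)). rewrite sum_n_Reals in HN. simpl in HN.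
    apply Rabs_lt_between in HN. lra. }
  destruct T as [N HN].
  assert (F : small (fun t => sum_f_R0 (a t) N)).
  { clear HN. induction N as [|N IH]; [exact (Ha O)|].
    apply (small_plus (fun t => sum_f_R0 (a t) N) (fun t => a t (S N)) IH (Ha (S N))). }
  destruct (F (eps / 2) ltac:(lra)) as [d [Hd HF]].
  exists (Rmin d t0). split; [now apply Rmin_glb_lt|]. intros t Ht.
  pose proof (Rmin_l d t0). pose proof (Rmin_r d t0).
  assert (Hex : ex_series (a t)).
  { apply (ex_series_dominated b); [|exact Hb]. intros n. apply Hab. lra. }
  rewrite (Series_incr_n (a t) (S N)) by (auto with arith). simpl pred.
  eapply Rle_trans; [apply Rabs_triang|].
  specialize (HF t ltac:(lra)).
  assert (Rabs (Series (fun k => a t (S N + k)%nat)) <= Series (fun k => b (S N + k)%nat)).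
  { assert (Hb' : ex_series (fun k => b (S N + k)%nat)) by now apply (ex_series_incr_n b (S N)).
    eapply Rle_trans; [apply Series_Rabs|].
    - apply (ex_series_dominated_abs (fun k => b (S N + k)%nat)); [|exact Hb'].
      intros n. apply Hab. lra.
    - apply Series_le; [|exact Hb']. intros n. split; [apply Rabs_pos|]. apply Hab. lra. }
  assert (Series b = sum_f_R0 b N + Series (fun k => b (S N + k)%nat))
    by (apply (Series_incr_n b (S N)); [lia|exact Hb]).
  lra.
Qed.

(** * Hyperbolic functions *)

Lemma derivative_nonneg_le (f f' : R -> R) a b : a <= b ->
  (forall x, a <= x <= b -> is_derive f x (f' x)) ->
  (forall x, a <= x <= b -> 0 <= f' x) -> f a <= f b.
Proof.
  intros Hab Hd H0. destruct (mean_value_exists f f' a b Hab Hd) as [c [Hc E]].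
  specialize (H0 c Hc). nra.
Qed.

Lemma is_derive_sinh x : is_derive sinh x (cosh x).
Proof. apply is_derive_Reals, derivable_pt_lim_sinh. Qed.

Lemma is_derive_cosh x : is_derive cosh x (sinh x).
Proof. apply is_derive_Reals, derivable_pt_lim_cosh. Qed.

Lemma cosh2_sinh2 x : cosh x * cosh x = 1 + sinh x * sinh x.
Proof.
  unfold cosh, sinh. assert (E : exp x * exp (- x) = 1) by (rewrite <- exp_plus, Rplus_opp_r; apply exp_0).
  field_simplify. nra.
Qed.

Lemma cosh_ge_1 x : 1 <= cosh x.
Proof.
  assert (0 < cosh x) by (unfold cosh; pose proof (exp_pos x); pose proof (exp_pos (- x)); lra).
  pose proof (cosh2_sinh2 x). nra.
Qed.

Lemma sinh_ge x : 0 <= x -> x <= sinh x.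
Proof.
  intros Hx.
  assert (H : sinh 0 - 0 <= sinh x - x).
  { apply (derivative_nonneg_le (fun x => sinh x - x) (fun x => cosh x - 1) 0 x Hx).
    - intros y _. apply (is_derive_minus (V := R_NormedModule) sinh (fun x => x)).
      apply is_derive_sinh. auto_derive; [exact I|ring].
    - intros y _. pose proof (cosh_ge_1 y). lra. }
  rewrite sinh_0 in H. lra.
Qed.

Lemma cosh_ge_sq x : 0 <= x -> 1 + x ^ 2 / 2 <= cosh x.
Proof.
  intros Hx.
  assert (H : cosh 0 - (0 ^ 2 / 2) <= cosh x - x ^ 2 / 2).
  { apply (derivative_nonneg_le (fun x => cosh x - x ^ 2 / 2) (fun x => sinh x - x) 0 x Hx).
    - intros y _. apply (is_derive_minus (V := R_NormedModule) cosh (fun x => x ^ 2 / 2)).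
      apply is_derive_cosh. auto_derive; [exact I|field].
    - intros y Hy. pose proof (sinh_ge y ltac:(lra)). lra. }
  rewrite cosh_0 in H. lra.
Qed.

Lemma sinh_ge_cube x : 0 <= x -> x + x ^ 3 / 6 <= sinh x.
Proof.
  intros Hx.
  assert (H : sinh 0 - (0 + 0 ^ 3 / 6) <= sinh x - (x + x ^ 3 / 6)).
  { apply (derivative_nonneg_le (fun x => sinh x - (x + x ^ 3 / 6)) (fun x => cosh x - (1 + x ^ 2 / 2)) 0 x Hx).
    - intros y _. apply (is_derive_minus (V := R_NormedModule) sinh (fun x => x + x ^ 3 / 6)).
      apply is_derive_sinh. auto_derive; [exact I|field].
    - intros y Hy. pose proof (cosh_ge_sq y ltac:(lra)). lra. }
  rewrite sinh_0 in H. lra.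
Qed.

Lemma one_minus_le_exp x : 1 - x <= exp (- x).
Proof. pose proof (exp_ineq1_le (- x)). lra. Qed.

(** [y <= sinh y <= y cosh y <= y e^y]. *)
Lemma ratio_sinh_bounds y : 0 < y -> 1 - y <= y / sinh y <= 1.
Proof.
  intros Hy. pose proof (sinh_ge y ltac:(lra)) as H. split.
  - apply Rle_trans with (exp (- y)); [apply one_minus_le_exp|].
    apply le_div_of_mul_le; [lra|].
    destruct (mean_value_exists sinh cosh 0 y) as [c [Hc E]]; [lra|intros; apply is_derive_sinh|].
    rewrite sinh_0 in E.
    assert (B : cosh c <= exp y).
    { apply Rle_trans with (exp c); [|apply exp_le_compat; lra].
      unfold cosh. assert (exp (- c) <= exp c) by (apply exp_le_compat; lra). lra. }
    replace (sinh y) with (cosh c * y) by lra.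
    apply Rle_trans with (exp (- y) * (exp y * y)).
    + apply Rmult_le_compat_l; [left; apply exp_pos|]. apply Rmult_le_compat_r; lra.
    + rewrite <- Rmult_assoc, <- exp_plus, Rplus_opp_l, exp_0. lra.
  - apply div_le_of_le_mul; lra.
Qed.

(** * The logarithm of the generating function near [q = 1] *)

(** The function [log_quot (exp (- y))], written in a form that is easy to
    differentiate. *)
Definition ell (y : R) : R := ln (1 + exp (- y)) - ln (1 - exp (- y)).

Lemma exp_neg_bounds y : 0 < y -> 0 < exp (- y) < 1.
Proof.
  intros Hy. split; [apply exp_pos|]. rewrite <- exp_0. apply exp_increasing. lra.
Qed.

Lemma ell_log_quot y : 0 < y -> log_quot (exp (- y)) = ell y.
Proof.
  intros Hy. pose proof (exp_neg_bounds y Hy). unfold log_quot, ell. rewrite ln_div; lra.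
Qed.

(** [y_ell_d1], [y_ell_d2] and [y_ell_d3] are the successive derivatives of
    [y * ell y]. *)
Definition y_ell_d1 (y : R) : R := ell y - y / sinh y.
Definition y_ell_d2 (y : R) : R := - 2 / sinh y + y * cosh y / (sinh y * sinh y).
Definition y_ell_d3 (y : R) : R :=
  3 * (cosh y / (sinh y * sinh y)) + y / sinh y
  - 2 * (y * (cosh y * cosh y) / (sinh y * sinh y * sinh y)).

Lemma is_derive_ell y : 0 < y -> is_derive ell y (- / sinh y).
Proof.
  intros Hy. pose proof (exp_neg_bounds y Hy) as H. unfold ell.
  auto_derive; [lra|]. unfold sinh.
  assert (E : exp y * exp (- y) = 1) by (rewrite <- exp_plus, Rplus_opp_r; apply exp_0).
  replace (exp y) with (/ exp (- y)).
  2:{ apply Rmult_eq_reg_r with (exp (- y)); [|lra]. rewrite E. field. lra. }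
  set (q := exp (- y)) in *. field. repeat split; try lra. nra.
Qed.

Lemma sinh_pos y : 0 < y -> 0 < sinh y.
Proof. intros Hy. pose proof (sinh_ge y ltac:(lra)). lra. Qed.

Lemma is_derive_y_ell y : 0 < y -> is_derive (fun y => y * ell y) y (y_ell_d1 y).
Proof.
  intros Hy. pose proof (is_derive_ell y Hy) as H. pose proof (sinh_pos y Hy).
  auto_derive; [eexists; exact H|].  subst_derive. unfold y_ell_d1. field. lra.
Qed.

Lemma is_derive_y_ell_d1 y : 0 < y -> is_derive y_ell_d1 y (y_ell_d2 y).
Proof.
  intros Hy. pose proof (is_derive_ell y Hy) as H. pose proof (sinh_pos y Hy).
  pose proof (is_derive_sinh y) as Hs.
  unfold y_ell_d1. auto_derive; [repeat split; try (eexists; eassumption); lra|].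
  subst_derive. unfold y_ell_d2. field. lra.
Qed.

Lemma is_derive_y_ell_d2 y : 0 < y -> is_derive y_ell_d2 y (y_ell_d3 y).
Proof.
  intros Hy. pose proof (sinh_pos y Hy).
  pose proof (is_derive_sinh y) as Hs. pose proof (is_derive_cosh y) as Hc.
  unfold y_ell_d2. auto_derive; [repeat split; try (eexists; eassumption); nra|].
  unfold y_ell_d3. field. lra.
Qed.

(** The bound has the scaling of the third derivative of [y ln y], which up to
    sign is what [y * ell y] resembles near [0]; for large [y] it holds because
    [sinh y >= y^3 / 6]. *)
Lemma y_ell_d3_bound y : 0 < y -> Rabs (y_ell_d3 y) <= 41 / (y * y).
Proof.
  intros Hy. pose proof (sinh_pos y Hy) as Hs. pose proof (sinh_ge_cube y ltac:(lra)) as H3.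
  pose proof (cosh_ge_1 y) as Hc. pose proof (cosh2_sinh2 y) as Hcs.
  set (s := sinh y) in *. set (c := cosh y) in *.
  assert (P3 : 0 < y ^ 3) by (apply pow_lt; lra).
  assert (A1 : y / s <= 1) by (apply div_le_of_le_mul; lra).
  assert (A0 : 0 < y / s) by (apply Rdiv_lt_0_compat; lra).
  assert (A3 : y ^ 3 / s <= 6) by (apply div_le_of_le_mul; lra).
  assert (A3' : 0 < y ^ 3 / s) by (apply Rdiv_lt_0_compat; lra).
  assert (A2 : y ^ 2 / s <= 6).
  { apply div_le_of_le_mul; [lra|]. destruct (Rle_lt_dec y 1); nra. }
  assert (A2' : 0 < y ^ 2 / s) by (apply Rdiv_lt_0_compat; nra).
  assert (Cl : c <= 1 + s) by nra.
  apply le_div_of_mul_le; [nra|]. rewrite <- (Rabs_pos_eq (y * y)) by nra. rewrite <- Rabs_mult.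
  assert (E : y_ell_d3 y * (y * y) = 3 * (c * (y / s * (y / s))) + y ^ 3 / s
     - 2 * ((y / s) * (y / s) * (y / s) + y ^ 3 / s)).
  { unfold y_ell_d3. fold s c. rewrite Hcs. field. lra. }
  rewrite E.
  assert (B : c * (y / s * (y / s)) <= 7).
  { apply Rle_trans with ((1 + s) * (y / s * (y / s))); [apply Rmult_le_compat_r; nra|].
    replace ((1 + s) * (y / s * (y / s))) with (y / s * (y / s) + y ^ 2 / s) by (field; lra). nra. }
  assert (B' : 0 <= c * (y / s * (y / s))) by (apply Rmult_le_pos; nra).
  assert (B3 : 0 <= (y / s) * (y / s) * (y / s) <= 1).
  { split; [apply Rmult_le_pos; nra|]. assert (y / s * (y / s) <= 1) by nra. nra. }
  apply Rabs_le. lra.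
Qed.

Lemma ell_nonneg y : 0 < y -> 0 <= ell y.
Proof.
  intros Hy. rewrite <- ell_log_quot by assumption. pose proof (exp_neg_bounds y Hy).
  apply log_quot_nonneg. lra.
Qed.

(** [ell y + ln (y / 2)] is what remains of [ell] after its logarithmic
    singularity at [0]. *)
Lemma ell_near_0 y : 0 < y < 1 -> Rabs (ell y + ln (y / 2)) <= y.
Proof.
  intros Hy. pose proof (exp_neg_bounds y ltac:(lra)) as Hq.
  pose proof (one_minus_le_exp y) as H1.
  assert (H2 : exp (- y) <= 1 - y + y ^ 2 / 2).
  { assert (H : exp (- 0) - (1 - 0 + 0 ^ 2 / 2) >= exp (- y) - (1 - y + y ^ 2 / 2)); [|rewrite Ropp_0, exp_0 in H; lra].
    apply Rle_ge. apply Ropp_le_cancel.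
    apply (derivative_nonneg_le (fun y => - (exp (- y) - (1 - y + y ^ 2 / 2)))
      (fun y => exp (- y) - 1 + y) 0 y); [lra| |].
    - intros z _. auto_derive; [exact I|field].
    - intros z _. pose proof (one_minus_le_exp z). lra. }
  rewrite <- ell_log_quot by lra. unfold log_quot.
  set (q := exp (- y)) in *.
  assert (0 < (1 + q) / (1 - q)) by (apply Rdiv_lt_0_compat; lra).
  rewrite <- ln_mult by lra.
  set (w := (1 + q) / (1 - q) * (y / 2)).
  assert (W1 : 1 - y / 2 <= w).
  { apply Rle_trans with (2 * (1 - y / 2) / y * (y / 2)); [right; field; lra|].
    apply Rmult_le_compat_r; [lra|]. apply div_le_of_le_mul; [lra|].
    replace ((1 + q) / (1 - q) * y) with ((1 + q) * y / (1 - q)) by (field; lra).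
    apply le_div_of_mul_le; [lra|]. nra. }
  assert (W2 : w <= 1 / (1 - y / 2)).
  { unfold w. replace ((1 + q) / (1 - q) * (y / 2)) with ((1 + q) * (y / 2) / (1 - q)) by (field; lra).
    apply div_le_of_le_mul; [lra|]. replace (1 / (1 - y / 2) * (1 - q)) with ((1 - q) / (1 - y / 2)) by (field; lra).
    apply le_div_of_mul_le; [lra|]. nra. }
  assert (L1 : - y <= ln (1 - y / 2)).
  { pose proof (exp_ineq1_le (ln (/ (1 - y / 2)))) as E.
    assert (0 < / (1 - y / 2)) by (apply Rinv_0_lt_compat; lra).
    rewrite exp_ln, ln_Rinv in E by lra.
    assert (1 / (1 - y / 2) <= 1 + y) by (apply div_le_of_le_mul; nra). lra. }
  apply Rabs_le. split.
  - apply Rle_trans with (ln (1 - y / 2)); [exact L1|]. apply Rcomplements.ln_le; lra.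
  - apply Rle_trans with (ln (1 / (1 - y / 2))); [apply Rcomplements.ln_le; lra|].
    replace (1 / (1 - y / 2)) with (/ (1 - y / 2)) by (field; lra). rewrite ln_Rinv by lra. lra.
Qed.

(** * Odd polylogarithms *)

(** The coefficients of [sum_(j odd) q^j / j^r]. *)
Definition odd_coef (r n : nat) : R := if Nat.odd n then / INR n ^ r else 0.

Lemma odd_coef_bounds r n : 0 <= odd_coef r n <= 1.
Proof.
  unfold odd_coef. destruct (Nat.odd n) eqn:E; [|lra].
  assert (1 <= INR n ^ r).
  { apply pow_R1_Rle. destruct n; [discriminate|]. rewrite S_INR. pose proof (pos_INR n). lra. }
  split; [left; apply Rinv_0_lt_compat; lra|]. rewrite <- Rinv_1. apply Rinv_le_contravar; lra.
Qed.

Lemma CV_radius_odd_coef r : Rbar_le 1 (CV_radius (odd_coef r)).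
Proof.
  apply CV_radius_bounded_ge_1 with 1. intros n. pose proof (odd_coef_bounds r n).
  rewrite Rabs_pos_eq; lra.
Qed.

Definition oddlog (r : nat) (q : R) : R := PSeries (odd_coef r) q.

Lemma odd_coef_0 r : odd_coef r 0 = 0.
Proof. reflexivity. Qed.

Lemma odd_coef_S_derive r n : PS_derive (odd_coef (S r)) n = odd_coef r (S n).
Proof.
  unfold PS_derive, odd_coef. destruct (Nat.odd (S n)); [|ring].
  assert (INR (S n) <> 0) by (apply not_0_INR; lia).
  set (x := INR (S n)) in *. simpl pow. field. 
  split; [|assumption]. now apply pow_nonzero.
Qed.

Lemma oddlog_derive r q : Rabs q < 1 ->
  q * PSeries (PS_derive (odd_coef (S r))) q = oddlog r q.
Proof.
  intros Hq. unfold oddlog.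
  rewrite (PSeries_decr_1 (odd_coef r)).
  - rewrite odd_coef_0, Rplus_0_l. f_equal. apply PSeries_ext. intros n. apply odd_coef_S_derive.
  - apply CV_radius_inside, lt_CV_radius; [apply CV_radius_odd_coef|exact Hq].
Qed.

Lemma PSeries_inv_one_minus m x : (1 <= m)%nat -> Rabs x < 1 ->
  (1 - x ^ m) * PSeries (inv_one_minus_q m) x = 1.
Proof.
  intros Hm Hx.
  assert (E : PSeries (PS_mult (one_minus_q m) (inv_one_minus_q m)) x = 1).
  { rewrite one_minus_q_mult_inv by assumption. apply PSeries_PS_one. }
  rewrite PSeries_mult_ge_1, PSeries_one_minus in E
    by (auto using CV_radius_one_minus, CV_radius_inv_one_minus).
  exact E.
Qed.

(** Both sides vanish at [0] and have derivative [2 / (1 - q^2)]. *)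
Lemma oddlog_1 q : 0 <= q < 1 -> 2 * oddlog 1 q = log_quot q.
Proof.
  intros Hq.
  assert (H : 2 * oddlog 1 q - log_quot q = 2 * oddlog 1 0 - log_quot 0).
  { apply (zero_derivative_const (fun q => 2 * oddlog 1 q - log_quot q)); [lra|].
    intros x Hx. assert (Hx' : Rabs x < 1) by (rewrite Rabs_pos_eq; lra).
    assert (D1 : is_derive (oddlog 1) x (PSeries (PS_derive (odd_coef 1)) x)).
    { apply is_derive_PSeries, lt_CV_radius; [apply CV_radius_odd_coef|exact Hx']. }
    assert (E : (1 - x ^ 2) * PSeries (PS_derive (odd_coef 1)) x = 1).
    { etransitivity; [|apply (PSeries_inv_one_minus 2 x); [lia|exact Hx']]. f_equal. apply PSeries_ext. intros n.
      rewrite odd_coef_S_derive. unfold odd_coef, inv_one_minus_q.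
      rewrite Nat.odd_succ. simpl pow. rewrite Rinv_1.
      destruct (Nat.even n) eqn:Ev.
      - apply Nat.even_spec in Ev. destruct Ev as [p ->].
        replace (2 * p)%nat with (p * 2)%nat by lia. rewrite Nat.Div0.mod_mul. reflexivity.
      - assert (Od : Nat.odd n = true) by (rewrite <- Nat.negb_even, Ev; reflexivity).
        apply Nat.odd_spec in Od. destruct Od as [p ->].
        replace (2 * p + 1)%nat with (1 + p * 2)%nat by lia. rewrite Nat.Div0.mod_add. reflexivity. }
    unfold log_quot. set (g := oddlog 1) in *.
    assert (0 < (1 + x) * / (1 - x)) by (apply Rdiv_lt_0_compat; lra).
    auto_derive; [repeat split; try (eexists; eassumption); try lra; assumption|].
 subst_derive.
    replace (PSeries (PS_derive (odd_coef 1)) x) with (/ (1 - x ^ 2)).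
    - field. nra.
    - apply Rmult_eq_reg_l with (1 - x ^ 2); [rewrite E; field|]; nra. }
  unfold oddlog in H at 2. rewrite PSeries_0, odd_coef_0 in H. unfold log_quot in H at 2.
  replace ((1 + 0) / (1 - 0)) with 1 in H by field. rewrite ln_1 in H. lra.
Qed.

Lemma Series_nonneg (a : nat -> R) : (forall n, 0 <= a n) -> ex_series a -> 0 <= Series a.
Proof.
  intros Ha H. eapply Rle_trans; [apply (Ha O)|]. exact (sum_le_Series a 0 Ha H).
Qed.

Lemma oddlog_le r q : 0 <= q < 1 -> 0 <= oddlog (S r) q <= oddlog r q.
Proof.
  intros Hq.
  assert (Hex : forall r, ex_series (fun n => odd_coef r n * q ^ n)).
  { intros r'. apply (ex_pseries_R (odd_coef r') q), CV_radius_inside, lt_CV_radius;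
    [apply CV_radius_odd_coef|rewrite Rabs_pos_eq; lra]. }
  assert (Hp : forall n, 0 <= q ^ n) by (intros; apply pow_le; lra).
  split.
  - apply Series_nonneg; [|apply Hex].
    intros n. apply Rmult_le_pos; [apply odd_coef_bounds|apply Hp].
  - apply Series_le; [|apply Hex]. intros n. split.
    + apply Rmult_le_pos; [apply odd_coef_bounds|apply Hp].
    + apply Rmult_le_compat_r; [apply Hp|]. unfold odd_coef. destruct (Nat.odd n) eqn:E; [|lra].
      destruct n; [discriminate|]. assert (1 <= INR (S n)) by (rewrite S_INR; pose proof (pos_INR n); lra).
      set (x := INR (S n)) in *.
      apply Rinv_le_contravar; [apply pow_lt; lra|]. simpl pow.
      assert (0 < x ^ r) by (apply pow_lt; lra). nra.
Qed.

(** The primitive of [y * ell y] that vanishes at infinity, integrating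
    [ell y = 2 sum_(j odd) exp (- j y) / j] term by term. *)
Definition y_ell_prim (y : R) : R := - 2 * (y * oddlog 2 (exp (- y)) + oddlog 3 (exp (- y))).

Lemma is_derive_y_ell_prim y : 0 < y -> is_derive y_ell_prim y (y * ell y).
Proof.
  intros Hy. pose proof (exp_neg_bounds y Hy) as Hq.
  assert (Hq' : Rabs (exp (- y)) < 1) by (rewrite Rabs_pos_eq; lra).
  assert (D : forall r, is_derive (oddlog r) (exp (- y)) (PSeries (PS_derive (odd_coef r)) (exp (- y)))).
  { intros r. apply is_derive_PSeries, lt_CV_radius; [apply CV_radius_odd_coef|exact Hq']. }
  pose proof (D 2%nat) as D2. pose proof (D 3%nat) as D3.
  pose proof (oddlog_derive 1 _ Hq') as E2. pose proof (oddlog_derive 2 _ Hq') as E3.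
  pose proof (oddlog_1 (exp (- y)) ltac:(lra)) as E1. rewrite ell_log_quot in E1 by exact Hy.
  unfold y_ell_prim. set (g2 := oddlog 2) in *. set (g3 := oddlog 3) in *.
  auto_derive; [repeat split; eexists; eassumption|].
  subst_derive.
  set (p2 := PSeries (PS_derive (odd_coef 2)) (exp (- y))) in *.
  set (p3 := PSeries (PS_derive (odd_coef 3)) (exp (- y))) in *.
  rewrite <- E1, <- E2, <- E3. ring.
Qed.

Lemma ex_series_inv_sq : ex_series (fun n => / INR (S n) ^ 2).
Proof.
  eapply ex_series_ext; [|apply (ex_series_Rpower 1); lra].
  intros n. simpl. rewrite Rpower_Ropp. f_equal.
  assert (0 < INR (S n)) by (apply lt_0_INR; lia).
  replace (1 + 1) with (INR 2) by (simpl; ring). rewrite Rpower_pow by assumption. reflexivity.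
Qed.

Lemma ex_series_odd_coef r : ex_series (odd_coef (2 + r)).
Proof.
  apply (ex_series_incr_1 (odd_coef (2 + r))).
  apply (ex_series_dominated (fun n => / INR (S n) ^ 2)); [|apply ex_series_inv_sq].
  intros n. rewrite Rabs_pos_eq by apply odd_coef_bounds.
  assert (1 <= INR (S n)) by (rewrite S_INR; pose proof (pos_INR n); lra).
  unfold odd_coef. destruct (Nat.odd (S n)).
  - apply Rinv_le_contravar; [apply pow_lt; lra|]. rewrite pow_add.
    assert (1 <= INR (S n) ^ r) by (now apply pow_R1_Rle). assert (0 < INR (S n) ^ 2) by (apply pow_lt; lra). nra.
  - left. apply Rinv_0_lt_compat, pow_lt. lra.
Qed.

Lemma exp_neg_pow y n : exp (- y) ^ n = exp (- (INR n * y)).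
Proof. rewrite exp_INR_mult. f_equal. ring. Qed.

(** The value at [0] is minus the integral of [y * ell y] over the half-line. *)
Lemma y_ell_prim_at_0 y : 0 < y -> Rabs (y_ell_prim y + 2 * Series (odd_coef 3)) <= 4 * Series (odd_coef 2) * y.
Proof.
  intros Hy. pose proof (exp_neg_bounds y Hy) as Hq. set (q := exp (- y)) in *.
  assert (Hex : forall r, ex_series (fun n => odd_coef r n * q ^ n)).
  { intros r'. apply (ex_pseries_R (odd_coef r') q), CV_radius_inside, lt_CV_radius;
    [apply CV_radius_odd_coef|rewrite Rabs_pos_eq; lra]. }
  assert (Hp : forall n, 0 <= q ^ n <= 1).
  { intros n. split; [apply pow_le; lra|]. rewrite <- (pow1 n). apply pow_incr; lra. }
  assert (A2 : 0 <= oddlog 2 q <= Series (odd_coef 2)).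
  { split; [apply oddlog_le; lra|]. apply Series_le; [|apply (ex_series_odd_coef 0)].
    intros n. pose proof (odd_coef_bounds 2 n). specialize (Hp n). nra. }
  assert (A3 : 0 <= Series (odd_coef 3) - oddlog 3 q <= Series (odd_coef 2) * y).
  { unfold oddlog, PSeries. rewrite <- Series_minus by (apply (ex_series_odd_coef 1) || apply Hex).
    assert (T : forall n, 0 <= odd_coef 3 n - odd_coef 3 n * q ^ n <= odd_coef 2 n * y).
    { intros n. pose proof (odd_coef_bounds 3 n). pose proof (Hp n). split; [nra|].
      assert (E : 1 - q ^ n <= INR n * y).
      { unfold q. rewrite exp_neg_pow. pose proof (one_minus_le_exp (INR n * y)). lra. }
      assert (odd_coef 3 n * INR n = odd_coef 2 n).
      { unfold odd_coef. destruct n as [|n]; [simpl; ring|]. destruct (Nat.odd (S n)); [|ring].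
        assert (INR (S n) <> 0) by (apply not_0_INR; lia). field. assumption. }
      replace (odd_coef 2 n) with (odd_coef 3 n * INR n). nra. }
    split.
    - apply Series_nonneg; [intros n; apply T|].
      apply (ex_series_minus (V := R_NormedModule) (odd_coef 3)); [apply (ex_series_odd_coef 1)|apply Hex].
    - rewrite <- Series_scal_r. apply Series_le; [apply T|].
      apply ex_series_scal_r. apply (ex_series_odd_coef 0). }
  unfold y_ell_prim. fold q. 
  replace (- 2 * (y * oddlog 2 q + oddlog 3 q) + 2 * Series (odd_coef 3))
    with (- 2 * (y * oddlog 2 q) + 2 * (Series (odd_coef 3) - oddlog 3 q)) by ring.
  apply Rabs_le. assert (0 <= y * oddlog 2 q <= Series (odd_coef 2) * y) by nra. lra.
Qed.

(** The even terms of [sum 1 / n^3] add up to one eighth of the whole. *)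
Lemma Series_odd_coef_3 z3 : is_series (fun n => / INR (S n) ^ 3) z3 ->
  8 * Series (odd_coef 3) = 7 * z3.
Proof.
  intros Hz.
  pose proof (Series_correct _ (ex_series_odd_coef 1)) as Ho.
  change (is_lim_seq (sum_n (odd_coef 3)) (Series (odd_coef 3))) in Ho.
  change (is_lim_seq (sum_n (fun n => / INR (S n) ^ 3)) z3) in Hz.
  assert (E : forall N, sum_f_R0 (fun n => / INR (S n) ^ 3) (S (2 * N)) =
     sum_f_R0 (odd_coef 3) (S (S (2 * N))) + / 8 * sum_f_R0 (fun n => / INR (S n) ^ 3) N).
  { assert (P : forall p, INR (S p) <> 0) by (intros; apply not_0_INR; lia).
    induction N as [|N IH].
    - simpl. unfold odd_coef. simpl. field.
    - replace (2 * S N)%nat with (S (S (2 * N)))%nat by lia.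
      rewrite (tech5 _ (S (S (2 * N)))), (tech5 _ (S (2 * N))), IH.
      rewrite (tech5 (odd_coef 3) (S (S (S (2 * N))))), (tech5 (odd_coef 3) (S (S (2 * N)))).
      rewrite (tech5 _ N). unfold odd_coef at 3 4.
      replace (Nat.odd (S (S (S (2 * N))))) with true.
      2:{ symmetry. apply Nat.odd_spec. exists (S N). lia. }
      replace (Nat.odd (S (S (S (S (2 * N)))))) with false.
      2:{ symmetry. rewrite <- Nat.negb_even. replace (S (S (S (S (2 * N))))) with (2 * S (S N))%nat by lia.
          rewrite Nat.even_mul. reflexivity. }
      replace (INR (S (S (S (S (2 * N)))))) with (2 * INR (S (S N))).
      2:{ replace (S (S (S (S (2 * N))))) with (2 * S (S N))%nat by lia. rewrite mult_INR. simpl. ring. }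
      pose proof (P (S N)). pose proof (P (S (S (2 * N)))). field. split; assumption. }
  assert (L1 : is_lim_seq (fun N => sum_n (fun n => / INR (S n) ^ 3) (S (2 * N))) z3).
  { apply (is_lim_seq_subseq (sum_n (fun n => / INR (S n) ^ 3)) z3 (fun N => S (2 * N))); [|exact Hz].
    apply eventually_subseq. intros n. lia. }
  assert (L2 : is_lim_seq (fun N => sum_n (odd_coef 3) (S (S (2 * N)))) (Series (odd_coef 3))).
  { apply (is_lim_seq_subseq (sum_n (odd_coef 3)) (Series (odd_coef 3)) (fun N => S (S (2 * N)))); [|exact Ho].
    apply eventually_subseq. intros n. lia. }
  assert (L3 : is_lim_seq (fun N => sum_n (fun n => / INR (S n) ^ 3) (S (2 * N)))
    (Series (odd_coef 3) + / 8 * z3)).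
  { apply is_lim_seq_ext with (fun N => sum_n (odd_coef 3) (S (S (2 * N))) + / 8 * sum_n (fun n => / INR (S n) ^ 3) N).
    - intros N. rewrite !sum_n_Reals. symmetry. apply E.
    - apply is_lim_seq_plus'; [exact L2|]. apply (is_lim_seq_scal_l _ (/ 8) z3 Hz). }
  apply is_lim_seq_unique in L1. apply is_lim_seq_unique in L3. rewrite L1 in L3.
  injection L3. lra.
Qed.

(** * Asymptotics of the logarithm of the generating function *)

Lemma Rabs_le_inv x y : Rabs x <= y -> - y <= x <= y.
Proof. intros H. apply Rabs_le_between. exact H. Qed.

Definition EM_xlnx (x : R) : R :=
  EM (fun x => x ^ 2 / 4 - x ^ 2 / 2 * ln x) (fun x => - (x * ln x)) (fun x => - ln x - 1) x.

Definition EM_pp (t x : R) : R :=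
  EM (fun x => y_ell_prim (x * t) / t ^ 2) (fun x => x * ell (x * t)) (fun x => y_ell_d1 (x * t)) x.

(** The Euler-Maclaurin remainder of [x * (ell (x t) + ln (x t / 2))]: the
    logarithmic singularity is removed, and with it a linear function, whose
    remainder is zero. *)
Definition EM_rem (t x : R) : R :=
  EM (fun x => y_ell_prim (x * t) / t ^ 2 - (x ^ 2 / 4 - x ^ 2 / 2 * ln x) + x ^ 2 / 2 * ln (t / 2))
     (fun x => x * ell (x * t) + x * ln x + x * ln (t / 2))
     (fun x => y_ell_d1 (x * t) + ln x + 1 + ln (t / 2)) x.

Lemma EM_split t x : EM_pp t x = EM_rem t x + EM_xlnx x.
Proof. unfold EM_pp, EM_rem, EM_xlnx, EM, Rdiv. ring. Qed.

Lemma is_derive_xlnx_prim y : 0 < y ->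
  is_derive (fun x => x ^ 2 / 4 - x ^ 2 / 2 * ln x) y (- (y * ln y)).
Proof. intros Hy. auto_derive; [exact Hy|field; lra]. Qed.

Lemma is_derive_xlnx y : 0 < y -> is_derive (fun x => - (x * ln x)) y (- ln y - 1).
Proof. intros Hy. auto_derive; [exact Hy|field; lra]. Qed.

Lemma EM_xlnx_bound x : 0 < x -> Rabs (EM_xlnx x) <= 1 / x ^ 2.
Proof.
  intros Hx. unfold EM_xlnx.
  apply EM_bound with (f2 := fun x => - / x) (f3 := fun x => / x ^ 2); intros y Hy.
  - apply is_derive_xlnx_prim. lra.
  - apply is_derive_xlnx. lra.
  - auto_derive; [lra|field; lra].
  - auto_derive; [lra|field; lra].
  - assert (0 < x ^ 2) by (apply pow_lt; lra). assert (x ^ 2 <= y ^ 2) by (apply pow_incr; lra).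
    rewrite Rabs_pos_eq by (left; apply Rinv_0_lt_compat; lra).
    unfold Rdiv. rewrite Rmult_1_l. apply Rinv_le_contravar; lra.
Qed.

Lemma is_derive_dilate (f : R -> R) f' t x : is_derive f (x * t) f' ->
  is_derive (fun x => f (x * t)) x (t * f').
Proof.
  intros H. apply (is_derive_comp f (fun x => x * t) x f' t H).
  auto_derive; [exact I|ring].
Qed.

Lemma is_derive_pp_prim t x : 0 < t -> 0 < x ->
  is_derive (fun x => y_ell_prim (x * t) / t ^ 2) x (x * ell (x * t)).
Proof.
  intros Ht Hx. assert (0 < x * t) by nra.
  replace (x * ell (x * t)) with (t * (x * t * ell (x * t)) * / t ^ 2) by (field; lra).
  apply (is_derive_scal_l (V := R_NormedModule) (fun x => y_ell_prim (x * t)) x _ (/ t ^ 2)).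
  apply is_derive_dilate, is_derive_y_ell_prim. assumption.
Qed.

Lemma is_derive_pp_fun t x : 0 < t -> 0 < x ->
  is_derive (fun x => x * ell (x * t)) x (y_ell_d1 (x * t)).
Proof.
  intros Ht Hx. assert (0 < x * t) by nra.
  apply is_derive_ext with (fun x => x * t * ell (x * t) * / t); [intros y; simpl; field; lra|].
  replace (y_ell_d1 (x * t)) with (t * y_ell_d1 (x * t) * / t) by (field; lra).
  apply (is_derive_scal_l (V := R_NormedModule) (fun x => x * t * ell (x * t)) x _ (/ t)).
  apply (is_derive_dilate (fun y => y * ell y)), is_derive_y_ell. assumption.
Qed.

(** The third derivative of [x * ell (x t)] is [t^2 y_ell_d3 (x t)], and the
    bound on [y_ell_d3] makes the result uniform in [t]. *)
Lemma EM_pp_bound t x : 0 < t -> 0 < x -> Rabs (EM_pp t x) <= 41 / x ^ 2.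
Proof.
  intros Ht Hx. unfold EM_pp.
  apply EM_bound with (f2 := fun x => t * y_ell_d2 (x * t)) (f3 := fun x => t * (t * y_ell_d3 (x * t)));
    intros y Hy; assert (Hyt : 0 < y * t) by nra.
  - apply is_derive_pp_prim; lra.
  - apply is_derive_pp_fun; lra.
  - now apply is_derive_dilate, is_derive_y_ell_d1.
  - apply (is_derive_scal (fun x => y_ell_d2 (x * t)) y t). now apply is_derive_dilate, is_derive_y_ell_d2.
  - assert (0 < x ^ 2) by (apply pow_lt; lra). assert (x ^ 2 <= y ^ 2) by (apply pow_incr; lra).
    rewrite !Rabs_mult, (Rabs_pos_eq t) by lra.
    apply Rle_trans with (t * (t * (41 / (y * t * (y * t))))).
    + apply Rmult_le_compat_l; [lra|]. apply Rmult_le_compat_l; [lra|]. now apply y_ell_d3_bound.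
    + replace (t * (t * (41 / (y * t * (y * t))))) with (41 * / y ^ 2) by (field; lra).
      apply Rmult_le_compat_l; [lra|]. apply Rinv_le_contravar; lra.
Qed.

Lemma EM_rem_bound t x : 0 < t -> 0 < x -> Rabs (EM_rem t x) <= 42 / x ^ 2.
Proof.
  intros Ht Hx. pose proof (EM_pp_bound t x Ht Hx) as H1. pose proof (EM_xlnx_bound x Hx) as H2.
  rewrite EM_split in H1. apply Rabs_le_inv in H1. apply Rabs_le_inv in H2.
  apply Rabs_le. lra.
Qed.

Lemma ell_dilate_near_0 t x : 0 < t -> 0 < x -> x * t < 1 ->
  Rabs (ell (x * t) + ln x + ln (t / 2)) <= x * t.
Proof.
  intros Ht Hx Hxt. assert (0 < x * t) by nra.
  pose proof (ell_near_0 (x * t) ltac:(lra)) as H1.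
  replace (ln (x * t / 2)) with (ln x + ln (t / 2)) in H1.
  - rewrite <- Rplus_assoc in H1. exact H1.
  - rewrite <- ln_mult by lra. f_equal. field.
Qed.

(** The function itself, its derivative and the increment of its primitive all
    tend to zero with [t] on a fixed interval. *)
Lemma EM_rem_near_0 t x : 0 < t -> 0 < x -> (x + 1) * t < 1 ->
  Rabs (EM_rem t x) <= 5 * (x + 1) ^ 2 * t.
Proof.
  intros Ht Hx Hxt. unfold EM_rem, EM.
  set (P := fun x => y_ell_prim (x * t) / t ^ 2 - (x ^ 2 / 4 - x ^ 2 / 2 * ln x) + x ^ 2 / 2 * ln (t / 2)).
  set (f := fun x => x * ell (x * t) + x * ln x + x * ln (t / 2)).
  set (f1 := fun x => y_ell_d1 (x * t) + ln x + 1 + ln (t / 2)).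
  change (Rabs ((f x + f (x + 1)) / 2 - (P (x + 1) - P x) - (f1 (x + 1) - f1 x) / 12) <= 5 * (x + 1) ^ 2 * t).
  assert (Bf : forall y, x <= y <= x + 1 -> Rabs (f y) <= (x + 1) ^ 2 * t).
  { intros y Hy. assert (y * t < 1) by nra. 
    pose proof (ell_dilate_near_0 t y Ht ltac:(lra) H) as E. unfold f.
    replace (y * ell (y * t) + y * ln y + y * ln (t / 2)) with (y * (ell (y * t) + ln y + ln (t / 2))) by ring.
    rewrite Rabs_mult, (Rabs_pos_eq y) by lra.
    apply Rle_trans with (y * (y * t)); [apply Rmult_le_compat_l; lra|].
    assert (y * y <= (x + 1) ^ 2) by nra. nra. }
  assert (Bf1 : forall y, x <= y <= x + 1 -> Rabs (f1 y) <= 2 * (x + 1) * t).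
  { intros y Hy. assert (y * t < 1) by nra. assert (0 < y * t) by nra.
    pose proof (ell_dilate_near_0 t y Ht ltac:(lra) H) as E. unfold f1, y_ell_d1.
    pose proof (ratio_sinh_bounds (y * t) H0) as Rt.
    apply Rabs_le_inv in E. apply Rabs_le. assert (y * t <= (x + 1) * t) by nra. lra. }
  assert (BP : Rabs (P (x + 1) - P x) <= (x + 1) ^ 2 * t * (x + 1 - x)).
  { apply (mean_value_inequality P f); [lra| |exact Bf].
    intros y Hy.
    pose proof (is_derive_pp_prim t y Ht ltac:(lra)) as D. unfold P, f.
    pose (g := fun x => y_ell_prim (x * t) / t ^ 2).
    match type of D with is_derive _ _ ?v => change (is_derive g y v) in D end.
    change (is_derive (fun x => g x - (x ^ 2 / 4 - x ^ 2 / 2 * ln x) + x ^ 2 / 2 * ln (t / 2)) y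
      (y * ell (y * t) + y * ln y + y * ln (t / 2))).
    clearbody g. auto_derive; [repeat split; try (eexists; eassumption); lra|].
 subst_derive. field. lra. }
  pose proof (Bf x ltac:(lra)) as B1. pose proof (Bf (x + 1) ltac:(lra)) as B2.
  pose proof (Bf1 x ltac:(lra)) as B3. pose proof (Bf1 (x + 1) ltac:(lra)) as B4.
  assert (2 * (x + 1) * t <= 2 * (x + 1) ^ 2 * t) by (apply Rmult_le_compat_r; [lra|nra]).
  apply Rabs_le_inv in B1. apply Rabs_le_inv in B2. apply Rabs_le_inv in B3. apply Rabs_le_inv in B4.
  apply Rabs_le_inv in BP. apply Rabs_le. lra.
Qed.

Lemma ex_series_inv_sq_scal c : ex_series (fun n => c / INR (S n) ^ 2).
Proof. apply (ex_series_Rscal c), ex_series_inv_sq. Qed.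

Lemma INR_S_pos n : 0 < INR (S n).
Proof. apply lt_0_INR. lia. Qed.

Lemma ex_series_EM_rem t : 0 < t -> ex_series (fun n => EM_rem t (INR (S n))).
Proof.
  intros Ht. apply (ex_series_dominated (fun n => 42 / INR (S n) ^ 2)).
  - intros n. apply EM_rem_bound; [exact Ht|apply INR_S_pos].
  - apply ex_series_inv_sq_scal.
Qed.

Lemma ex_series_EM_xlnx : ex_series (fun n => EM_xlnx (INR (S n))).
Proof.
  apply (ex_series_dominated (fun n => 1 / INR (S n) ^ 2)).
  - intros n. apply EM_xlnx_bound, INR_S_pos.
  - apply ex_series_inv_sq_scal.
Qed.

(** [EM_rem_bound] dominates the terms uniformly in [t], [EM_rem_near_0] makes
    each of them tend to zero. *)
Lemma small_EM_rem : small (fun t => Series (fun n => EM_rem t (INR (S n)))).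
Proof.
  apply small_Series with (b := fun n => 42 / INR (S n) ^ 2) (t0 := 1); [lra|apply ex_series_inv_sq_scal| |].
  - intros t n Ht. apply EM_rem_bound; [lra|apply INR_S_pos].
  - intros n. pose proof (INR_S_pos n) as Hn.
    assert (0 < / (INR (S n) + 1)) by (apply Rinv_0_lt_compat; lra).
    apply small_le with (h := fun t => 5 * (INR (S n) + 1) ^ 2 * t) (t0 := / (INR (S n) + 1)); [assumption| |].
    + intros t Ht. apply EM_rem_near_0; [lra|assumption|].
      apply Rmult_lt_reg_l with (/ (INR (S n) + 1)); [lra|].
      rewrite <- Rmult_assoc, Rinv_l by lra. lra.
    + apply small_scal, small_id.
Qed.

Lemma is_lim_seq_0_of_le (a : nat -> R) C :
  (forall n, (1 <= n)%nat -> Rabs (a n) <= C / INR n) -> is_lim_seq a 0.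
Proof.
  intros H. apply is_lim_seq_abs_0.
  apply (is_lim_seq_le_le_loc (fun _ => 0) _ (fun n => C * / INR n)).
  - exists 1%nat. intros n Hn. split; [apply Rabs_pos|]. now apply H.
  - apply is_lim_seq_const.
  - replace 0 with (C * 0) by ring. apply (is_lim_seq_scal_l _ C 0).
    apply (is_lim_seq_inv INR p_infty); [apply is_lim_seq_INR|discriminate].
Qed.

Lemma ell_decay t y : 0 < t <= y -> (1 + y) * ell y <= 12 / (1 - exp (- t)) * (1 / t ^ 2 + 1 / t) / y.
Proof.
  intros Hy. pose proof (exp_neg_bounds t ltac:(lra)) as Ht. pose proof (exp_neg_bounds y ltac:(lra)) as Hq.
  assert (E : exp (- y) <= exp (- t)) by (apply exp_le_compat; lra).
  assert (E3 : exp (- y) <= 6 / y ^ 3).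
  { assert (0 < y ^ 3) by (apply pow_lt; lra).
    apply le_div_of_mul_le; [assumption|]. rewrite exp_Ropp.
    apply Rmult_le_reg_l with (exp y); [apply exp_pos|].
    rewrite <- Rmult_assoc, Rinv_r, Rmult_1_l by (apply Rgt_not_eq, exp_pos).
    pose proof (sinh_ge_cube y ltac:(lra)). unfold sinh in *. pose proof (exp_pos (- y)). pose proof (exp_pos y). lra. }
  assert (L : ell y <= 2 * (6 / y ^ 3) / (1 - exp (- t))).
  { rewrite <- ell_log_quot by lra. eapply Rle_trans; [apply log_quot_le; lra|].
    unfold Rdiv at 1 3. apply Rmult_le_compat; try lra.
    - left. apply Rinv_0_lt_compat. lra.
    - apply Rinv_le_contravar; lra. }
  apply Rle_trans with ((1 + y) * (2 * (6 / y ^ 3) / (1 - exp (- t)))).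
  { apply Rmult_le_compat_l; lra. }
  replace ((1 + y) * (2 * (6 / y ^ 3) / (1 - exp (- t)))) with
    (12 / (1 - exp (- t)) * (1 / y ^ 2 + 1 / y) * / y) by (field; lra).
  apply (Rmult_le_compat_r (/ y)); [left; apply Rinv_0_lt_compat; lra|].
  apply Rmult_le_compat_l; [left; apply Rdiv_lt_0_compat; lra|].
  unfold Rdiv. rewrite !Rmult_1_l. apply Rplus_le_compat; apply Rinv_le_contravar; try lra.
  - apply pow_lt; lra.
  - apply pow_incr; lra.
Qed.

(** Euler-Maclaurin summation of [x * ell (x t)]; the boundary terms at infinity
    vanish. *)
Lemma pp_log_EM t : 0 < t ->
  PSeries pp_log_coef (exp (- t)) =
  ell t / 2 - y_ell_prim t / t ^ 2 - y_ell_d1 t / 12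
  + (Series (fun n => EM_rem t (INR (S n))) + Series (fun n => EM_xlnx (INR (S n)))).
Proof.
  intros Ht. pose proof (exp_neg_bounds t Ht) as Hq.
  pose proof (pp_log_series (exp (- t)) ltac:(lra)) as H1.
  set (D := 12 / (1 - exp (- t)) * (1 / t ^ 2 + 1 / t)).
  assert (D0 : 0 < D).
  { unfold D. apply Rmult_lt_0_compat; [apply Rdiv_lt_0_compat; lra|].
    apply Rplus_lt_0_compat; apply Rdiv_lt_0_compat; try lra. apply pow_lt; lra. }
  assert (Hn : forall n, (1 <= n)%nat -> 0 < INR n /\ 0 < t <= INR n * t /\ 0 <= ell (INR n * t) /\
     (1 + INR n * t) * ell (INR n * t) <= D / t / INR n).
  { intros n h. assert (1 <= INR n) by (replace 1 with (INR 1) by reflexivity; apply le_INR; exact h).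
    assert (t <= INR n * t) by nra. repeat split; try lra.
    - apply ell_nonneg. lra.
    - replace (D / t / INR n) with (D / (INR n * t)) by (field; lra). apply ell_decay. lra. }
  assert (H2 : is_series (fun i => INR (S i) * ell (INR (S i) * t))
     (1 * ell (1 * t) / 2 + (0 - y_ell_prim (1 * t) / t ^ 2) - y_ell_d1 (1 * t) / 12 +
      (Series (fun n => EM_rem t (INR (S n))) + Series (fun n => EM_xlnx (INR (S n)))))).
  { apply (EM_series (fun x => y_ell_prim (x * t) / t ^ 2) (fun x => x * ell (x * t)) (fun x => y_ell_d1 (x * t))).
    - apply is_series_ext with (fun n => EM_rem t (INR (S n)) + EM_xlnx (INR (S n))).
      + intros n. symmetry. apply EM_split.
      + apply (is_series_plus (V := R_NormedModule) (fun n => EM_rem t (INR (S n))) (fun n => EM_xlnx (INR (S n))));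
        apply Series_correct; [now apply ex_series_EM_rem|apply ex_series_EM_xlnx].
    - apply is_lim_seq_0_of_le with (D / t ^ 2). intros n h. destruct (Hn n h) as [N1 [N2 [N3 N4]]].
      rewrite Rabs_pos_eq by nra.
      replace (INR n * ell (INR n * t)) with (INR n * t * ell (INR n * t) / t) by (field; lra).
      replace (D / t ^ 2 / INR n) with (D / t / INR n / t) by (field; lra).
      apply Rmult_le_compat_r; [left; apply Rinv_0_lt_compat; lra|]. lra.
    - apply is_lim_seq_0_of_le with (D / t + 6 / t ^ 2). intros n h. destruct (Hn n h) as [N1 [N2 [N3 N4]]].
      unfold y_ell_d1.
      assert (S0 : 0 < INR n * t / sinh (INR n * t) <= 6 / t ^ 2 / INR n).
      { pose proof (sinh_pos (INR n * t) ltac:(lra)). split; [apply Rdiv_lt_0_compat; lra|].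
        apply div_le_of_le_mul; [assumption|]. pose proof (sinh_ge_cube (INR n * t) ltac:(lra)) as Hc.
        apply Rle_trans with (6 / t ^ 2 / INR n * ((INR n * t) ^ 3 / 6)).
        - replace (6 / t ^ 2 / INR n * ((INR n * t) ^ 3 / 6)) with (INR n * t * INR n) by (field; lra).
          assert (1 <= INR n) by (replace 1 with (INR 1) by reflexivity; apply le_INR; exact h). nra.
        - apply Rmult_le_compat_l; [|lra]. left. repeat apply Rdiv_lt_0_compat; try lra. apply pow_lt; lra. }
      replace ((D / t + 6 / t ^ 2) / INR n) with (D / t / INR n + 6 / t ^ 2 / INR n) by (field; lra).
      assert (0 <= INR n * t * ell (INR n * t)) by (apply Rmult_le_pos; lra).
      assert (0 < D / t / INR n) by (repeat apply Rdiv_lt_0_compat; lra).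
      apply Rabs_le. lra.
    - apply is_lim_seq_0_of_le with (D / t / t ^ 2). intros n h. destruct (Hn n h) as [N1 [N2 [N3 N4]]].
      assert (P2 : 0 < t ^ 2) by (apply pow_lt; lra).
      unfold Rdiv at 1. rewrite Rabs_mult, (Rabs_pos_eq (/ t ^ 2)) by (left; apply Rinv_0_lt_compat; lra).
      replace (D / t / t ^ 2 / INR n) with (D / t / INR n * / t ^ 2) by (field; lra).
      apply Rmult_le_compat_r; [left; apply Rinv_0_lt_compat; lra|].
      eapply Rle_trans; [|exact N4]. unfold y_ell_prim.
      set (y := INR n * t) in *. pose proof (exp_neg_bounds y ltac:(lra)).
      pose proof (oddlog_le 1 (exp (- y)) ltac:(lra)). pose proof (oddlog_le 2 (exp (- y)) ltac:(lra)).
      pose proof (oddlog_1 (exp (- y)) ltac:(lra)) as E1. rewrite ell_log_quot in E1 by lra.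
      rewrite Rabs_mult, (Rabs_left (-2)) by lra.
      assert (0 <= y * oddlog 2 (exp (- y)) <= y * (ell y / 2)) by (split; [apply Rmult_le_pos; lra|apply Rmult_le_compat_l; lra]).
      rewrite Rabs_pos_eq by lra. lra. }
  assert (H3 : is_series (fun i => INR (S i) * ell (INR (S i) * t)) (PSeries pp_log_coef (exp (- t)))).
  { eapply is_series_ext; [|exact H1]. intros n. cbv beta. rewrite exp_neg_pow, ell_log_quot; [reflexivity|].
    pose proof (INR_S_pos n). nra. }
  rewrite <- (is_series_unique _ _ H3), (is_series_unique _ _ H2). rewrite !Rmult_1_l. lra.
Qed.

(** The derivative of the left-hand side is [y * (ell y + ln (y / 2))], at most
    [y^2]; the constant is determined by letting the lower end of the interval
    tend to [0]. *)
Lemma y_ell_prim_near_0 t : 0 < t < 1 ->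
  Rabs (y_ell_prim t - (t ^ 2 / 4 - t ^ 2 / 2 * ln (t / 2)) + 2 * Series (odd_coef 3)) <= t ^ 3.
Proof.
  intros Ht.
  set (Psi := fun y => y_ell_prim y - (y ^ 2 / 4 - y ^ 2 / 2 * ln (y / 2))).
  set (Z := 2 * Series (odd_coef 3)). set (K := 4 * Series (odd_coef 2)).
  change (Rabs (Psi t + Z) <= t ^ 3).
  assert (DP : forall y, 0 < y -> is_derive Psi y (y * (ell y + ln (y / 2)))).
  { intros y Hy. pose proof (is_derive_y_ell_prim y Hy) as D. unfold Psi. 
    auto_derive; [repeat split; try (eexists; eassumption); lra|].
 subst_derive. unfold Rdiv. field. lra. }
  assert (K0 : 0 <= K).
  { unfold K. assert (0 <= Series (odd_coef 2)); [|lra].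
    apply Series_nonneg; [intros n; apply odd_coef_bounds|apply (ex_series_odd_coef 0)]. }
  assert (LB : forall e, 0 < e < 1 -> e ^ 2 * Rabs (ln (e / 2)) <= 2 * e).
  { intros e He. 
    assert (- (2 / e) <= ln (e / 2) <= 0).
    { split.
      - pose proof (exp_ineq1_le (ln (/ (e / 2)))) as E.
        rewrite exp_ln in E by (apply Rinv_0_lt_compat; lra). rewrite ln_Rinv in E by lra.
        replace (/ (e / 2)) with (2 / e) in E by (field; lra). lra.
      - rewrite <- ln_1. apply Rcomplements.ln_le; lra. }
    rewrite Rabs_left1 by lra. apply Rle_trans with (e ^ 2 * (2 / e)).
    - apply Rmult_le_compat_l; [apply pow2_ge_0|lra].
    - right. field. lra. }
  apply le_epsilon. intros eps He.
  set (e := Rmin (t / 2) (eps / (K + 2))).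
  assert (He0 : 0 < e).
  { apply Rmin_glb_lt; [lra|]. apply Rdiv_lt_0_compat; lra. }
  assert (e <= t / 2) by apply Rmin_l.
  assert (Hee : e * (K + 2) <= eps).
  { apply Rle_trans with (eps / (K + 2) * (K + 2)); [apply Rmult_le_compat_r; [lra|apply Rmin_r]|].
    right. field. lra. }
  assert (A1 : Rabs (Psi t - Psi e) <= t ^ 2 * (t - e)).
  { apply (mean_value_inequality Psi (fun y => y * (ell y + ln (y / 2)))); [lra| |].
    - intros y Hy. apply DP. lra.
    - intros y Hy. rewrite Rabs_mult, (Rabs_pos_eq y) by lra.
      pose proof (ell_near_0 y ltac:(lra)). apply Rle_trans with (y * y); [apply Rmult_le_compat_l; lra|nra]. }
  assert (A2 : Rabs (Psi e + Z) <= (K + 2) * e).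
  { pose proof (y_ell_prim_at_0 e He0) as F. fold Z K in F. pose proof (LB e ltac:(lra)) as L.
    unfold Psi. replace (y_ell_prim e - (e ^ 2 / 4 - e ^ 2 / 2 * ln (e / 2)) + Z)
      with ((y_ell_prim e + Z) + (- (e ^ 2 / 4) + e ^ 2 * ln (e / 2) / 2)) by field.
    eapply Rle_trans; [apply Rabs_triang|].
    rewrite <- (Rabs_pos_eq (e ^ 2)) in L by apply pow2_ge_0. rewrite <- Rabs_mult in L.
    apply Rabs_le_inv in L.
    assert (Rabs (- (e ^ 2 / 4) + e ^ 2 * ln (e / 2) / 2) <= 2 * e) by (apply Rabs_le; nra).
    lra. }
  replace (Psi t + Z) with ((Psi t - Psi e) + (Psi e + Z)) by ring.
  eapply Rle_trans; [apply Rabs_triang|]. assert (t ^ 2 * (t - e) <= t ^ 3) by nra. lra.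
Qed.

(** Equal to [zeta'(-1) + 1/6]; see [zeta_derive_m1]. *)
Definition em_const : R := Series (fun n => EM_xlnx (INR (S n))).

Definition pp_log (t : R) : R := PSeries pp_log_coef (exp (- t)).

Lemma pp_log_asymp :
  small (fun t => pp_log t -
    (2 * Series (odd_coef 3) / t ^ 2 + ln (t / 2) / 12 - / 6 + em_const)).
Proof.
  apply small_le with (h := fun t => 3 * t + Rabs (Series (fun n => EM_rem t (INR (S n))))) (t0 := 1); [lra| |].
  2:{ apply small_plus; [apply small_scal, small_id|].
      intros eps He. destruct (small_EM_rem eps He) as [d [Hd H]]. exists d. split; [exact Hd|].
      intros t Ht. rewrite Rabs_Rabsolu. now apply H. }
  intros t Ht. unfold pp_log. rewrite pp_log_EM by lra. fold em_const.
  set (E := Series (fun n => EM_rem t (INR (S n)))).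
  pose proof (y_ell_prim_near_0 t Ht) as H1. set (Z := 2 * Series (odd_coef 3)) in *.
  pose proof (ell_near_0 t Ht) as H2. pose proof (ratio_sinh_bounds t ltac:(lra)) as H3.
  set (P := y_ell_prim t - (t ^ 2 / 4 - t ^ 2 / 2 * ln (t / 2)) + Z) in *.
  assert (P2 : 0 < t ^ 2) by (apply pow_lt; lra).
  assert (H4 : Rabs (P / t ^ 2) <= t).
  { unfold Rdiv. rewrite Rabs_mult, (Rabs_pos_eq (/ t ^ 2)) by (left; apply Rinv_0_lt_compat; lra).
    apply div_le_of_le_mul; [assumption|]. eapply Rle_trans; [exact H1|]. right. ring. }
  unfold y_ell_d1. set (k := ell t + ln (t / 2)) in *.
  replace (ell t / 2 - y_ell_prim t / t ^ 2 - (ell t - t / sinh t) / 12 + (E + em_const) -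
    (Z / t ^ 2 + ln (t / 2) / 12 - / 6 + em_const))
    with (k / 2 - P / t ^ 2 - k / 12 - (1 - t / sinh t) / 12 + E) by (unfold P, k; field; split; [lra|]; try (apply Rgt_not_eq, sinh_pos); lra).
  eapply Rle_trans; [apply Rabs_triang|]. apply Rplus_le_compat_r.
  apply Rabs_le_inv in H2. apply Rabs_le_inv in H4. apply Rabs_le. lra.
Qed.

(** * Fourier coefficients and Cauchy's estimate *)

Fixpoint Cpsum (a : nat -> C) (n : nat) : C :=
  match n with O => a O | S n' => (Cpsum a n' + a n)%C end.

Lemma Re_Cpsum a n : Re (Cpsum a n) = sum_f_R0 (fun k => Re (a k)) n.
Proof. induction n as [|n IH]; [reflexivity|]. simpl. f_equal. exact IH. Qed.

Lemma Im_Cpsum a n : Im (Cpsum a n) = sum_f_R0 (fun k => Im (a k)) n.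
Proof. induction n as [|n IH]; [reflexivity|]. simpl. f_equal. exact IH. Qed.

Lemma Cser_of_limit a l (e : nat -> R) : (forall n, Cmod (Cpsum a n - l)%C <= e n) ->
  is_lim_seq e 0 -> Cser a l.
Proof.
  intros H He.
  assert (G : forall (f : C -> R), (forall z w, f (z - w)%C = f z - f w) -> (forall z, Rabs (f z) <= Cmod z) ->
    (forall n, f (Cpsum a n) = sum_f_R0 (fun k => f (a k)) n) -> is_series (fun n => f (a n)) (f l)).
  { intros f Hf1 Hf2 Hf3.
    change (is_lim_seq (sum_n (fun n => f (a n))) (f l)).
    apply is_lim_seq_ext with (fun n => f (Cpsum a n - l)%C + f l).
    - intros n. rewrite sum_n_Reals, Hf1, Hf3. ring.
    - replace (Finite (f l)) with (Finite (0 + f l)) by (f_equal; ring). apply is_lim_seq_plus'; [|apply is_lim_seq_const].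
      apply is_lim_seq_abs_0. apply is_lim_seq_le_le with (fun _ => 0) e; [|apply is_lim_seq_const|exact He].
      intros n. split; [apply Rabs_pos|]. eapply Rle_trans; [apply Hf2|apply H]. }
  split; apply G.
  - intros [] []. reflexivity.
  - apply re_le_Cmod.
  - apply Re_Cpsum.
  - intros [] []. reflexivity.
  - apply Im_le_Cmod.
  - apply Im_Cpsum.
Qed.

Lemma Cser_zero (a : nat -> C) : (forall k, a k = 0%C) -> Cser a 0%C.
Proof.
  intros H. apply Cser_of_limit with (fun _ => 0); [|apply is_lim_seq_const].
  intros n. replace (Cpsum a n) with (RtoC 0).
  - unfold Cminus. rewrite Cplus_opp_r, Cmod_0. lra.
  - induction n as [|n IH]; simpl; rewrite H; [reflexivity|]. rewrite <- IH. ring.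
Qed.

Lemma Cser_shift a l K : Cser a l -> Cser (fun k => a (S K + k)%nat) (l - Cpsum a K)%C.
Proof.
  intros [H1 H2]. split.
  - replace (Re (l - Cpsum a K)%C) with (Re l - Re (Cpsum a K)) by (destruct l, (Cpsum a K); reflexivity).
    rewrite Re_Cpsum, <- sum_n_Reals.
    apply (is_series_incr_n (V := R_NormedModule) (fun k => Re (a k)) (S K)); [lia|].
    simpl pred. match goal with |- is_series _ ?x => replace x with (Re l); [exact H1|] end.
    set (S := sum_n (fun k => Re (a k)) K). change (Re l = Re l - S + S). ring.
  - replace (Im (l - Cpsum a K)%C) with (Im l - Im (Cpsum a K)) by (destruct l, (Cpsum a K); reflexivity).
    rewrite Im_Cpsum, <- sum_n_Reals.
    apply (is_series_incr_n (V := R_NormedModule) (fun k => Im (a k)) (S K)); [lia|].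
    simpl pred. match goal with |- is_series _ ?x => replace x with (Im l); [exact H2|] end.
    set (S := sum_n (fun k => Im (a k)) K). change (Im l = Im l - S + S). ring.
Qed.

Lemma geometric_tail a l M x K : Cser a l -> 0 <= x < 1 -> (forall k, Cmod (a k) <= M * x ^ k) ->
  Cmod (l - Cpsum a K)%C <= M * x ^ S K / (1 - x).
Proof.
  intros Ha Hx H.
  apply (Cser_Cmod_le (fun k => a (S K + k)%nat) (fun k => M * x ^ S K * x ^ k)).
  - now apply Cser_shift.
  - intros k. eapply Rle_trans; [apply H|]. right. rewrite pow_add. ring.
  - unfold Rdiv. apply (is_series_scal (V := R_NormedModule) (M * x ^ S K)).
    apply is_series_geom. rewrite Rabs_pos_eq; lra.
Qed.

Lemma Cser_terms_bounded a l : Cser a l -> exists M, 0 <= M /\ forall k, Cmod (a k) <= M.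
Proof.
  intros [H1 H2].
  destruct (is_lim_seq_bounded (fun n => Re (a n)) 0) as [M1 HM1].
  { apply (ex_series_lim_0 (fun n => Re (a n))). now exists (Re l). }
  destruct (is_lim_seq_bounded (fun n => Im (a n)) 0) as [M2 HM2].
  { apply (ex_series_lim_0 (fun n => Im (a n))). now exists (Im l). }
  exists (M1 + M2).
  assert (G : forall k, Cmod (a k) <= M1 + M2).
  { intros k. eapply Rle_trans; [apply Cmod_le_sum|]. specialize (HM1 k); specialize (HM2 k). lra. }
  split; [|exact G]. eapply Rle_trans; [apply Cmod_ge_0|apply (G O)].
Qed.

Lemma sin_INR_diff_PI k n : sin ((INR k - INR n) * PI) = 0.
Proof.
  apply sin_eq_0_1. exists (Z.of_nat k - Z.of_nat n)%Z.
  rewrite minus_IZR, <- !INR_IZR_INZ. reflexivity.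
Qed.

(** [Re (A_k e^(i (k - n) th))], spelled out so that it can be integrated. *)
Definition fourier_term (A : nat -> C) (n : nat) (k : nat) (th : R) : R :=
  Re (A k) * cos ((INR k - INR n) * th) - Im (A k) * sin ((INR k - INR n) * th).

Definition cis (x : R) : C := (cos x, sin x).

Lemma cis_plus x y : cis (x + y) = (cis x * cis y)%C.
Proof. unfold cis, Cmult; simpl. rewrite cos_plus, sin_plus. f_equal; ring. Qed.

Lemma Cmod_cis x : Cmod (cis x) = 1.
Proof.
  unfold cis, Cmod; simpl. replace (cos x * (cos x * 1) + sin x * (sin x * 1)) with (Rsqr (sin x) + Rsqr (cos x))
    by (unfold Rsqr; ring). rewrite sin2_cos2. apply sqrt_1.
Qed.

Lemma cis_pow x n : (cis x ^ n)%C = cis (INR n * x).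
Proof.
  induction n as [|n IH].
  - simpl. unfold cis. rewrite Rmult_0_l, cos_0, sin_0. reflexivity.
  - rewrite Cpow_S, IH, <- cis_plus, S_INR. f_equal. ring.
Qed.

Lemma fourier_term_eq A n k th :
  fourier_term A n k th = Re (cis (- (INR n * th)) * (A k * cis (INR k * th)))%C.
Proof.
  rewrite (Cmult_comm (A k)), Cmult_assoc, <- cis_plus.
  replace (- (INR n * th) + INR k * th) with ((INR k - INR n) * th) by ring.
  unfold cis, fourier_term. destruct (A k) as [p q]; simpl. ring.
Qed.

Lemma fourier_term_le A n k th : Rabs (fourier_term A n k th) <= Cmod (A k).
Proof.
  rewrite fourier_term_eq. eapply Rle_trans; [apply re_le_Cmod|].
  rewrite !Cmod_mult, !Cmod_cis. lra.
Qed.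

Lemma is_RInt_fourier_term A n k :
  is_RInt (fourier_term A n k) (- PI) PI (if Nat.eqb k n then 2 * PI * Re (A n) else 0).
Proof.
  destruct (Nat.eqb_spec k n) as [->|Hk].
  - apply is_RInt_ext with (fun _ => Re (A n)).
    + intros th _. unfold fourier_term. rewrite Rminus_diag, Rmult_0_l, cos_0, sin_0, Rmult_1_r, Rmult_0_r. symmetry. apply Rminus_0_r.
    + assert (E : (PI - - PI) * Re (A n) = 2 * PI * Re (A n)) by ring. rewrite <- E.
      apply (is_RInt_const (V := R_NormedModule)).
  - assert (Hm : INR k - INR n <> 0).
    { intros E. apply Hk. apply INR_eq. lra. }
    set (m := INR k - INR n) in *.
    pose (P := fun th => (Re (A k) * sin (m * th) + Im (A k) * cos (m * th)) / m).
    replace 0 with (minus (G := R_AbelianGroup) (P PI) (P (- PI))).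
    + apply (is_RInt_derive (V := R_CompleteNormedModule) P).
      * intros th _. unfold P, fourier_term. fold m. auto_derive; [exact I|]. field. exact Hm.
      * intros th _. apply (ex_derive_continuous (V := R_NormedModule)).
        unfold fourier_term. fold m. auto_derive. exact I.
    + change (@eq R (P PI - P (- PI)) 0). unfold P.
      replace (m * - PI) with (- (m * PI)) by ring. rewrite sin_neg, cos_neg.
      unfold m. rewrite sin_INR_diff_PI. fold m. field. exact Hm.
Qed.

Lemma is_RInt_sum_f_R0 (f : nat -> R -> R) (l : nat -> R) a b N :
  (forall k, is_RInt (f k) a b (l k)) ->
  is_RInt (fun x => sum_f_R0 (fun k => f k x) N) a b (sum_f_R0 l N).
Proof.
  intros H. induction N as [|N IH]; [apply H|].
  simpl. apply (is_RInt_plus (V := R_NormedModule) (fun x => sum_f_R0 (fun k => f k x) N) (f (S N)));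
  [exact IH|apply H].
Qed.

Lemma sum_f_R0_single (x : R) n N : (n <= N)%nat ->
  sum_f_R0 (fun k => if Nat.eqb k n then x else 0) N = x.
Proof.
  assert (Z : forall N, (N < n)%nat -> sum_f_R0 (fun k => if Nat.eqb k n then x else 0) N = 0).
  { induction N0 as [|N0 IH]; intros h; simpl.
    - destruct n; [lia|reflexivity].
    - rewrite IH by lia. destruct n; [lia|]. destruct (Nat.eqb_spec N0 n); [lia|ring]. }
  intros h. induction h as [|N h IH].
  - destruct n; [reflexivity|]. rewrite tech5, Z by lia. rewrite Nat.eqb_refl. ring.
  - rewrite tech5, IH. destruct (Nat.eqb_spec (S N) n); [lia|ring].
Qed.

(** The series converges uniformly on the circle, so that it may be integrated
    term by term, and only the constant term has a non-zero integral. *)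
Lemma is_RInt_fourier A n : ex_series (fun k => Cmod (A k)) ->
  is_RInt (fun th => Series (fun k => fourier_term A n k th)) (- PI) PI (2 * PI * Re (A n)).
Proof.
  intros HA.
  pose (f := fun N th => sum_f_R0 (fun k => fourier_term A n k th) N).
  destruct (filterlim_RInt (V := R_CompleteNormedModule) f (- PI) PI eventually _
    (fun th => Series (fun k => fourier_term A n k th))
    (fun N => sum_f_R0 (fun k => if Nat.eqb k n then 2 * PI * Re (A n) else 0) N)) as [l [Hl Hi]].
  - intros N. apply is_RInt_sum_f_R0. intros k. apply is_RInt_fourier_term.
  - intros P [eps HP].
    pose proof (Series_correct _ HA) as Hs.
    change (is_lim_seq (sum_n (fun k => Cmod (A k))) (Series (fun k => Cmod (A k)))) in Hs.
    apply is_lim_seq_spec in Hs. destruct (Hs eps) as [N HN].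
    exists N. intros N' HN'. apply HP. intros th.
    specialize (HN N' HN'). rewrite sum_n_Reals in HN. apply Rabs_def2 in HN.
    change (Rabs (f N' th - Series (fun k => fourier_term A n k th)) < eps).
    rewrite Rabs_minus_sym. unfold f.
    assert (E1 : ex_series (fun k => Rabs (fourier_term A n k th))).
    { apply (ex_series_dominated_abs (fun k => Cmod (A k))); [|exact HA].
      intros k. apply fourier_term_le. }
    rewrite (Series_incr_n (fun k => fourier_term A n k th) (S N')) by (lia || now apply ex_series_Rabs).
    rewrite (Series_incr_n (fun k => Cmod (A k)) (S N')) in HN by (lia || assumption).
    simpl pred in *.
    match goal with |- Rabs (?s + ?t - ?s) < _ => replace (s + t - s) with t by ring end.
    assert (HA' : ex_series (fun k => Cmod (A (S N' + k)%nat))) by now apply (ex_series_incr_n (fun k => Cmod (A k)) (S N')).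
    apply Rle_lt_trans with (Series (fun k => Cmod (A (S N' + k)%nat))); [|lra].
    eapply Rle_trans; [apply Series_Rabs|].
    + apply (ex_series_incr_n (fun k => Rabs (fourier_term A n k th)) (S N')). exact E1.
    + apply Series_le; [|exact HA']. intros k. split; [apply Rabs_pos|apply fourier_term_le].
  - replace (2 * PI * Re (A n)) with l; [exact Hi|].
    assert (L : is_lim_seq (fun N => sum_f_R0 (fun k => if Nat.eqb k n then 2 * PI * Re (A n) else 0) N) (2 * PI * Re (A n))).
    { apply (is_lim_seq_ext_loc (fun _ => 2 * PI * Re (A n))); [|apply is_lim_seq_const].
      exists n. intros N h. symmetry. now apply sum_f_R0_single. }
    apply is_lim_seq_unique in L.
    change (is_lim_seq (fun N => sum_f_R0 (fun k => if Nat.eqb k n then 2 * PI * Re (A n) else 0) N) l) in Hl.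
    apply is_lim_seq_unique in Hl. rewrite L in Hl. now injection Hl.
Qed.

Lemma circle_pow r th k : ((RtoC r * cis th) ^ k)%C = (RtoC (r ^ k) * cis (INR k * th))%C.
Proof.
  rewrite Cpow_mult_l, <- RtoC_pow, cis_pow. reflexivity.
Qed.

Lemma Cmod_circle r th : 0 <= r -> Cmod (RtoC r * cis th)%C = r.
Proof. intros Hr. rewrite Cmod_mult, Cmod_R, Cmod_cis, Rabs_pos_eq; lra. Qed.

Lemma Re_coefficient_le A n M : ex_series (fun k => Cmod (A k)) ->
  (forall th, Cmod (Csum (fun k => (A k * cis (INR k * th))%C)) <= M) -> Rabs (Re (A n)) <= M.
Proof.
  intros HA HM. pose proof (is_RInt_fourier A n HA) as H. pose proof PI_RGT_0 as HPI.
  assert (B : Rabs (2 * PI * Re (A n)) <= (PI - - PI) * M).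
  { apply (norm_RInt_le (V := R_NormedModule) (fun th => Series (fun k => fourier_term A n k th)) (fun _ => M) (- PI) PI).
    - lra.
    - intros th _. specialize (HM th).
      assert (HC : Cser (fun k => (A k * cis (INR k * th))%C) (Csum (fun k => (A k * cis (INR k * th))%C))).
      { apply Csum_correct with (fun k => Cmod (A k)); [|exact HA]. intros k.
        rewrite Cmod_mult, Cmod_cis. lra. }
      destruct (Cser_scal (cis (- (INR n * th))) _ _ HC) as [HR _].
      assert (E : Series (fun k => fourier_term A n k th) =
        Re (cis (- (INR n * th)) * Csum (fun k => (A k * cis (INR k * th))%C))%C).
      { apply is_series_unique. eapply is_series_ext; [|exact HR]. intros k. symmetry. apply fourier_term_eq. }
      change (Rabs (Series (fun k => fourier_term A n k th)) <= M). rewrite E.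
      eapply Rle_trans; [apply re_le_Cmod|]. rewrite Cmod_mult, Cmod_cis. lra.
    - exact H.
    - apply (is_RInt_const (V := R_NormedModule) (- PI) PI M). }
  rewrite Rabs_mult, (Rabs_pos_eq (2 * PI)) in B by lra.
  apply Rmult_le_reg_l with (2 * PI); lra.
Qed.

(** The factor [2] comes from bounding the real and the imaginary part
    separately. *)
Lemma cauchy_estimate (a : nat -> C) r n M : 0 <= r -> ex_series (fun k => Cmod (a k) * r ^ k) ->
  (forall w, Cmod w = r -> Cmod (Csum (fun k => (a k * w ^ k)%C)) <= M) -> Cmod (a n) * r ^ n <= 2 * M.
Proof.
  intros Hr Ha HM.
  assert (Hp : forall k, 0 <= r ^ k) by (intros; now apply pow_le).
  assert (G : forall c, Cmod c = 1 -> Rabs (Re (c * (a n * RtoC (r ^ n))))%C <= M).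
  { intros c Hc. apply (Re_coefficient_le (fun k => (c * (a k * RtoC (r ^ k)))%C)).
    - eapply ex_series_ext; [|exact Ha]. intros k. rewrite !Cmod_mult, Hc, Cmod_R, Rabs_pos_eq by apply Hp.
      symmetry. apply Rmult_1_l.
    - intros th. specialize (HM (RtoC r * cis th)%C (Cmod_circle r th Hr)).
      assert (HC : Cser (fun k => (a k * (RtoC r * cis th) ^ k)%C) (Csum (fun k => (a k * (RtoC r * cis th) ^ k)%C))).
      { apply Csum_correct with (fun k => Cmod (a k) * r ^ k); [|exact Ha]. intros k.
        rewrite Cmod_mult, Cmod_pow, Cmod_circle by assumption. lra. }
      apply (Cser_scal c) in HC.
      assert (E : Csum (fun k => (c * (a k * RtoC (r ^ k)) * cis (INR k * th))%C) =
        (c * Csum (fun k => (a k * (RtoC r * cis th) ^ k)%C))%C).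
      { apply Cser_unique. eapply Cser_ext; [|exact HC]. intros k. cbv beta. rewrite circle_pow. ring. }
      rewrite E, Cmod_mult, Hc. lra. }
  pose proof (G 1%C Cmod_1) as G1. 
  assert (HCi : Cmod (- Ci)%C = 1) by (rewrite Cmod_opp; apply Cmod_Ci).
  pose proof (G (- Ci)%C HCi) as G2.
  replace (Cmod (a n) * r ^ n) with (Cmod (a n * RtoC (r ^ n))%C).
  2:{ rewrite Cmod_mult, Cmod_R, Rabs_pos_eq by apply Hp. reflexivity. }
  set (z := (a n * RtoC (r ^ n))%C) in *. eapply Rle_trans; [apply Cmod_le_sum|].
  rewrite Cmult_1_l in G1.
  replace (Re (- Ci * z)%C) with (Im z) in G2 by (destruct z; simpl; ring). lra.
Qed.

(** * Sums of power series and the identity principle *)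

Definition pser (f : C -> C) (s0 : C) (a : nat -> C) (r : R) : Prop :=
  forall w, Cmod w < r -> Cser (fun k => (a k * w ^ k)%C) (f (s0 + w)%C).

Lemma pser_ex_series f s0 a r x : pser f s0 a r -> 0 <= x < r ->
  exists M, 0 <= M /\ ex_series (fun k => Cmod (a k) * x ^ k) /\
  exists rho, x < rho < r /\ forall k, Cmod (a k) * rho ^ k <= M.
Proof.
  intros Hf Hx. set (rho := (x + r) / 2). assert (Hrho : x < rho < r) by (unfold rho; lra).
  assert (E : Cmod (RtoC rho) = rho) by (rewrite Cmod_R, Rabs_pos_eq; lra).
  pose proof (Hf (RtoC rho) ltac:(lra)) as H.
  destruct (Cser_terms_bounded _ _ H) as [M [HM0 HM]].
  assert (HM' : forall k, Cmod (a k) * rho ^ k <= M).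
  { intros k. specialize (HM k). rewrite Cmod_mult, Cmod_pow, E in HM. exact HM. }
  exists M. repeat split; [exact HM0| |exists rho; split; [exact Hrho|exact HM']].
  apply (ex_series_dominated (fun k => M * (x / rho) ^ k)).
  - intros k. rewrite Rabs_pos_eq by (apply Rmult_le_pos; [apply Cmod_ge_0|apply pow_le; lra]).
    replace (x ^ k) with (rho ^ k * (x / rho) ^ k).
    + rewrite <- Rmult_assoc. apply Rmult_le_compat_r; [|apply HM'].
      apply pow_le. apply Rmult_le_pos; [lra|left; apply Rinv_0_lt_compat; lra].
    + rewrite <- Rpow_mult_distr. f_equal. field. lra.
  - apply ex_series_Rscal. apply ex_series_geom.
    rewrite Rabs_pos_eq by (apply Rmult_le_pos; [lra|left; apply Rinv_0_lt_compat; lra]).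
    apply Rmult_lt_reg_r with rho; [lra|]. unfold Rdiv. rewrite Rmult_assoc, Rinv_l by lra. lra.
Qed.

(** Weierstrass's theorem.  Cauchy's estimate turns bounds on the functions into
    bounds on the coefficients, so that the double series may be rearranged. *)
Lemma pser_Csum (f : nat -> C -> C) s0 (a : nat -> nat -> C) (M : nat -> R) r r' :
  0 < r < r' -> (forall n, pser (f n) s0 (a n) r') ->
  (forall n w, Cmod w = r -> Cmod (f n (s0 + w)%C) <= M n) -> ex_series M ->
  (forall k, ex_series (fun n => Cmod (a n k))) /\
  pser (fun s => Csum (fun n => f n s)) s0 (fun k => Csum (fun n => a n k)) r.
Proof.
  intros Hr Hf HM HMs.
  assert (Hc : forall n k, Cmod (a n k) * r ^ k <= 2 * M n).
  { intros n k. destruct (pser_ex_series _ _ _ _ r (Hf n) ltac:(lra)) as [_ [_ [Hex _]]].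
    apply cauchy_estimate; [lra|exact Hex|]. intros w Hw.
    rewrite (Cser_unique _ _ (Hf n w ltac:(lra))). now apply HM. }
  assert (M0 : forall n, 0 <= M n).
  { intros n. pose proof (Hc n O). pose proof (Cmod_ge_0 (a n O)). simpl in *. lra. }
  assert (Hp : forall k, 0 < r ^ k) by (intros; apply pow_lt; lra).
  assert (Hc' : forall n k, Cmod (a n k) <= 2 / r ^ k * M n).
  { intros n k. specialize (Hc n k). specialize (Hp k).
    replace (2 / r ^ k * M n) with (2 * M n / r ^ k) by (field; lra). now apply le_div_of_mul_le. }
  assert (Hcs : forall k, ex_series (fun n => 2 / r ^ k * M n))
    by (intros k; apply ex_series_Rscal, HMs).
  split.
  { intros k. apply (ex_series_dominated (fun n => 2 / r ^ k * M n)); [|apply Hcs].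
    intros n. rewrite Rabs_pos_eq by apply Cmod_ge_0. apply Hc'. }
  intros w Hw. pose proof (Cmod_ge_0 w) as Hw0.
  set (x := Cmod w / r).
  assert (Hx : 0 <= x < 1).
  { split; [apply Rmult_le_pos; [lra|left; apply Rinv_0_lt_compat; lra]|].
    apply Rmult_lt_reg_r with r; [lra|]. unfold x, Rdiv. rewrite Rmult_assoc, Rinv_l by lra. lra. }
  assert (Ht : forall n k, Cmod (a n k * w ^ k)%C <= 2 * M n * x ^ k).
  { intros n k. rewrite Cmod_mult, Cmod_pow. unfold x.
    replace (Cmod w ^ k) with (r ^ k * (Cmod w / r) ^ k).
    - rewrite <- Rmult_assoc. apply Rmult_le_compat_r; [apply pow_le; apply Hx|apply Hc].
    - rewrite <- Rpow_mult_distr. f_equal. field. lra. }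
  (* a finite sum over [k] commutes with the sum over [n] *)
  assert (Hpart : forall K, Cser (fun n => Cpsum (fun k => (a n k * w ^ k)%C) K)
     (Cpsum (fun k => (Csum (fun n => a n k) * w ^ k)%C) K)).
  { assert (T : forall k, Cser (fun n => (a n k * w ^ k)%C) (Csum (fun n => a n k) * w ^ k)%C).
    { intros k. rewrite Cmult_comm. apply Cser_ext with (fun n => (w ^ k * a n k)%C); [intros; ring|].
      apply Cser_scal. apply Csum_correct with (fun n => 2 / r ^ k * M n); [|apply Hcs]. intros n. apply Hc'. }
    induction K as [|K IH]; [apply T|]. simpl Cpsum. apply Cser_plus; [exact IH|apply T]. }
  assert (Htail : forall K n, Cmod (f n (s0 + w)%C - Cpsum (fun k => (a n k * w ^ k)%C) K)%C
     <= 2 * x ^ S K / (1 - x) * M n).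
  { intros K n. eapply Rle_trans; [apply (geometric_tail _ _ (2 * M n) x K); [apply Hf; lra|exact Hx|apply Ht]|].
    right. field. lra. }
  assert (Hf0 : Cser (fun n => f n (s0 + w)%C) (Csum (fun n => f n (s0 + w)%C))).
  { apply Csum_correct with (fun n => 2 / (1 - x) * M n).
    - intros n.
      apply (Cser_Cmod_le (fun k => (a n k * w ^ k)%C) (fun k => 2 * M n * x ^ k)); [apply Hf; lra|apply Ht|].
      replace (2 / (1 - x) * M n) with (2 * M n * / (1 - x)) by (field; lra).
      apply (is_series_scal (V := R_NormedModule) (2 * M n)). apply is_series_geom. rewrite Rabs_pos_eq; lra.
    - apply ex_series_Rscal, HMs. }
  apply Cser_of_limit with (fun K => x ^ S K * (2 / (1 - x) * Series M)).
  - intros K.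
    replace (x ^ S K * (2 / (1 - x) * Series M)) with (2 * x ^ S K / (1 - x) * Series M) by (field; lra).
    rewrite <- Cmod_opp.
    replace (- (Cpsum (fun k => (Csum (fun n => a n k) * w ^ k)%C) K - Csum (fun n => f n (s0 + w))))%C
      with (Csum (fun n => f n (s0 + w)%C) - Cpsum (fun k => (Csum (fun n => a n k) * w ^ k)%C) K)%C by ring.
    apply (Cser_Cmod_le (fun n => (f n (s0 + w)%C - Cpsum (fun k => (a n k * w ^ k)%C) K)%C)
      (fun n => 2 * x ^ S K / (1 - x) * M n)).
    + apply Cser_minus; [exact Hf0|apply Hpart].
    + intros n. apply Htail.
    + apply (is_series_scal (V := R_NormedModule)). now apply Series_correct.
  - replace 0 with (0 * (2 / (1 - x) * Series M)) by ring.
    apply (is_lim_seq_scal_r _ (2 / (1 - x) * Series M) 0).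
    apply (is_lim_seq_incr_1 (fun n => x ^ n)). apply is_lim_seq_geom. rewrite Rabs_pos_eq; lra.
Qed.

(** If [a_k] is the first non-zero coefficient, then [h (s0 + w)] is
    [a_k w^k (1 + O(w))], which does not vanish near [0]. *)
Lemma pser_zero_coefs h s0 a r : 0 < r -> pser h s0 a r ->
  (forall d, 0 < d -> exists w, 0 < Cmod w < d /\ h (s0 + w)%C = 0%C) -> forall k, a k = 0%C.
Proof.
  intros Hr Hh Hz.
  destruct (pser_ex_series _ _ _ _ 0 Hh ltac:(lra)) as [M [HM0 [_ [rho [Hrho HM]]]]].
  intros k. induction k as [k IH] using (well_founded_induction Wf_nat.lt_wf).
  apply Cmod_eq_0. apply Rle_antisym; [|apply Cmod_ge_0].
  apply le_epsilon. intros eps He. rewrite Rplus_0_l.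
  assert (Hp : 0 < rho ^ S k) by (apply pow_lt; lra).
  set (d := Rmin (rho / 2) (eps * rho ^ S k / (2 * M + 1))).
  assert (Hd : 0 < d).
  { apply Rmin_glb_lt; [lra|]. apply Rdiv_lt_0_compat; [apply Rmult_lt_0_compat; lra|lra]. }
  destruct (Hz d Hd) as [w [Hw Hw0]].
  assert (d <= rho / 2) by apply Rmin_l.
  assert (Hd2 : d * (2 * M + 1) <= eps * rho ^ S k).
  { apply Rle_trans with (eps * rho ^ S k / (2 * M + 1) * (2 * M + 1)).
    - apply Rmult_le_compat_r; [lra|apply Rmin_r].
    - right. field. lra. }
  pose proof (Hh w ltac:(lra)) as Hs. rewrite Hw0 in Hs.
  set (x := Cmod w / rho).
  assert (Hx : 0 < x <= / 2).
  { split; [apply Rdiv_lt_0_compat; lra|]. apply div_le_of_le_mul; lra. }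
  assert (Ht : forall j, Cmod (a j * w ^ j)%C <= M * x ^ j).
  { intros j. rewrite Cmod_mult, Cmod_pow. unfold x.
    replace (Cmod w ^ j) with (rho ^ j * (Cmod w / rho) ^ j).
    - rewrite <- Rmult_assoc. apply Rmult_le_compat_r; [apply pow_le; fold x; lra|apply HM].
    - rewrite <- Rpow_mult_distr. f_equal. field. lra. }
  pose proof (geometric_tail _ _ M x k Hs ltac:(lra) Ht) as T.
  assert (Z : forall j, (j < k)%nat -> Cpsum (fun i => (a i * w ^ i)%C) j = 0%C).
  { induction j as [|j IHj]; intros hj; simpl Cpsum.
    - rewrite IH by lia. ring.
    - rewrite IHj, IH by lia. ring. }
  assert (E : Cpsum (fun i => (a i * w ^ i)%C) k = (a k * w ^ k)%C).
  { destruct k as [|k]; [reflexivity|]. simpl Cpsum. rewrite Z by lia. apply Cplus_0_l. }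
  rewrite E in T. replace (0 - a k * w ^ k)%C with (- (a k * w ^ k))%C in T by ring.
  rewrite Cmod_opp, Cmod_mult, Cmod_pow in T.
  assert (Hwk : 0 < Cmod w ^ k) by (apply pow_lt; lra).
  apply Rmult_le_reg_r with (Cmod w ^ k); [exact Hwk|].
  eapply Rle_trans; [exact T|].
  apply div_le_of_le_mul; [lra|].
  assert (E2 : x ^ S k * rho ^ S k = Cmod w ^ S k).
  { rewrite <- Rpow_mult_distr. f_equal. unfold x. field. lra. }
  apply Rmult_le_reg_r with (rho ^ S k); [exact Hp|].
  rewrite Rmult_assoc, E2. simpl pow.
  apply Rle_trans with (M * d * Cmod w ^ k).
  { rewrite Rmult_assoc. apply Rmult_le_compat_l; [exact HM0|]. apply Rmult_le_compat_r; lra. }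
  apply Rle_trans with (eps * rho ^ S k / 2 * Cmod w ^ k).
  { apply Rmult_le_compat_r; [lra|]. lra. }
  replace (eps * rho ^ S k / 2 * Cmod w ^ k) with (eps * rho ^ S k * Cmod w ^ k * / 2) by field.
  replace (eps * Cmod w ^ k * (1 - x) * (rho * rho ^ k)) with (eps * rho ^ S k * Cmod w ^ k * (1 - x)) by (simpl; ring).
  apply Rmult_le_compat_l; [|lra]. apply Rmult_le_pos; [apply Rmult_le_pos|]; lra.
Qed.

Lemma analytic_at_pser f s0 : analytic_at f s0 <-> exists a r, 0 < r /\ pser f s0 a r.
Proof.
  split; intros [a [r [Hr H]]]; exists a, r; split; try exact Hr.
  - intros w Hw. specialize (H (s0 + w)%C).
    replace (s0 + w - s0)%C with w in H by ring. apply is_pseries_Cser. now apply H.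
  - intros s Hs. apply is_pseries_Cser. specialize (H (s - s0)%C Hs).
    replace (s0 + (s - s0))%C with s in H by ring. exact H.
Qed.

(** A path from [2] to [-1] around the pole at [1]; as the graph of a function
    of the real part, it is injective and easy to parametrize. *)
Definition detour (x : R) : C := (x, (x + 1) * (2 - x)).

Lemma detour_dist x y : -1 <= x <= 2 -> -1 <= y <= 2 ->
  Rabs (x - y) <= Cmod (detour x - detour y)%C <= 4 * Rabs (x - y).
Proof.
  intros Hx Hy. split; [apply (re_le_Cmod (detour x - detour y)%C)|].
  eapply Rle_trans; [apply Cmod_le_sum|]. simpl.
  replace ((x + 1) * (2 - x) + - ((y + 1) * (2 - y))) with ((x - y) * (1 - x - y)) by ring.
  rewrite Rabs_mult. assert (Rabs (1 - x - y) <= 3) by (apply Rabs_le; lra).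
  pose proof (Rabs_pos (x - y)). change (x + - y) with (x - y). nra.
Qed.

(** Where the zeros stop, they accumulate; the coefficients of the local
    expansion vanish there, and the zeros go on. *)
Lemma analytic_continuation_along_detour h :
  (forall x, -1 <= x <= 2 -> analytic_at h (detour x)) ->
  (forall x, 1 < x <= 2 -> h (detour x) = 0%C) ->
  forall x, -1 < x <= 2 -> h (detour x) = 0%C.
Proof.
  intros Ha H0.
  set (E := fun y => 0 <= y <= 3 /\ forall z, 0 <= z <= y -> h (detour (2 - z)) = 0%C).
  destruct (completeness E) as [m [Hm1 Hm2]].
  - exists 3. intros y [Hy _]. lra.
  - exists 0. split; [lra|]. intros z Hz. apply H0. lra.
  - assert (Em : / 2 <= m).
    { apply Hm1. split; [lra|]. intros z Hz. apply H0. lra. }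
    assert (Em3 : m <= 3) by (apply Hm2; intros y [Hy _]; lra).
    assert (Hlt : forall z, 0 <= z < m -> h (detour (2 - z)) = 0%C).
    { intros z Hz. destruct (Classical_Prop.classic (h (detour (2 - z)) = 0%C)) as [G|G]; [exact G|].
      exfalso. assert (B : m <= z).
      { apply Hm2. intros y [Hy1 Hy2]. destruct (Rle_lt_dec y z) as [h'|h']; [exact h'|].
        exfalso. apply G, Hy2. lra. }
      lra. }
    assert (M3 : m = 3).
    { destruct (Rle_lt_dec 3 m) as [G|G]; [lra|]. exfalso.
      destruct (proj1 (analytic_at_pser h (detour (2 - m))) (Ha (2 - m) ltac:(lra))) as [a [r [Hr Hps]]].
      assert (Hz : forall k, a k = 0%C).
      { apply (pser_zero_coefs h (detour (2 - m)) a r Hr Hps). intros d Hd.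
        set (e := Rmin (/ 4) (d / 8)). assert (0 < e) by (apply Rmin_glb_lt; lra).
        assert (e <= / 4) by apply Rmin_l. assert (e <= d / 8) by apply Rmin_r.
        exists (detour (2 - (m - e)) - detour (2 - m))%C.
        pose proof (detour_dist (2 - (m - e)) (2 - m) ltac:(lra) ltac:(lra)) as D.
        replace (2 - (m - e) - (2 - m)) with e in D by ring. rewrite (Rabs_pos_eq e) in D by lra.
        split; [lra|].
        replace (detour (2 - m) + (detour (2 - (m - e)) - detour (2 - m)))%C with (detour (2 - (m - e))) by ring.
        apply Hlt. lra. }
      set (e := Rmin (3 - m) (r / 8)). assert (0 < e) by (apply Rmin_glb_lt; lra).
      assert (e <= 3 - m) by apply Rmin_l. assert (e <= r / 8) by apply Rmin_r.
      assert (B : m + e <= m); [|lra]. apply Hm1. split; [lra|]. intros z Hz'.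
      destruct (Rlt_le_dec z m) as [h1|h1]; [apply Hlt; lra|].
      pose proof (detour_dist (2 - z) (2 - m) ltac:(lra) ltac:(lra)) as D.
      assert (Rabs (2 - z - (2 - m)) <= e) by (apply Rabs_le; lra).
      pose proof (Hps (detour (2 - z) - detour (2 - m))%C ltac:(lra)) as S.
      replace (detour (2 - m) + (detour (2 - z) - detour (2 - m)))%C with (detour (2 - z)) in S by ring.
      rewrite <- (Cser_unique _ _ S).
      apply Cser_unique, Cser_zero. intros k. rewrite Hz. ring. }
    intros x Hx. replace x with (2 - (2 - x)) by ring. apply Hlt. lra.
Qed.

(** * Operations on local expansions *)

Lemma pser_plus f g s0 a b r : pser f s0 a r -> pser g s0 b r ->
  pser (fun s => (f s + g s)%C) s0 (fun k => (a k + b k)%C) r.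
Proof.
  intros Hf Hg w Hw.
  apply Cser_ext with (fun k => (a k * w ^ k + b k * w ^ k)%C); [intros; ring|].
  apply Cser_plus; [now apply Hf|now apply Hg].
Qed.

Lemma pser_scal c f s0 a r : pser f s0 a r -> pser (fun s => (c * f s)%C) s0 (fun k => (c * a k)%C) r.
Proof.
  intros Hf w Hw. apply Cser_ext with (fun k => (c * (a k * w ^ k))%C); [intros; ring|].
  now apply Cser_scal, Hf.
Qed.

Lemma pser_weaken f s0 a r r' : r' <= r -> pser f s0 a r -> pser f s0 a r'.
Proof. intros H Hf w Hw. apply Hf. lra. Qed.

(** The coefficients of the product with [d + w]. *)
Definition mul_linear (d : C) (a : nat -> C) (k : nat) : C :=
  (d * a k + match k with O => 0 | S j => a j end)%C.

Lemma Cser_incr (a : nat -> C) w l : Cser (fun k => (a k * w ^ k)%C) l ->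
  Cser (fun k => (match k with O => 0 | S j => a j end * w ^ k)%C) (w * l)%C.
Proof.
  intros H. apply (Cser_scal w) in H. destruct H as [H1 H2].
  assert (E : forall k, (w * (a k * w ^ k))%C = (a k * w ^ S k)%C) by (intros; rewrite Cpow_S; ring).
  split.
  - apply (is_series_decr_1 (V := R_NormedModule)).
    replace (plus (Re (w * l)%C) _) with (Re (w * l)%C).
    + eapply is_series_ext; [|exact H1]. intros k. cbv beta. now rewrite E.
    + change (@eq R (Re (w * l)%C) (Re (w * l)%C + - (0 * 1 - 0 * 0))). ring.
  - apply (is_series_decr_1 (V := R_NormedModule)).
    replace (plus (Im (w * l)%C) _) with (Im (w * l)%C).
    + eapply is_series_ext; [|exact H2]. intros k. cbv beta. now rewrite E.
    + change (@eq R (Im (w * l)%C) (Im (w * l)%C + - (0 * 0 + 0 * 1))). ring.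
Qed.

Lemma pser_mul_linear c f s0 a r : pser f s0 a r ->
  pser (fun s => ((s - c) * f s)%C) s0 (mul_linear (s0 - c)%C a) r.
Proof.
  intros Hf w Hw. specialize (Hf w Hw).
  replace ((s0 + w - c) * f (s0 + w))%C with ((s0 - c) * f (s0 + w) + w * f (s0 + w))%C by ring.
  apply Cser_ext with (fun k => ((s0 - c) * (a k * w ^ k) + match k with O => 0 | S j => a j end * w ^ k)%C).
  { intros k. unfold mul_linear. ring. }
  apply Cser_plus; [now apply Cser_scal|now apply Cser_incr].
Qed.

Definition const_coef (c : C) (k : nat) : C := match k with O => c | _ => 0%C end.

Lemma pser_const c s0 r : pser (fun _ => c) s0 (const_coef c) r.
Proof.
  intros w Hw. apply Cser_of_limit with (fun _ => 0); [|apply is_lim_seq_const].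
  intros n. replace (Cpsum (fun k => (const_coef c k * w ^ k)%C) n) with c.
  - unfold Cminus. rewrite Cplus_opp_r, Cmod_0. lra.
  - induction n as [|n IH]; simpl Cpsum; [simpl; ring|]. rewrite <- IH. simpl. ring.
Qed.

(** * Complex powers of positive reals *)

Definition rpow (x : R) (s : C) : C := Cexp (s * RtoC (ln x))%C.

Lemma Cmod_rpow x s : Cmod (rpow x s) = Rpower x (Re s).
Proof. unfold rpow, Rpower. rewrite Cmod_Cexp. f_equal. destruct s; simpl. ring. Qed.

Lemma rpow_plus x s t : rpow x (s + t)%C = (rpow x s * rpow x t)%C.
Proof. unfold rpow. rewrite <- Cexp_plus. f_equal. ring. Qed.

Lemma rpow_R x y : rpow x (RtoC y) = RtoC (Rpower x y).
Proof.
  unfold rpow, Rpower. rewrite <- Cexp_R. f_equal. unfold RtoC, Cmult; simpl. f_equal; ring.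
Qed.

Lemma rpow_1 x : 0 < x -> rpow x 1%C = RtoC x.
Proof. intros Hx. rewrite rpow_R, Rpower_1; auto. Qed.

Lemma rpow_plus_1 x s : 0 < x -> rpow x (1 + s)%C = (RtoC x * rpow x s)%C.
Proof. intros Hx. now rewrite rpow_plus, rpow_1. Qed.

Lemma rpow_minus_1 x s : 0 < x -> rpow x (s - 1)%C = (RtoC (/ x) * rpow x s)%C.
Proof.
  intros Hx. replace s with (1 + (s - 1))%C at 2 by ring.
  rewrite rpow_plus_1, Cmult_assoc, <- RtoC_mult, Rinv_l by lra. ring.
Qed.

Lemma rpow_base_1 s : rpow 1 s = 1%C.
Proof. unfold rpow. rewrite ln_1. replace (s * RtoC 0)%C with (RtoC 0) by ring. apply Cexp_0. Qed.

(** With the factor [c], this also covers imaginary parts: [c = - i]. *)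
Lemma is_derive_Re_rpow c s x : 0 < x ->
  is_derive (fun x => Re (c * rpow x s)%C) x (Re (c * s * rpow x (s - 1))%C).
Proof.
  intros Hx. rewrite rpow_minus_1 by exact Hx. destruct c as [p q], s as [a b].
  unfold rpow, Cexp, Cmult, RtoC. simpl.
  auto_derive; [repeat split; exact Hx|].
  replace (a * ln x - b * 0) with (a * ln x) by ring.
  replace (a * ln x + - (b * 0)) with (a * ln x) by ring.
  replace (a * 0 + b * ln x) with (b * ln x) by ring. field. lra.
Qed.

Lemma Cser_X1 u : Cser (fun n => (RtoC (PS_X 1 n) * u ^ n)%C) u.
Proof.
  apply Cser_of_limit with (fun n => match n with O => Cmod u | _ => 0 end).
  - intros n. destruct n as [|n].
    + simpl. unfold PS_X. simpl. replace (0 * 1 - u)%C with (- u)%C by ring. rewrite Cmod_opp. lra.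
    + replace (Cpsum (fun n => (RtoC (PS_X 1 n) * u ^ n)%C) (S n)) with u.
      * unfold Cminus. rewrite Cplus_opp_r, Cmod_0. lra.
      * induction n as [|n IH]; [simpl; unfold PS_X; simpl; ring|].
        change (u = Cpsum (fun n => (RtoC (PS_X 1 n) * u ^ n)%C) (S n) + RtoC (PS_X 1 (S (S n))) * u ^ S (S n))%C.
        rewrite <- IH. unfold PS_X. simpl Nat.eqb. cbv iota. ring.
  - apply is_lim_seq_incr_1. apply is_lim_seq_const.
Qed.

(** The case [c_k = 1] for [k = 1] and [0] otherwise of [exp_pseries]. *)
Lemma Cexp_series u : Cser (fun k => (RtoC (/ INR (fact k)) * u ^ k)%C) (Cexp u).
Proof.
  assert (Hlt : forall a : nat -> R, (forall r : R, Rbar_le r (CV_radius a)) -> Rbar_lt (Cmod u) (CV_radius a)).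
  { intros a Ha. eapply Rbar_lt_le_trans; [|apply (Ha (Cmod u + 1))]. simpl. lra. }
  rewrite <- (Cser_unique _ _ (Cser_X1 u)) at 1.
  apply exp_pseries.
  - reflexivity.
  - simpl. apply Rinv_1.
  - intros n.
    assert (D : PS_derive (PS_X 1) = PS_one).
    { extensionality k. unfold PS_derive, PS_X, PS_one. destruct k as [|k]; simpl; ring. }
    rewrite D, PS_mult_1_l. unfold PS_derive. rewrite fact_simpl, mult_INR. field.
    split; [apply INR_fact_neq_0|apply not_0_INR; lia].
  - rewrite CV_radius_infinite_DAlembert; [exact I| |].
    + intros n. apply Rinv_neq_0_compat, INR_fact_neq_0.
    + apply is_lim_seq_incr_1. apply is_lim_seq_0_of_le with 1. intros n Hn.
      assert (0 < INR n) by (apply lt_0_INR; lia).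
      assert (P : forall j, INR (fact j) <> 0) by (intros; apply INR_fact_neq_0).
      replace (/ INR (fact (S (S n))) / / INR (fact (S n))) with (/ INR (S (S n))).
      2:{ rewrite (fact_simpl (S n)), mult_INR. field. split; [apply P|apply not_0_INR; lia]. }
      rewrite Rabs_Rabsolu, Rabs_pos_eq by (left; apply Rinv_0_lt_compat, INR_S_pos).
      unfold Rdiv. rewrite Rmult_1_l. apply Rinv_le_contravar; [assumption|]. apply le_INR. lia.
  - apply Hlt. intros r. apply CV_radius_ge_of_bounded with (Rabs r).
    intros n. unfold PS_X. destruct (Nat.eqb_spec n 1) as [->|].
    + rewrite Rmult_1_l, pow_1. lra.
    + rewrite Rmult_0_l, Rabs_R0. apply Rabs_pos.
Qed.

Definition rpow_coef (v : R) (s0 : C) (k : nat) : C :=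
  (rpow v (- s0) * RtoC ((- ln v) ^ k / INR (fact k)))%C.

Lemma pser_rpow v s0 r : pser (fun s => rpow v (- s)%C) s0 (rpow_coef v s0) r.
Proof.
  intros w _. replace (- (s0 + w))%C with (- s0 + - w)%C by ring. rewrite rpow_plus.
  unfold rpow at 2.
  eapply Cser_ext; [|apply Cser_scal, Cexp_series].
  intros k. cbv beta. unfold rpow_coef, Rdiv.
  replace (- w * RtoC (ln v))%C with (RtoC (- ln v) * w)%C by (rewrite RtoC_opp; ring).
  rewrite Cpow_mult_l, <- RtoC_pow, RtoC_mult. ring.
Qed.

(** * The Riemann zeta function near [-1] *)

(** [zeta_piece (-1) v s] collects the terms of [zeta_rem v s] that contain
    [v^(-s)], and [zeta_piece 1 v s] those of [zeta_rem (v - 1) s]; all are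
    polynomials in [s] times [rpow v (- s)], so that their expansions are
    explicit. *)
Definition zeta_piece (e v : R) (s : C) : C :=
  (RtoC (/ 2) * ((s - 1) * rpow v (- s)) + RtoC (e * v) * rpow v (- s)
   + RtoC (e / (12 * v)) * ((s - 0) * ((s - 1) * rpow v (- s))))%C.

(** The Euler-Maclaurin remainder of [(s - 1) x^(-s)]; the factor [s - 1] keeps
    it analytic at [s = 1]. *)
Definition zeta_rem (v : R) (s : C) : C := (zeta_piece 1 (v + 1) s + zeta_piece (-1) v s)%C.

Lemma zeta_rem_EM c v s : 0 < v ->
  Re (c * zeta_rem v s)%C = EM (fun x => Re (- c * rpow x (1 - s))%C) (fun x => Re (c * (s - 1) * rpow x (- s))%C)
    (fun x => Re (c * (s - 1) * - s * rpow x (- s - 1))%C) v.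
Proof.
  intros Hv. unfold EM, zeta_rem, zeta_piece. replace (1 - s)%C with (1 + - s)%C by ring.
  rewrite !rpow_plus_1, !rpow_minus_1 by lra.
  destruct (rpow v (- s)) as [p q], (rpow (v + 1) (- s)) as [p' q'], c as [a b], s as [x y].
  simpl. field. lra.
Qed.

(** Real and imaginary parts are Euler-Maclaurin remainders of real functions,
    with third derivative of order [v^(- Re s - 3)]. *)
Lemma zeta_rem_bound v s : 0 < v -> -3 <= Re s ->
  Cmod (zeta_rem v s) <= 2 * (Cmod ((s - 1) * s * (s + 1) * (s + 2))%C * Rpower v (- (Re s + 3))).
Proof.
  intros Hv Hs. set (B := Cmod ((s - 1) * s * (s + 1) * (s + 2))%C).
  assert (B0 : 0 <= B) by apply Cmod_ge_0.
  assert (G : forall c, Cmod c = 1 -> Rabs (Re (c * zeta_rem v s)%C) <= B * Rpower v (- (Re s + 3))).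
  { intros c Hc. rewrite zeta_rem_EM by exact Hv.
    apply EM_bound with (f2 := fun x => Re (c * (s - 1) * - s * (- s - 1) * rpow x (- s - 1 - 1))%C)
      (f3 := fun x => Re (c * (s - 1) * - s * (- s - 1) * (- s - 1 - 1) * rpow x (- s - 1 - 1 - 1))%C);
    intros y Hy; [|apply is_derive_Re_rpow; lra|apply is_derive_Re_rpow; lra|apply is_derive_Re_rpow; lra|].
    - replace (c * (s - 1) * rpow y (- s))%C with (- c * (1 - s) * rpow y (1 - s - 1))%C.
      2:{ replace (1 - s - 1)%C with (- s)%C by ring. ring. }
      apply is_derive_Re_rpow. lra.
    - eapply Rle_trans; [apply re_le_Cmod|]. rewrite Cmod_mult, Cmod_rpow.
      replace (c * (s - 1) * - s * (- s - 1) * (- s - 1 - 1))%C with (- (c * ((s - 1) * s * (s + 1) * (s + 2))))%C by ring.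
      rewrite Cmod_opp, Cmod_mult, Hc, Rmult_1_l. fold B. apply Rmult_le_compat_l; [exact B0|].
      replace (Re (- s - 1 - 1 - 1)%C) with (- (Re s + 3)) by (destruct s; simpl; ring).
      apply Rpower_neg_decr; lra. }
  assert (HCi : Cmod (- Ci)%C = 1) by (rewrite Cmod_opp; apply Cmod_Ci).
  pose proof (G 1%C Cmod_1) as G1. pose proof (G (- Ci)%C HCi) as G2.
  rewrite Cmult_1_l in G1.
  replace (Re (- Ci * zeta_rem v s)%C) with (Im (zeta_rem v s)) in G2 by (destruct (zeta_rem v s); simpl; ring).
  eapply Rle_trans; [apply Cmod_le_sum|]. lra.
Qed.

Definition zeta_piece_coef (e v : R) (s0 : C) (k : nat) : C :=
  (RtoC (/ 2) * mul_linear (s0 - 1) (rpow_coef v s0) k + RtoC (e * v) * rpow_coef v s0 k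
   + RtoC (e / (12 * v)) * mul_linear (s0 - 0) (mul_linear (s0 - 1) (rpow_coef v s0)) k)%C.

Lemma pser_zeta_piece e v s0 r : pser (zeta_piece e v) s0 (zeta_piece_coef e v s0) r.
Proof.
  apply (pser_plus (fun s => (RtoC (/ 2) * ((s - 1) * rpow v (- s)) + RtoC (e * v) * rpow v (- s))%C)
    (fun s => (RtoC (e / (12 * v)) * ((s - 0) * ((s - 1) * rpow v (- s))))%C)).
  - apply (pser_plus (fun s => (RtoC (/ 2) * ((s - 1) * rpow v (- s)))%C) (fun s => (RtoC (e * v) * rpow v (- s))%C)).
    + apply pser_scal, (pser_mul_linear 1 (fun s => rpow v (- s)%C)), pser_rpow.
    + apply pser_scal, pser_rpow.
  - apply pser_scal, (pser_mul_linear 0 (fun s => ((s - 1) * rpow v (- s))%C)),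
      (pser_mul_linear 1 (fun s => rpow v (- s)%C)), pser_rpow.
Qed.

Definition zeta_rem_coef (v : R) (s0 : C) (k : nat) : C :=
  (zeta_piece_coef 1 (v + 1) s0 k + zeta_piece_coef (-1) v s0 k)%C.

Lemma pser_zeta_rem v s0 r : pser (zeta_rem v) s0 (zeta_rem_coef v s0) r.
Proof. apply pser_plus; apply pser_zeta_piece. Qed.

Lemma zeta_rem_ball_bound s0 r v w : 1 <= v -> 0 <= r -> -2 <= Re s0 - r -> Cmod w = r ->
  Cmod (zeta_rem v (s0 + w)%C) <= 2 * ((Cmod s0 + r + 2) ^ 4 * Rpower v (- (Re s0 - r + 3))).
Proof.
  intros Hv Hr Hs Hw.
  assert (W : - r <= Re w <= r) by (apply Rabs_le_inv; rewrite <- Hw; apply re_le_Cmod).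
  assert (ER : Re (s0 + w)%C = Re s0 + Re w) by (destruct s0, w; reflexivity).
  eapply Rle_trans; [apply zeta_rem_bound; lra|]. rewrite ER.
  set (s := (s0 + w)%C). set (D := Cmod s0 + r + 2).
  pose proof (Cmod_ge_0 s0).
  assert (Ds : Cmod s <= D - 2) by (unfold s, D; pose proof (Cmod_triangle s0 w); lra).
  assert (T : forall y, Rabs y <= 2 -> Cmod (s + RtoC y)%C <= D).
  { intros y Hy. eapply Rle_trans; [apply Cmod_triangle|]. rewrite Cmod_R. lra. }
  apply Rmult_le_compat_l; [lra|]. apply Rmult_le_compat.
  - apply Cmod_ge_0.
  - left. apply exp_pos.
  - rewrite !Cmod_mult. unfold Cminus. rewrite <- RtoC_opp.
    pose proof (T (- (1)) ltac:(rewrite Rabs_left; lra)). pose proof (T 1 ltac:(rewrite Rabs_pos_eq; lra)).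
    pose proof (T 2 ltac:(rewrite Rabs_pos_eq; lra)).
    pose proof (Cmod_ge_0 s). pose proof (Cmod_ge_0 (s + RtoC (- (1)))%C).
    pose proof (Cmod_ge_0 (s + 1)%C). pose proof (Cmod_ge_0 (s + 2)%C).
    replace (D ^ 4) with (D * D * D * D) by ring.
    repeat apply Rmult_le_compat; try assumption; try lra; repeat apply Rmult_le_pos; assumption.
  - unfold Rpower. apply exp_le_compat. assert (0 <= ln v) by (rewrite <- ln_1; apply Rcomplements.ln_le; lra).
    nra.
Qed.

Definition zeta_rem_sum (s : C) : C := Csum (fun n => zeta_rem (INR (S n)) s).

Lemma INR_S_ge_1 n : 1 <= INR (S n).
Proof. rewrite S_INR. pose proof (pos_INR n). lra. Qed.

Lemma pser_zeta_rem_sum s0 : -2 < Re s0 -> exists r, 0 < r /\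
  (forall k, ex_series (fun n => Cmod (zeta_rem_coef (INR (S n)) s0 k))) /\
  pser zeta_rem_sum s0 (fun k => Csum (fun n => zeta_rem_coef (INR (S n)) s0 k)) r.
Proof.
  intros Hs. set (r := (Re s0 + 2) / 4). exists r. assert (Hr : 0 < r) by (unfold r; lra). split; [exact Hr|].
  apply (pser_Csum (fun n => zeta_rem (INR (S n))) s0 (fun n => zeta_rem_coef (INR (S n)) s0)
    (fun n => 2 * (Cmod s0 + r + 2) ^ 4 * Rpower (INR (S n)) (- (1 + 3 * r))) r (2 * r)).
  - lra.
  - intros n. apply pser_zeta_rem.
  - intros n w Hw. rewrite Rmult_assoc.
    replace (1 + 3 * r) with (Re s0 - r + 3) by (unfold r; field).
    apply zeta_rem_ball_bound; [apply INR_S_ge_1|lra|unfold r; lra|exact Hw].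
  - apply ex_series_Rscal. apply ex_series_Rpower. lra.
Qed.

Lemma Cser_zeta_rem s : -2 < Re s -> Cser (fun n => zeta_rem (INR (S n)) s) (zeta_rem_sum s).
Proof.
  intros Hs. apply Csum_correct with
    (fun n => 2 * Cmod ((s - 1) * s * (s + 1) * (s + 2))%C * Rpower (INR (S n)) (- (1 + (Re s + 2)))).
  - intros n. rewrite Rmult_assoc. replace (1 + (Re s + 2)) with (Re s + 3) by ring.
    apply zeta_rem_bound; [apply INR_S_pos|lra].
  - apply ex_series_Rscal. apply ex_series_Rpower. lra.
Qed.

(** The boundary terms at [x = 1] of the Euler-Maclaurin formula for
    [(s - 1) x^(-s)], that is, [1 + (s - 1) / 2 + s (s - 1) / 12]; the form is
    that of [mul_linear]. *)
Definition zeta_poly (s : C) : C :=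
  (1 + (RtoC (/ 2) * ((s - 1) * 1) + RtoC (/ 12) * ((s - 0) * ((s - 1) * 1))))%C.

Lemma is_lim_seq_Rpower_neg e : 0 < e -> is_lim_seq (fun n => Rpower (INR n) (- e)) 0.
Proof.
  intros He. unfold Rpower.
  apply (is_lim_comp_seq exp (fun n => - e * ln (INR n)) m_infty 0).
  - apply is_lim_exp_m.
  - exists O. intros n _. discriminate.
  - replace m_infty with (Rbar_mult (- e) p_infty).
    + apply (is_lim_seq_scal_l (fun n => ln (INR n)) (- e) p_infty). apply (is_lim_comp_seq ln INR p_infty p_infty).
      * apply is_lim_ln_p.
      * exists O. intros n _. discriminate.
      * apply is_lim_seq_INR.
    + apply is_Rbar_mult_unique, is_Rbar_mult_sym, is_Rbar_mult_p_infty_neg. simpl. lra.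
Qed.

Lemma is_lim_seq_rpow c s : Re s < 0 -> is_lim_seq (fun n => Re (c * rpow (INR n) s)%C) 0.
Proof.
  intros Hs. apply is_lim_seq_abs_0.
  apply is_lim_seq_le_le with (fun _ => 0) (fun n => Cmod c * Rpower (INR n) (- - Re s)).
  - intros n. split; [apply Rabs_pos|]. eapply Rle_trans; [apply re_le_Cmod|].
    rewrite Cmod_mult, Cmod_rpow, Ropp_involutive. lra.
  - apply is_lim_seq_const.
  - replace (Finite 0) with (Rbar_mult (Cmod c) 0) by (simpl; f_equal; ring).
    apply is_lim_seq_scal_l. apply is_lim_seq_Rpower_neg. lra.
Qed.

(** Both sides are compared through [Re (c * _)] with [c = 1] and [c = - i], to
    which real Euler-Maclaurin summation applies. *)
Lemma zeta_EM (zeta : C -> C) s : is_Riemann_zeta zeta -> 1 < Re s ->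
  ((s - 1) * zeta s = zeta_poly s + zeta_rem_sum s)%C.
Proof.
  intros [Hz _] Hs. specialize (Hz s Hs). apply is_series_Cser in Hz.
  assert (G : forall c, Re (c * ((s - 1) * zeta s))%C = Re (c * (zeta_poly s + zeta_rem_sum s))%C).
  { intros c.
    destruct (Cser_scal (c * (s - 1))%C _ _ Hz) as [H1 _].
    destruct (Cser_scal c _ _ (Cser_zeta_rem s ltac:(lra))) as [H2 _].
    assert (H3 : is_series (fun i => Re (c * (s - 1) * rpow (INR (S i)) (- s))%C)
       (Re (c * (s - 1) * rpow 1 (- s))%C / 2 + (0 - Re (- c * rpow 1 (1 - s))%C)
        - Re (c * (s - 1) * - s * rpow 1 (- s - 1))%C / 12 + Re (c * zeta_rem_sum s)%C)).
    { apply (EM_series (fun x => Re (- c * rpow x (1 - s))%C) (fun x => Re (c * (s - 1) * rpow x (- s))%C)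
        (fun x => Re (c * (s - 1) * - s * rpow x (- s - 1))%C)).
      - eapply is_series_ext; [|exact H2]. intros n. cbv beta. apply zeta_rem_EM, INR_S_pos.
      - apply is_lim_seq_rpow. destruct s; simpl in *; lra.
      - apply is_lim_seq_rpow. destruct s; simpl in *; lra.
      - apply is_lim_seq_rpow. destruct s; simpl in *; lra. }
    rewrite !rpow_base_1 in H3.
    apply is_series_unique in H1. apply is_series_unique in H3.
    replace (c * ((s - 1) * zeta s))%C with (c * (s - 1) * zeta s)%C by ring.
    rewrite <- H1. etransitivity; [exact H3|]. unfold zeta_poly.
    destruct c as [a b], s as [x y], (zeta_rem_sum (x, y)) as [p q]. simpl. field. }
  apply injective_projections.
  - specialize (G 1%C). rewrite !Cmult_1_l in G. exact G.
  - specialize (G (- Ci)%C). 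
    set (A := ((s - 1) * zeta s)%C) in *. set (B := (zeta_poly s + zeta_rem_sum s)%C) in *.
    clearbody A B. destruct A as [a1 a2], B as [b1 b2]. simpl in *. lra.
Qed.

Definition zeta_poly_coef (s0 : C) (k : nat) : C :=
  (const_coef 1 k + (RtoC (/ 2) * mul_linear (s0 - 1) (const_coef 1) k
   + RtoC (/ 12) * mul_linear (s0 - 0) (mul_linear (s0 - 1) (const_coef 1)) k))%C.

Lemma pser_zeta_poly s0 r : pser zeta_poly s0 (zeta_poly_coef s0) r.
Proof.
  apply (pser_plus (fun _ => 1%C) (fun s => (RtoC (/ 2) * ((s - 1) * 1) + RtoC (/ 12) * ((s - 0) * ((s - 1) * 1)))%C));
    [apply pser_const|].
  apply (pser_plus (fun s => (RtoC (/ 2) * ((s - 1) * 1))%C) (fun s => (RtoC (/ 12) * ((s - 0) * ((s - 1) * 1)))%C)).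
  - apply pser_scal, (pser_mul_linear 1 (fun _ => 1%C)), pser_const.
  - apply pser_scal, (pser_mul_linear 0 (fun s => ((s - 1) * 1)%C)), (pser_mul_linear 1 (fun _ => 1%C)), pser_const.
Qed.

Definition zeta_diff (zeta : C -> C) (s : C) : C :=
  ((s - 1) * zeta s + (- (1)) * (zeta_poly s + zeta_rem_sum s))%C.

Lemma pser_zeta_diff zeta s0 z r0 : -2 < Re s0 -> 0 < r0 -> pser zeta s0 z r0 ->
  exists r, 0 < r /\ pser (zeta_diff zeta) s0
    (fun k => (mul_linear (s0 - 1) z k +
      (- (1)) * (zeta_poly_coef s0 k + Csum (fun n => zeta_rem_coef (INR (S n)) s0 k)))%C) r.
Proof.
  intros Hs Hr0 Hz. destruct (pser_zeta_rem_sum s0 Hs) as [r1 [Hr1 [_ H1]]].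
  exists (Rmin r0 r1). split; [now apply Rmin_glb_lt|].
  apply (pser_plus (fun s => ((s - 1) * zeta s)%C) (fun s => ((- (1)) * (zeta_poly s + zeta_rem_sum s))%C)).
  - apply pser_mul_linear. apply pser_weaken with r0; [apply Rmin_l|exact Hz].
  - apply (pser_scal _ (fun s => (zeta_poly s + zeta_rem_sum s)%C)), pser_plus; [apply pser_zeta_poly|].
    apply pser_weaken with r1; [apply Rmin_r|exact H1].
Qed.

(** It vanishes for [Re s > 1] by [zeta_EM] and is analytic along the path. *)
Lemma zeta_diff_zero zeta : is_Riemann_zeta zeta -> forall x, -1 < x <= 2 -> zeta_diff zeta (detour x) = 0%C.
Proof.
  intros Hz. apply analytic_continuation_along_detour.
  - intros x Hx.
    assert (N : detour x <> RtoC 1).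
    { unfold detour, RtoC. intros E. injection E. intros E2 E1. subst x. lra. }
    destruct (proj1 (analytic_at_pser zeta (detour x)) (proj2 Hz _ N)) as [a [r [Hr Ha]]].
    destruct (pser_zeta_diff zeta (detour x) a r ltac:(simpl; lra) Hr Ha) as [r' [Hr' H']].
    apply analytic_at_pser. do 2 eexists. split; [exact Hr'|exact H'].
  - intros x Hx. unfold zeta_diff. rewrite (zeta_EM zeta) by (simpl; lra || assumption). ring.
Qed.

(** At [s = -1] the summand [(s - 1) x^(-s)] is linear in [x], and the
    Euler-Maclaurin formula is exact for linear functions. *)
Lemma zeta_rem_coef_0 v : 0 < v -> zeta_rem_coef v (RtoC (-1)) 0 = 0%C.
Proof.
  intros Hv. unfold zeta_rem_coef, zeta_piece_coef, mul_linear, rpow_coef.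
  replace (- RtoC (-1))%C with (RtoC 1) by (rewrite <- RtoC_opp; f_equal; ring).
  rewrite !rpow_1 by lra. simpl. unfold RtoC, Cplus, Cmult, Cminus, Copp; simpl. f_equal; field; lra.
Qed.

(** The derivative of [(s - 1) x^(-s)] at [s = -1] is [x + 2 x ln x], and [x] has
    remainder zero. *)
Lemma zeta_rem_coef_1 v : 0 < v -> zeta_rem_coef v (RtoC (-1)) 1 = RtoC (-2 * EM_xlnx v).
Proof.
  intros Hv. unfold zeta_rem_coef, zeta_piece_coef, mul_linear, rpow_coef.
  replace (- RtoC (-1))%C with (RtoC 1) by (rewrite <- RtoC_opp; f_equal; ring).
  rewrite !rpow_1 by lra. unfold EM_xlnx, EM. simpl.
  unfold RtoC, Cplus, Cmult, Cminus, Copp; simpl. f_equal; field; lra.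
Qed.

(** Comparing coefficients of order [0] and [1] in
    [(s - 1) zeta(s) = zeta_poly s + zeta_rem_sum s] at [-1] yields
    [zeta(-1) = -1/12] and the derivative. *)
Lemma zeta_derive_m1 (zeta : C -> C) : is_Riemann_zeta zeta ->
  Re (C_derive zeta (RtoC (-1))) = - / 6 + em_const.
Proof.
  intros Hz.
  assert (N : RtoC (-1) <> RtoC 1) by (intros E; apply RtoC_inj in E; lra).
  destruct (proj1 (analytic_at_pser zeta (RtoC (-1))) (proj2 Hz _ N)) as [z [r [Hr Hp]]].
  assert (Hre : -2 < Re (RtoC (-1))) by (simpl; lra).
  destruct (pser_zeta_diff zeta (RtoC (-1)) z r Hre Hr Hp) as [r' [Hr' H']].
  assert (H0 := pser_zero_coefs _ _ _ _ Hr' H').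
  assert (Hzz : forall d, 0 < d -> exists w, 0 < Cmod w < d /\ zeta_diff zeta (RtoC (-1) + w)%C = 0%C).
  { intros d Hd. set (e := Rmin 1 (d / 8)). assert (0 < e) by (apply Rmin_glb_lt; lra).
    assert (e <= 1) by apply Rmin_l. assert (e <= d / 8) by apply Rmin_r.
    assert (D1 : detour (-1) = RtoC (-1)) by (unfold detour, RtoC; f_equal; ring).
    pose proof (detour_dist (-1 + e) (-1) ltac:(lra) ltac:(lra)) as D.
    replace (-1 + e - -1) with e in D by ring. rewrite (Rabs_pos_eq e) in D by lra. rewrite D1 in D.
    exists (detour (-1 + e) - RtoC (-1))%C. split; [lra|].
    replace (RtoC (-1) + (detour (-1 + e) - RtoC (-1)))%C with (detour (-1 + e)) by ring.
    apply zeta_diff_zero; [exact Hz|lra]. }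
  specialize (H0 Hzz).
  assert (C0 : Csum (fun n => zeta_rem_coef (INR (S n)) (RtoC (-1)) 0) = 0%C).
  { apply Cser_unique, Cser_zero. intros n. apply zeta_rem_coef_0, INR_S_pos. }
  assert (C1 : Csum (fun n => zeta_rem_coef (INR (S n)) (RtoC (-1)) 1) = RtoC (-2 * em_const)).
  { apply Cser_unique. apply Cser_ext with (fun n => RtoC (-2 * EM_xlnx (INR (S n)))).
    - intros n. symmetry. apply zeta_rem_coef_1, INR_S_pos.
    - split; simpl.
      + apply (is_series_scal (V := R_NormedModule) (-2)). apply Series_correct, ex_series_EM_xlnx.
      + exact (proj2 (Cser_zero (fun _ => 0%C) (fun _ => eq_refl))). }
  pose proof (H0 O) as K0. pose proof (H0 1%nat) as K1. cbv beta in K0, K1.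
  rewrite C0 in K0. rewrite C1 in K1.
  assert (Rz : Re (z 1%nat) = - / 6 + em_const).
  { apply (f_equal Re) in K0. apply (f_equal Re) in K1.
    unfold mul_linear, zeta_poly_coef, mul_linear, const_coef in K0, K1.
    destruct (z O) as [a b], (z 1%nat) as [c d]. simpl in *. lra. }
  rewrite <- Rz.
  assert (Z0 : zeta (RtoC (-1)) = z O).
  { pose proof (Hp 0%C) as Hp0. rewrite Cmod_0 in Hp0. specialize (Hp0 Hr).
    rewrite Cplus_0_r in Hp0. rewrite <- (Cser_unique _ _ Hp0). apply Cser_unique.
    apply Cser_ext with (fun k => (const_coef (z O) k * 0 ^ k)%C).
    - intros [|k]; simpl; ring.
    - apply (pser_const (z O) 0%C 1 0%C). rewrite Cmod_0. lra. }
  unfold C_derive, C_lim. simpl Re at 1.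
  destruct (pser_ex_series _ _ _ _ 0 Hp ltac:(lra)) as [M [HM0 [_ [rho [Hrho HM]]]]].
  change (fst (Re (z 1%nat), 0)) with (Re (z 1%nat)).
  match goal with |- real (Lim ?f ?x) = _ => assert (L : is_lim f x (Re (z 1%nat))) end.
  { apply is_lim_spec. intros eps. 
    assert (Hd : 0 < Rmin (rho / 2) (eps * rho ^ 2 / (2 * M + 1))).
    { apply Rmin_glb_lt; [lra|]. apply Rdiv_lt_0_compat; [|lra].
      apply Rmult_lt_0_compat; [apply cond_pos|apply pow_lt; lra]. }
    assert (K : forall x : R, Rabs (x - -1) < Rmin (rho / 2) (eps * rho ^ 2 / (2 * M + 1)) -> x <> -1 ->
      Rabs (Re ((zeta (x, 0) - zeta (RtoC (-1))) / ((x, 0) - RtoC (-1)))%C - Re (z 1%nat)) < eps).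
    2:{ exists (mkposreal _ Hd). intros x Hx Hne. apply K; [exact Hx|exact Hne]. }
    intros x Hx Hne. set (h := x - -1) in *.
    assert (Hh : h <> 0) by (unfold h; lra).
    pose proof (Rmin_l (rho / 2) (eps * rho ^ 2 / (2 * M + 1))).
    pose proof (Rmin_r (rho / 2) (eps * rho ^ 2 / (2 * M + 1))).
    assert (Habs : 0 < Rabs h) by (now apply Rabs_pos_lt).
    assert (Ex : (x, 0) = (RtoC (-1) + RtoC h)%C) by (unfold h, RtoC, Cplus; simpl; f_equal; ring).
    pose proof (Hp (RtoC h)) as Hser. rewrite Cmod_R in Hser. specialize (Hser ltac:(lra)).
    assert (Ht : forall k, Cmod (z k * RtoC h ^ k)%C <= M * (Rabs h / rho) ^ k).
    { intros k. rewrite Cmod_mult, Cmod_pow, Cmod_R.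
      replace (Rabs h ^ k) with (rho ^ k * (Rabs h / rho) ^ k).
      - rewrite <- Rmult_assoc. apply Rmult_le_compat_r; [|apply HM].
        apply pow_le. apply Rmult_le_pos; [lra|left; apply Rinv_0_lt_compat; lra].
      - rewrite <- Rpow_mult_distr. f_equal. field. lra. }
    assert (Hxr : 0 < Rabs h / rho <= / 2).
    { split; [apply Rdiv_lt_0_compat; lra|]. apply div_le_of_le_mul; lra. }
    pose proof (geometric_tail _ _ M (Rabs h / rho) 1 Hser ltac:(lra) Ht) as T.
    simpl Cpsum in T. rewrite <- Ex, <- Z0 in T.
    set (q := ((zeta (x, 0) - zeta (RtoC (-1))) / ((x, 0) - RtoC (-1)))%C).
    fold q.
    assert (Hd' : ((x, 0) - RtoC (-1))%C = RtoC h) by (unfold h, RtoC, Cminus, Cplus, Copp; simpl; f_equal; ring).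
    assert (HRh : RtoC h <> 0%C) by (intros E; apply RtoC_inj in E; contradiction).
    assert (Eq : (zeta (x, 0) - (zeta (RtoC (-1)) * 1 + z 1%nat * (RtoC h * 1)) = RtoC h * (q - z 1%nat))%C).
    { unfold q. rewrite Hd'. field. exact HRh. }
    rewrite Eq, Cmod_mult, Cmod_R in T.
    replace (Re q - Re (z 1%nat)) with (Re (q - z 1%nat)%C) by (destruct q, (z 1%nat); reflexivity).
    eapply Rle_lt_trans; [apply re_le_Cmod|].
    apply Rmult_lt_reg_l with (Rabs h); [exact Habs|].
    eapply Rle_lt_trans; [exact T|].
    apply Rle_lt_trans with (M * (Rabs h / rho) ^ 2 * 2).
    { unfold Rdiv at 1. apply Rmult_le_compat_l.
      - apply Rmult_le_pos; [exact HM0|apply pow2_ge_0].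
      - rewrite <- (Rinv_inv 2). apply Rinv_le_contravar; lra. }
    replace (M * (Rabs h / rho) ^ 2 * 2) with (Rabs h * (2 * M * Rabs h / rho ^ 2)) by (field; lra).
    apply Rmult_lt_compat_l; [exact Habs|].
    apply Rlt_div_l; [apply pow_lt; lra|].
    assert (Q : Rabs h * (2 * M + 1) < eps * rho ^ 2) by (apply (Rlt_div_r (Rabs h)); lra).
    lra. }
  apply is_lim_unique in L. simpl in L. simpl. rewrite L. reflexivity.
Qed.

Lemma zeta_3 (zeta : C -> C) : is_Riemann_zeta zeta ->
  is_series (fun n => / INR (S n) ^ 3) (Re (zeta (RtoC 3))).
Proof.
  intros [Hz _]. specialize (Hz (RtoC 3) ltac:(simpl; lra)). apply is_series_Cser in Hz.
  destruct Hz as [H _]. eapply is_series_ext; [|exact H].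
  intros n. cbv beta. change (nat_Cpow (S n) (- RtoC 3)) with (rpow (INR (S n)) (- RtoC 3)%C).
  rewrite <- RtoC_opp, rpow_R. simpl Re. rewrite Rpower_Ropp. f_equal.
  replace 3 with (INR 3) by (simpl; ring). apply Rpower_pow, INR_S_pos.
Qed.

(** * Elementary inequalities *)

(** Applied along the segment from [0] to [y], it gives Taylor bounds that do
    not depend on the sign of [y]. *)
Lemma unit_interval_bound (f f' : R -> R) K : (forall x, 0 <= x <= 1 -> is_derive f x (f' x)) ->
  (forall x, 0 <= x <= 1 -> Rabs (f' x) <= K) -> f 0 = 0 -> forall x, 0 <= x <= 1 -> Rabs (f x) <= K.
Proof.
  intros Hd HK H0 x Hx. replace (f x) with (f x - f 0) by (rewrite H0; ring).
  assert (0 <= K) by (eapply Rle_trans; [apply Rabs_pos|apply (HK 0); lra]).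
  apply Rle_trans with (K * (x - 0)); [|nra].
  apply (mean_value_inequality f f'); [lra| |]; intros y Hy; [apply Hd|apply HK]; lra.
Qed.

Lemma Rabs_mult_le a b A B : Rabs a <= A -> Rabs b <= B -> Rabs (a * b) <= A * B.
Proof. intros. rewrite Rabs_mult. apply Rmult_le_compat; auto using Rabs_pos. Qed.

Lemma exp_taylor_2 y : Rabs (exp y - 1 - y - y ^ 2 / 2) <= Rabs y ^ 3 * exp (Rabs y).
Proof.
  set (E := exp (Rabs y)).
  assert (B0 : forall x, 0 <= x <= 1 -> Rabs (exp (x * y)) <= E).
  { intros x Hx. rewrite Rabs_pos_eq by (left; apply exp_pos). apply exp_le_compat.
    pose proof (Rle_abs y). pose proof (Rle_abs (- y)). rewrite Rabs_Ropp in *. nra. }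
  assert (B1 : forall x, 0 <= x <= 1 -> Rabs (exp (x * y) - 1) <= Rabs y * E).
  { apply (unit_interval_bound (fun x => exp (x * y) - 1) (fun x => y * exp (x * y))).
    - intros x _. auto_derive; [exact I|ring].
    - intros x Hx. apply Rabs_mult_le; [lra|now apply B0].
    - rewrite Rmult_0_l, exp_0. ring. }
  assert (B2 : forall x, 0 <= x <= 1 -> Rabs (exp (x * y) - 1 - x * y) <= Rabs y * (Rabs y * E)).
  { apply (unit_interval_bound (fun x => exp (x * y) - 1 - x * y) (fun x => y * (exp (x * y) - 1))).
    - intros x _. auto_derive; [exact I|ring].
    - intros x Hx. apply Rabs_mult_le; [lra|now apply B1].
    - rewrite Rmult_0_l, exp_0. ring. }
  assert (B3 : forall x, 0 <= x <= 1 -> Rabs (exp (x * y) - 1 - x * y - (x * y) ^ 2 / 2) <= Rabs y * (Rabs y * (Rabs y * E))).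
  { apply (unit_interval_bound (fun x => exp (x * y) - 1 - x * y - (x * y) ^ 2 / 2) (fun x => y * (exp (x * y) - 1 - x * y))).
    - intros x _. auto_derive; [exact I|field].
    - intros x Hx. apply Rabs_mult_le; [lra|now apply B2].
    - rewrite Rmult_0_l, exp_0. field. }
  specialize (B3 1 ltac:(lra)). rewrite Rmult_1_l in B3.
  replace (Rabs y ^ 3 * E) with (Rabs y * (Rabs y * (Rabs y * E))) by ring. exact B3.
Qed.

Lemma Rabs_sin_le y : Rabs (sin y) <= Rabs y.
Proof.
  assert (B : forall x, 0 <= x <= 1 -> Rabs (sin (x * y)) <= Rabs y * 1).
  { apply (unit_interval_bound (fun x => sin (x * y)) (fun x => y * cos (x * y))).
    - intros x _. auto_derive; [exact I|ring].
    - intros x Hx. apply Rabs_mult_le; [lra|]. apply Rabs_le. apply COS_bound.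
    - rewrite Rmult_0_l. apply sin_0. }
  specialize (B 1 ltac:(lra)). rewrite Rmult_1_l in B. lra.
Qed.

Lemma Rabs_scaled_le x y : 0 <= x <= 1 -> Rabs (x * y) <= Rabs y.
Proof. intros Hx. rewrite Rabs_mult, (Rabs_pos_eq x) by lra. pose proof (Rabs_pos y). nra. Qed.

Lemma Rabs_cos_minus_1_le y : Rabs (cos y - 1) <= Rabs y.
Proof.
  assert (B : forall x, 0 <= x <= 1 -> Rabs (cos (x * y) - 1) <= Rabs y * 1).
  { apply (unit_interval_bound (fun x => cos (x * y) - 1) (fun x => y * - sin (x * y))).
    - intros x _. auto_derive; [exact I|ring].
    - intros x Hx. apply Rabs_mult_le; [lra|]. rewrite Rabs_Ropp. apply Rabs_le. apply SIN_bound.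
    - rewrite Rmult_0_l, cos_0. ring. }
  specialize (B 1 ltac:(lra)). rewrite Rmult_1_l in B. lra.
Qed.

Lemma Rabs_cos_minus_1_le_sq y : Rabs (cos y - 1) <= Rabs y * Rabs y.
Proof.
  assert (B : forall x, 0 <= x <= 1 -> Rabs (cos (x * y) - 1) <= Rabs y * Rabs y).
  { apply (unit_interval_bound (fun x => cos (x * y) - 1) (fun x => y * - sin (x * y))).
    - intros x _. auto_derive; [exact I|ring].
    - intros x Hx. apply Rabs_mult_le; [lra|]. rewrite Rabs_Ropp.
      eapply Rle_trans; [apply Rabs_sin_le|now apply Rabs_scaled_le].
    - rewrite Rmult_0_l, cos_0. ring. }
  specialize (B 1 ltac:(lra)). rewrite Rmult_1_l in B. lra.
Qed.

Lemma sin_taylor_1_le_sq y : Rabs (sin y - y) <= Rabs y * Rabs y.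
Proof.
  assert (B : forall x, 0 <= x <= 1 -> Rabs (sin (x * y) - x * y) <= Rabs y * Rabs y).
  { apply (unit_interval_bound (fun x => sin (x * y) - x * y) (fun x => y * (cos (x * y) - 1))).
    - intros x _. auto_derive; [exact I|ring].
    - intros x Hx. apply Rabs_mult_le; [lra|].
      eapply Rle_trans; [apply Rabs_cos_minus_1_le|now apply Rabs_scaled_le].
    - rewrite Rmult_0_l, sin_0. ring. }
  specialize (B 1 ltac:(lra)). rewrite Rmult_1_l in B. exact B.
Qed.

Lemma Rabs_scaled_sq_le x y : 0 <= x <= 1 -> Rabs (x * y) * Rabs (x * y) <= Rabs y * Rabs y.
Proof. intros Hx. pose proof (Rabs_scaled_le x y Hx). apply Rmult_le_compat; auto using Rabs_pos. Qed.

Lemma sin_taylor_1 y : Rabs (sin y - y) <= Rabs y ^ 3.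
Proof.
  assert (B : forall x, 0 <= x <= 1 -> Rabs (sin (x * y) - x * y) <= Rabs y * (Rabs y * Rabs y)).
  { apply (unit_interval_bound (fun x => sin (x * y) - x * y) (fun x => y * (cos (x * y) - 1))).
    - intros x _. auto_derive; [exact I|ring].
    - intros x Hx. apply Rabs_mult_le; [lra|].
      eapply Rle_trans; [apply Rabs_cos_minus_1_le_sq|now apply Rabs_scaled_sq_le].
    - rewrite Rmult_0_l, sin_0. ring. }
  specialize (B 1 ltac:(lra)). rewrite Rmult_1_l in B.
  replace (Rabs y ^ 3) with (Rabs y * (Rabs y * Rabs y)) by ring. exact B.
Qed.

Lemma cos_taylor_2 y : Rabs (1 - cos y - y ^ 2 / 2) <= Rabs y ^ 3.
Proof.
  assert (B : forall x, 0 <= x <= 1 -> Rabs (1 - cos (x * y) - (x * y) ^ 2 / 2) <= Rabs y * (Rabs y * Rabs y)).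
  { apply (unit_interval_bound (fun x => 1 - cos (x * y) - (x * y) ^ 2 / 2) (fun x => y * (sin (x * y) - x * y))).
    - intros x _. auto_derive; [exact I|field].
    - intros x Hx. apply Rabs_mult_le; [lra|].
      eapply Rle_trans; [apply sin_taylor_1_le_sq|now apply Rabs_scaled_sq_le].
    - rewrite Rmult_0_l, cos_0. field. }
  specialize (B 1 ltac:(lra)). rewrite Rmult_1_l in B.
  replace (Rabs y ^ 3) with (Rabs y * (Rabs y * Rabs y)) by ring. exact B.
Qed.

(** A weak form of Jordan's inequality, for which the bound [PI <= 4] is enough. *)
Lemma sin_lower y : 0 <= y <= PI / 2 -> 5 / 12 * y <= sin y.
Proof.
  intros Hy. pose proof PI_4. pose proof PI_RGT_0. pose proof PI2_1.
  assert (S : forall x, 0 <= x <= 1 -> 5 / 6 * x <= sin x).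
  { intros x Hx.
    pose proof (pre_sin_bound x 0 ltac:(lra) ltac:(lra)) as [B _].
    unfold sin_approx, sin_term in B. simpl in B. nra. }
  destruct (Rle_lt_dec y 1) as [h|h].
  - specialize (S y ltac:(lra)). lra.
  - specialize (S 1 ltac:(lra)).
    assert (sin 1 <= sin y) by (apply sin_incr_1; lra). lra.
Qed.

Lemma one_minus_cos_lower th : - PI <= th <= PI -> th ^ 2 / 12 <= 1 - cos th.
Proof.
  intros Hth.
  assert (G : forall y, 0 <= y <= PI -> y ^ 2 / 12 <= 1 - cos y).
  { intros y Hy. pose proof (sin_lower (y / 2) ltac:(lra)) as Hs.
    replace y with (2 * (y / 2)) at 2 by field. rewrite cos_2a_sin. nra. }
  destruct (Rle_lt_dec 0 th) as [h|h]; [apply G; lra|].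
  rewrite <- cos_neg. replace (th ^ 2) with ((- th) ^ 2) by ring. apply G. lra.
Qed.

(** * The Gaussian integral *)

Definition gauss (u : R) : R := exp (- (u ^ 2) / 2).

Lemma gauss_continuous u : continuous gauss u.
Proof. apply (ex_derive_continuous (V := R_NormedModule)). unfold gauss. auto_derive. exact I. Qed.

Lemma ex_RInt_gauss a b : ex_RInt gauss a b.
Proof. apply (ex_RInt_continuous (V := R_CompleteNormedModule)). intros x _. apply gauss_continuous. Qed.

(** The integrand of the classical companion integral, whose derivative in [x]
    is again Gaussian. *)
Definition gauss_aux (x t : R) : R := exp (- (x ^ 2) * (1 + t ^ 2) / 2) / (1 + t ^ 2).

Lemma one_plus_sq_pos t : 0 < 1 + t ^ 2.
Proof. pose proof (pow2_ge_0 t). lra. Qed.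

Lemma is_derive_gauss_aux x t :
  is_derive (fun x => gauss_aux x t) x (- x * exp (- (x ^ 2) * (1 + t ^ 2) / 2)).
Proof.
  unfold gauss_aux. pose proof (one_plus_sq_pos t). auto_derive; [lra|].
  replace (- (x * (x * 1)) * (1 + t * (t * 1)) * / 2) with (- x ^ 2 * (1 + t ^ 2) / 2) by (simpl; field).
  simpl. simpl in H. field. lra.
Qed.

Lemma ex_RInt_gauss_aux x a b : ex_RInt (gauss_aux x) a b.
Proof.
  apply (ex_RInt_continuous (V := R_CompleteNormedModule)). intros t _.
  apply (ex_derive_continuous (V := R_NormedModule)). unfold gauss_aux.
  pose proof (one_plus_sq_pos t). auto_derive. simpl in *; lra.
Qed.

Lemma is_derive_RInt_gauss_aux x :
  is_derive (fun x => RInt (gauss_aux x) 0 1) x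
    (RInt (fun t => - x * exp (- (x ^ 2) * (1 + t ^ 2) / 2)) 0 1).
Proof.
  replace (RInt (fun t => - x * exp (- (x ^ 2) * (1 + t ^ 2) / 2)) 0 1)
    with (RInt (fun t => Derive (fun u => gauss_aux u t) x) 0 1).
  2:{ apply RInt_ext. intros t _. apply is_derive_unique, is_derive_gauss_aux. }
  apply (is_derive_RInt_param gauss_aux 0 1 x).
  - exists (mkposreal 1 Rlt_0_1). intros y _ t _. eexists. apply is_derive_gauss_aux.
  - intros t _.
    apply continuity_2d_pt_ext with (fun u v => - u * exp (- (u * u) * (1 + v * v) * / 2)).
    + intros u v. symmetry. etransitivity; [apply is_derive_unique, is_derive_gauss_aux|].
      f_equal. f_equal. field.
    + apply continuity_2d_pt_mult.
      * apply continuity_2d_pt_opp, continuity_2d_pt_id1.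
      * apply (continuity_1d_2d_pt_comp exp (fun u v => - (u * u) * (1 + v * v) * / 2)).
        -- apply derivable_continuous_pt, derivable_pt_exp.
        -- apply continuity_2d_pt_mult; [|apply continuity_2d_pt_const].
           apply continuity_2d_pt_mult.
           ++ apply continuity_2d_pt_opp, continuity_2d_pt_mult; apply continuity_2d_pt_id1.
           ++ apply continuity_2d_pt_plus; [apply continuity_2d_pt_const|].
              apply continuity_2d_pt_mult; apply continuity_2d_pt_id2.
  - exists (mkposreal 1 Rlt_0_1). intros y _. apply ex_RInt_gauss_aux.
Qed.

Lemma is_derive_RInt_gauss x : is_derive (fun x => RInt gauss 0 x) x (gauss x).
Proof.
  apply (is_derive_RInt (V := R_CompleteNormedModule) gauss (fun x => RInt gauss 0 x) 0 x).
  - exists (mkposreal 1 Rlt_0_1). intros y _. apply RInt_correct, ex_RInt_gauss.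
  - apply gauss_continuous.
Qed.

(** Substitute [u = x t]. *)
Lemma RInt_gauss_scaled x :
  RInt (fun t => - x * exp (- (x ^ 2) * (1 + t ^ 2) / 2)) 0 1 = - gauss x * RInt gauss 0 x.
Proof.
  pose proof (is_RInt_comp_lin (V := R_CompleteNormedModule) gauss x 0 0 1 (RInt gauss (x * 0 + 0) (x * 1 + 0))) as H.
  specialize (H (RInt_correct _ _ _ (ex_RInt_gauss _ _))).
  replace (x * 0 + 0) with 0 in H by ring. replace (x * 1 + 0) with x in H by ring.
  apply (is_RInt_scal (V := R_NormedModule) _ _ _ (- gauss x)) in H.
  apply is_RInt_unique. eapply is_RInt_ext; [|exact H].
  intros t _. cbv beta. change (- gauss x * (x * gauss (x * t + 0)) = - x * exp (- x ^ 2 * (1 + t ^ 2) / 2)).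
  unfold gauss. replace (- x ^ 2 * (1 + t ^ 2) / 2) with (- x ^ 2 / 2 + - (x * t + 0) ^ 2 / 2) by field.
  rewrite exp_plus. ring.
Qed.

(** By [RInt_gauss_scaled] the left-hand side has derivative zero, and at
    [x = 0] it is twice the integral of [1 / (1 + t^2)] over the unit interval. *)
Lemma gauss_square x : 0 <= x -> RInt gauss 0 x ^ 2 + 2 * RInt (gauss_aux x) 0 1 = PI / 2.
Proof.
  intros Hx.
  transitivity (RInt gauss 0 0 ^ 2 + 2 * RInt (gauss_aux 0) 0 1).
  - apply (zero_derivative_const (fun x => RInt gauss 0 x ^ 2 + 2 * RInt (gauss_aux x) 0 1)); [exact Hx|].
    intros y _. pose proof (is_derive_RInt_gauss y) as D1. pose proof (is_derive_RInt_gauss_aux y) as D2.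
    rewrite RInt_gauss_scaled in D2.
    pose (g := fun x => RInt gauss 0 x). pose (h := fun x => RInt (gauss_aux x) 0 1).
    assert (Eg : RInt gauss 0 y = g y) by reflexivity. rewrite Eg in D2.
    change (is_derive g y (gauss y)) in D1. change (is_derive h y (- gauss y * g y)) in D2.
    change (is_derive (fun x => g x ^ 2 + 2 * h x) y 0). clear Eg. clearbody g h.
    auto_derive; [repeat split; eexists; eassumption|].
    subst_derive. ring.
  - rewrite RInt_point. replace (RInt (gauss_aux 0) 0 1) with (PI / 4).
    + change (@zero _) with 0. simpl. field.
    + symmetry. apply is_RInt_unique.
      replace (PI / 4) with (minus (G := R_AbelianGroup) (atan 1) (atan 0)).
      2:{ change (atan 1 - atan 0 = PI / 4). rewrite atan_1, atan_0. ring. }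
      apply is_RInt_ext with (fun t => / (1 + t ^ 2)).
      * intros t _. unfold gauss_aux. replace (- 0 ^ 2 * (1 + t ^ 2) / 2) with 0 by field.
        rewrite exp_0. symmetry. apply Rmult_1_l.
      * apply (is_RInt_derive (V := R_CompleteNormedModule) atan (fun t => / (1 + t ^ 2))).
        -- intros t _. pose proof (one_plus_sq_pos t). auto_derive; [exact I|]. simpl in *. unfold Rsqr. field. lra.
        -- intros t _. apply (ex_derive_continuous (V := R_NormedModule)). pose proof (one_plus_sq_pos t).
           auto_derive. simpl in *. lra.
Qed.

Lemma RInt_gauss_limit eps : 0 < eps -> exists U0, 0 < U0 /\ forall U, U0 <= U ->
  Rabs (RInt gauss (- U) U - sqrt (2 * PI)) <= eps.
Proof.
  intros He. pose proof PI_RGT_0 as HP.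
  set (r := sqrt (PI / 2)). assert (Hr : 0 < r) by (apply sqrt_lt_R0; lra).
  assert (Hr2 : r * r = PI / 2) by (apply sqrt_sqrt; lra).
  assert (E2 : sqrt (2 * PI) = 2 * r).
  { apply sqrt_lem_1; [lra|lra|]. replace (2 * r * (2 * r)) with (4 * (r * r)) by ring. rewrite Hr2. field. }
  set (U0 := Rmax 1 (8 / (eps * r))).
  assert (H1 : 1 <= U0) by apply Rmax_l.
  exists U0. split; [lra|]. intros U HU.
  assert (HU' : 8 / (eps * r) <= U) by (eapply Rle_trans; [apply Rmax_r|exact HU]).
  assert (Heps : 0 < eps * r) by (apply Rmult_lt_0_compat; lra).
  assert (HU2 : 8 <= U * (eps * r)).
  { apply Rle_trans with (8 / (eps * r) * (eps * r)); [right; field; split; lra|]. apply Rmult_le_compat_r; lra. }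
  assert (Half : RInt gauss (- U) U = 2 * RInt gauss 0 U).
  { rewrite <- (RInt_Chasles gauss (- U) 0 U) by apply ex_RInt_gauss.
    change plus with Rplus.
    assert (S : RInt gauss (- U) 0 = RInt gauss 0 U).
    { pose proof (is_RInt_comp_opp (V := R_CompleteNormedModule) gauss U 0 (RInt gauss (- U) (- 0))
        (RInt_correct _ _ _ (ex_RInt_gauss _ _))) as H.
      rewrite Ropp_0 in H. apply is_RInt_swap, is_RInt_opp in H.
      symmetry. rewrite <- (Ropp_involutive (RInt gauss (- U) 0)). apply is_RInt_unique.
      eapply is_RInt_ext; [|exact H].
      intros y _. change (- - gauss (- y) = gauss y). rewrite Ropp_involutive.
      unfold gauss. f_equal. field. }
    rewrite S. change (RInt gauss 0 U + RInt gauss 0 U = 2 * RInt gauss 0 U). ring. }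
  rewrite Half, E2.
  set (I := RInt gauss 0 U) in *. pose proof (gauss_square U ltac:(lra)) as GS. fold I in GS.
  assert (I0 : 0 <= I).
  { apply RInt_ge_0; [lra|apply ex_RInt_gauss|]. intros x _. left. apply exp_pos. }
  assert (J : 0 <= RInt (gauss_aux U) 0 1 <= 2 / U).
  { split.
    - apply RInt_ge_0; [lra|apply ex_RInt_gauss_aux|]. intros x _. unfold gauss_aux.
      left. apply Rdiv_lt_0_compat; [apply exp_pos|apply one_plus_sq_pos].
    - apply Rle_trans with (RInt (fun _ => 2 / U) 0 1).
      + apply RInt_le; [lra|apply ex_RInt_gauss_aux|apply ex_RInt_const|].
        intros x _. unfold gauss_aux. pose proof (one_plus_sq_pos x). pose proof (pow2_ge_0 x).
        assert (HE : exp (- U ^ 2 * (1 + x ^ 2) / 2) <= 2 / U).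
        { replace (- U ^ 2 * (1 + x ^ 2) / 2) with (- (U ^ 2 * (1 + x ^ 2) / 2)) by field. rewrite exp_Ropp.
          pose proof (exp_ineq1_le (U ^ 2 * (1 + x ^ 2) / 2)).
          replace (2 / U) with (/ (U / 2)) by (field; lra). apply Rinv_le_contravar; [lra|]. nra. }
        apply div_le_of_le_mul; [lra|]. assert (0 < 2 / U) by (apply Rdiv_lt_0_compat; lra). nra.
      + rewrite RInt_const. change ((1 - 0) * (2 / U) <= 2 / U). lra. }
  assert (HJ : 2 / U <= eps * r / 4).
  { apply div_le_of_le_mul; [lra|]. lra. }
  assert (Hdiff : 0 <= r * r - I * I <= eps * r / 2) by nra.
  assert (Ir : I <= r) by nra.
  rewrite Rabs_left1 by lra.
  assert ((r - I) * r <= eps / 2 * r) by nra.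
  assert (r - I <= eps / 2) by (apply Rmult_le_reg_r with r; assumption). lra.
Qed.

(** * Cumulants *)

(** The terms of [log F (exp (- t))]. *)
Definition wt (t : R) (k : nat) : R := pp_log_coef k * exp (- (INR k * t)).

(** The cumulants of the distribution on the integers with weights
    [pp(n) exp (- n t)], that is, up to sign the derivatives of [pp_log]. *)
Definition kap (r : nat) (t : R) : R := Series (fun k => INR k ^ r * wt t k).

Lemma wt_nonneg t k : 0 <= wt t k.
Proof. apply Rmult_le_pos; [apply pp_log_coef_nonneg|left; apply exp_pos]. Qed.

Lemma CV_radius_PS_D a : CV_radius (PS_D a) = CV_radius a.
Proof.
  rewrite (CV_radius_ext _ (PS_incr_1 (PS_derive a))).
  - now rewrite CV_radius_incr_1, CV_radius_derive.
  - intros [|n]; [apply Rmult_0_l|reflexivity].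
Qed.

Lemma CV_radius_kap r : Rbar_le 1 (CV_radius (fun k => INR k ^ r * pp_log_coef k)).
Proof.
  induction r as [|r IH].
  - rewrite (CV_radius_ext _ pp_log_coef); [apply CV_radius_pp_log_coef|]. intros n. simpl. ring.
  - rewrite (CV_radius_ext _ (PS_D (fun k => INR k ^ r * pp_log_coef k))).
    + rewrite CV_radius_PS_D. exact IH.
    + intros n. unfold PS_D. simpl. ring.
Qed.

Lemma ex_series_kap r t : 0 < t -> ex_series (fun k => INR k ^ r * wt t k).
Proof.
  intros Ht. pose proof (exp_neg_bounds t Ht) as Hq.
  assert (H : Rbar_lt (Rabs (exp (- t))) (CV_radius (fun k => INR k ^ r * pp_log_coef k))).
  { apply lt_CV_radius; [apply CV_radius_kap|rewrite Rabs_pos_eq; lra]. }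
  apply CV_radius_inside in H.
  apply ex_pseries_R in H.
  eapply ex_series_ext; [|exact H]. intros k. unfold wt. cbv beta. rewrite exp_neg_pow. apply Rmult_assoc.
Qed.

Lemma pp_log_kap t : pp_log t = kap 0 t.
Proof.
  unfold pp_log, PSeries, kap. apply Series_ext. intros k. unfold wt. rewrite exp_neg_pow. simpl. ring.
Qed.

Lemma Series_dist_le (a b e : nat -> R) : ex_series a -> ex_series b -> ex_series e ->
  (forall k, Rabs (a k - b k) <= e k) -> Rabs (Series a - Series b) <= Series e.
Proof.
  intros Ha Hb He H. rewrite <- Series_minus by assumption.
  eapply Rle_trans; [apply Series_Rabs, (ex_series_dominated_abs e); assumption|].
  apply Series_le; [|exact He]. intros k. split; [apply Rabs_pos|apply H].
Qed.

Lemma ex_series_Rplus (a b : nat -> R) : ex_series a -> ex_series b -> ex_series (fun k => a k + b k).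
Proof. apply (ex_series_plus (V := R_NormedModule)). Qed.

(** Termwise Taylor expansion of [exp (k x)]. *)
Lemma pp_log_taylor t x : 0 < t -> Rabs x <= t / 2 ->
  Rabs (pp_log (t - x) - (pp_log t + x * kap 1 t + x ^ 2 / 2 * kap 2 t)) <= Rabs x ^ 3 * kap 3 (t / 2).
Proof.
  intros Ht Hx. pose proof (Rabs_le_inv _ _ Hx) as Hx'. rewrite !pp_log_kap. unfold kap.
  pose proof (ex_series_kap 0 t Ht) as E0. pose proof (ex_series_kap 1 t Ht) as E1.
  pose proof (ex_series_kap 2 t Ht) as E2.
  apply (ex_series_Rscal x) in E1. apply (ex_series_Rscal (x ^ 2 / 2)) in E2.
  pose proof (ex_series_Rplus _ _ E0 E1) as E01.
  rewrite <- !Series_scal_l, <- Series_plus, <- Series_plus by assumption.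
  apply Series_dist_le.
  - apply ex_series_kap. lra.
  - apply ex_series_Rplus; assumption.
  - apply ex_series_Rscal, ex_series_kap. lra.
  - intros k. unfold wt. pose proof (pp_log_coef_nonneg k) as Hc. pose proof (pos_INR k) as Hk.
    replace (exp (- (INR k * (t - x)))) with (exp (- (INR k * t)) * exp (INR k * x)).
    2:{ rewrite <- exp_plus. f_equal. ring. }
    set (y := INR k * x). set (w := pp_log_coef k). set (q := exp (- (INR k * t))).
    replace (INR k ^ 0 * (w * (q * exp y)) - (INR k ^ 0 * (w * q) + x * (INR k ^ 1 * (w * q)) + x ^ 2 / 2 * (INR k ^ 2 * (w * q))))
      with (w * (q * (exp y - 1 - y - y ^ 2 / 2))) by (unfold y; simpl; field).
    rewrite Rabs_mult, (Rabs_pos_eq w) by exact Hc.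
    rewrite Rabs_mult, (Rabs_pos_eq q) by (left; apply exp_pos).
    replace (Rabs x ^ 3 * (INR k ^ 3 * (w * exp (- (INR k * (t / 2))))))
      with (w * ((INR k * Rabs x) ^ 3 * exp (- (INR k * (t / 2))))) by ring.
    apply Rmult_le_compat_l; [exact Hc|].
    assert (Ey : Rabs y = INR k * Rabs x) by (unfold y; rewrite Rabs_mult, Rabs_pos_eq; lra).
    apply Rle_trans with (q * (Rabs y ^ 3 * exp (Rabs y))).
    { apply Rmult_le_compat_l; [left; apply exp_pos|apply exp_taylor_2]. }
    rewrite Ey.
    replace (q * ((INR k * Rabs x) ^ 3 * exp (INR k * Rabs x))) with
      ((INR k * Rabs x) ^ 3 * (q * exp (INR k * Rabs x))) by ring.
    apply Rmult_le_compat_l.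
    + apply pow_le, Rmult_le_pos; [exact Hk|apply Rabs_pos].
    + unfold q. rewrite <- exp_plus. apply exp_le_compat. nra.
Qed.

Lemma cube_le_exp y : 0 <= y -> y ^ 3 <= 6 * exp y.
Proof.
  intros Hy. pose proof (sinh_ge_cube y Hy) as H. unfold sinh in H.
  pose proof (exp_pos y). pose proof (exp_pos (- y)). lra.
Qed.

(** Half of the exponential decay pays for the polynomial weight. *)
Lemma kap_3_le t : 0 < t -> kap 3 t <= 48 / t ^ 3 * pp_log (t / 2).
Proof.
  intros Ht. rewrite pp_log_kap. unfold kap. rewrite <- Series_scal_l.
  apply Series_le.
  2:{ apply ex_series_Rscal, ex_series_kap. lra. }
  intros k. pose proof (pos_INR k) as Hk. split.
  - apply Rmult_le_pos; [now apply pow_le|apply wt_nonneg].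
  - unfold wt. pose proof (pp_log_coef_nonneg k) as Hc.
    assert (P3 : 0 < t ^ 3) by (apply pow_lt; lra).
    replace (48 / t ^ 3 * (INR k ^ 0 * (pp_log_coef k * exp (- (INR k * (t / 2))))))
      with (pp_log_coef k * (48 * exp (- (INR k * (t / 2))) / t ^ 3)) by (simpl; field; lra).
    replace (INR k ^ 3 * (pp_log_coef k * exp (- (INR k * t)))) with
      (pp_log_coef k * (INR k ^ 3 * exp (- (INR k * t)))) by ring.
    apply Rmult_le_compat_l; [exact Hc|]. apply le_div_of_mul_le; [exact P3|].
    pose proof (cube_le_exp (INR k * (t / 2)) ltac:(nra)) as H.
    replace (exp (- (INR k * t))) with (exp (- (INR k * (t / 2))) * exp (- (INR k * (t / 2)))).
    2:{ rewrite <- exp_plus. f_equal. field. }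
    assert (E : exp (INR k * (t / 2)) * exp (- (INR k * (t / 2))) = 1)
      by (rewrite <- exp_plus, Rplus_opp_r; apply exp_0).
    set (e := exp (- (INR k * (t / 2)))) in *. set (f := exp (INR k * (t / 2))) in *.
    assert (0 < e) by apply exp_pos.
    apply Rle_trans with (8 * (INR k * (t / 2)) ^ 3 * e * e); [right; field|].
    apply Rle_trans with (8 * (6 * f) * e * e).
    + apply Rmult_le_compat_r; [lra|]. apply Rmult_le_compat_r; lra.
    + right. transitivity (48 * (f * e) * e); [ring|]. rewrite E. ring.
Qed.

(** The coefficient of [1 / t^2] in [pp_log]; it equals [(7 / 4) zeta(3)]. *)
Definition zc : R := 2 * Series (odd_coef 3).

Lemma zc_pos : 0 < zc.
Proof.
  unfold zc. assert (H : sum_f_R0 (odd_coef 3) 1 <= Series (odd_coef 3)).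
  { apply sum_le_Series; [intros n; apply odd_coef_bounds|apply (ex_series_odd_coef 1)]. }
  unfold odd_coef in H at 1. simpl in H. lra.
Qed.

Definition pp_log_main (t : R) : R := zc / t ^ 2 + ln (t / 2) / 12 - / 6 + em_const.

Lemma pp_log_small : small (fun t => pp_log t - pp_log_main t).
Proof. exact pp_log_asymp. Qed.

Lemma pp_log_upper : exists K t0, 0 < K /\ 0 < t0 /\ forall t, 0 < t < t0 -> pp_log t <= K / t ^ 2.
Proof.
  destruct (pp_log_small 1 Rlt_0_1) as [d [Hd H]].
  exists (zc + Rabs em_const + 1), (Rmin d 1).
  pose proof zc_pos. pose proof (Rabs_pos em_const).
  split; [lra|]. split; [apply Rmin_glb_lt; lra|]. intros t Ht.
  pose proof (Rmin_l d 1). pose proof (Rmin_r d 1).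
  specialize (H t ltac:(lra)). apply Rabs_le_inv in H. unfold pp_log_main in H.
  assert (ln (t / 2) <= 0) by (rewrite <- ln_1; apply Rcomplements.ln_le; lra).
  assert (0 < t ^ 2) by (apply pow_lt; lra). assert (t ^ 2 <= 1) by nra.
  pose proof (Rle_abs em_const).
  replace ((zc + Rabs em_const + 1) / t ^ 2) with (zc / t ^ 2 + (Rabs em_const + 1) / t ^ 2) by (field; lra).
  assert (Rabs em_const + 1 <= (Rabs em_const + 1) / t ^ 2) by (apply le_div_of_mul_le; nra).
  lra.
Qed.

Lemma kap_3_upper : exists K t0, 0 < K /\ 0 < t0 /\
  forall t, 0 < t < t0 -> 0 <= kap 3 t <= K / t ^ 5 /\ 0 <= kap 3 (t / 2) <= K / t ^ 5.
Proof.
  destruct pp_log_upper as [K [t0 [HK [Ht0 H]]]].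
  assert (P : forall t, 0 < t < t0 -> 0 <= kap 3 t <= 192 * K / t ^ 5).
  { intros t Ht. split.
    - apply Series_nonneg; [|apply ex_series_kap; lra].
      intros k. apply Rmult_le_pos; [apply pow_le, pos_INR|apply wt_nonneg].
    - eapply Rle_trans; [apply kap_3_le; lra|]. specialize (H (t / 2) ltac:(lra)).
      assert (0 < t ^ 3) by (apply pow_lt; lra).
      apply Rle_trans with (48 / t ^ 3 * (K / (t / 2) ^ 2)).
      + apply Rmult_le_compat_l; [left; apply Rdiv_lt_0_compat; lra|exact H].
      + right. field. lra. }
  exists (192 * 32 * K), t0. split; [lra|]. split; [exact Ht0|]. intros t Ht.
  assert (P5 : 0 < t ^ 5) by (apply pow_lt; lra). split.
  - destruct (P t Ht) as [A B]. split; [exact A|]. eapply Rle_trans; [exact B|].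
    apply Rmult_le_compat_r; [left; now apply Rinv_0_lt_compat|lra].
  - destruct (P (t / 2) ltac:(lra)) as [A B]. split; [exact A|]. eapply Rle_trans; [exact B|].
    right. field. lra.
Qed.

(** The inverse of the standard deviation of the saddle point distribution, up
    to a factor that tends to [1]. *)
Definition sig (t : R) : R := t ^ 2 / sqrt (6 * zc).

Lemma sqrt_zc : 0 < sqrt (6 * zc) /\ sqrt (6 * zc) * sqrt (6 * zc) = 6 * zc.
Proof. pose proof zc_pos. split; [apply sqrt_lt_R0; lra|apply sqrt_sqrt; lra]. Qed.

Lemma inv_sq_expansion y : Rabs y <= / 2 ->
  Rabs (/ (1 - y) ^ 2 - 1 - 2 * y - 3 * y ^ 2) <= 22 * Rabs y ^ 3.
Proof.
  intros Hy. pose proof (Rabs_le_inv _ _ Hy) as H.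
  replace (/ (1 - y) ^ 2 - 1 - 2 * y - 3 * y ^ 2) with (y ^ 3 * ((4 - 3 * y) / (1 - y) ^ 2)) by (field; lra).
  rewrite Rabs_mult, <- RPow_abs, Rmult_comm.
  apply Rmult_le_compat_r; [apply pow_le, Rabs_pos|].
  assert (P : / 4 <= (1 - y) ^ 2) by nra.
  rewrite Rabs_pos_eq by (apply Rmult_le_pos; [lra|left; apply Rinv_0_lt_compat; lra]).
  apply div_le_of_le_mul; lra.
Qed.

Lemma Rabs_ln_le y : Rabs y <= / 2 -> Rabs (ln (1 - y)) <= 2 * Rabs y.
Proof.
  intros Hy. pose proof (Rabs_le_inv _ _ Hy) as H.
  pose proof (exp_ineq1_le (ln (1 - y))) as E1. rewrite exp_ln in E1 by lra.
  pose proof (exp_ineq1_le (ln (/ (1 - y)))) as E2.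
  rewrite exp_ln, ln_Rinv in E2 by (try apply Rinv_0_lt_compat; lra).
  assert (E3 : / (1 - y) - 1 <= 2 * Rabs y).
  { replace (/ (1 - y) - 1) with (y / (1 - y)) by (field; lra). apply div_le_of_le_mul; [lra|].
    pose proof (Rle_abs y). pose proof (Rabs_pos y). nra. }
  pose proof (Rle_abs (- y)) as E4. rewrite Rabs_Ropp in E4. pose proof (Rabs_pos y).
  apply Rabs_le. lra.
Qed.

(** The choice of [sig] makes the quadratic term of the expansion equal to
    [1 / 2]. *)
Lemma pp_log_main_diff e t : (e = 1 \/ e = -1) -> 0 < t < sqrt (6 * zc) / 2 ->
  Rabs (pp_log_main (t - e * sig t) - pp_log_main t - (e * (2 * zc / t ^ 3 * sig t) + / 2))
    <= (22 * zc / sqrt (6 * zc) ^ 3 + 1 / sqrt (6 * zc)) * t.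
Proof.
  intros He Ht. destruct sqrt_zc as [R0 R2]. pose proof zc_pos as Z0. set (r := sqrt (6 * zc)) in *.
  set (y := e * t / r).
  assert (Ay : Rabs y = t / r).
  { unfold y. replace (e * t / r) with (e * (t / r)) by (field; lra). rewrite Rabs_mult.
    replace (Rabs e) with 1 by (destruct He; subst; [rewrite Rabs_pos_eq|rewrite Rabs_left]; lra).
    rewrite Rmult_1_l. apply Rabs_pos_eq. apply Rlt_le, Rdiv_lt_0_compat; lra. }
  assert (Hy : Rabs y <= / 2) by (rewrite Ay; apply div_le_of_le_mul; lra).
  pose proof (Rabs_le_inv _ _ Hy) as Hy'.
  assert (Ets : t - e * sig t = t * (1 - y)) by (unfold sig, y; fold r; field; lra).
  assert (Ee : e * e = 1) by (destruct He; subst; ring).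
  assert (Ly : ln (t * (1 - y) / 2) = ln (t / 2) + ln (1 - y)).
  { rewrite <- ln_mult by lra. f_equal. field. }
  unfold pp_log_main. rewrite Ets, Ly.
  assert (EZ : e * (2 * zc / t ^ 3 * sig t) + / 2 = zc / t ^ 2 * (2 * y + 3 * y ^ 2)).
  { unfold sig, y. fold r.
    replace (zc / t ^ 2 * (2 * (e * t / r) + 3 * (e * t / r) ^ 2)) with
      (e * (2 * zc / t ^ 3 * (t ^ 2 / r)) + (e * e) * 3 * zc / (r * r)) by (field; lra).
    rewrite Ee, R2. f_equal. field. lra. }
  rewrite EZ.
  replace (zc / (t * (1 - y)) ^ 2 + (ln (t / 2) + ln (1 - y)) / 12 - / 6 + em_const -
    (zc / t ^ 2 + ln (t / 2) / 12 - / 6 + em_const) - zc / t ^ 2 * (2 * y + 3 * y ^ 2))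
    with (zc / t ^ 2 * (/ (1 - y) ^ 2 - 1 - 2 * y - 3 * y ^ 2) + ln (1 - y) / 12) by (field; lra).
  eapply Rle_trans; [apply Rabs_triang|]. rewrite Rmult_plus_distr_r.
  assert (Pt : 0 < zc / t ^ 2) by (apply Rdiv_lt_0_compat; [lra|apply pow_lt; lra]).
  apply Rplus_le_compat.
  - rewrite Rabs_mult, (Rabs_pos_eq (zc / t ^ 2)) by lra.
    eapply Rle_trans; [apply Rmult_le_compat_l; [lra|apply inv_sq_expansion; exact Hy]|].
    rewrite Ay. right. field. lra.
  - pose proof (Rabs_ln_le y Hy) as HL. rewrite Ay in HL.
    unfold Rdiv at 1. rewrite Rabs_mult, (Rabs_pos_eq (/ 12)) by lra.
    replace (1 / r * t) with (t / r) by (field; lra).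
    assert (0 < t / r) by (apply Rdiv_lt_0_compat; lra). lra.
Qed.

Lemma small_comp g phi t0 : 0 < t0 -> (forall t, 0 < t < t0 -> 0 < phi t <= 2 * t) -> small g ->
  small (fun t => g (phi t)).
Proof.
  intros H0 Hp Hg eps He. destruct (Hg eps He) as [d [Hd H]].
  exists (Rmin t0 (d / 2)). split; [apply Rmin_glb_lt; lra|]. intros t Ht.
  pose proof (Rmin_l t0 (d / 2)). pose proof (Rmin_r t0 (d / 2)).
  specialize (Hp t ltac:(lra)). apply H. lra.
Qed.

Lemma sig_bounds t : 0 < t < sqrt (6 * zc) / 2 -> 0 < sig t <= t / 2.
Proof.
  intros Ht. destruct sqrt_zc as [R0 _]. unfold sig. split.
  - apply Rdiv_lt_0_compat; [apply pow_lt; lra|exact R0].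
  - apply div_le_of_le_mul; [exact R0|]. nra.
Qed.

(** The Taylor expansion of [pp_log] at [t], compared with the difference of its
    asymptotics at [t] and [t - e * sig t]. *)
Lemma cumulants_combined e : (e = 1 \/ e = -1) ->
  small (fun t => e * ((kap 1 t - 2 * zc / t ^ 3) * sig t) + (kap 2 t * sig t ^ 2 - 1) / 2).
Proof.
  intros He. destruct sqrt_zc as [R0 R2]. pose proof zc_pos as Z0.
  destruct kap_3_upper as [K [t1 [HK [Ht1 H3]]]].
  set (r := sqrt (6 * zc)) in *.
  set (C := 22 * zc / r ^ 3 + 1 / r).
  apply small_le with (t0 := Rmin (r / 2) t1)
    (h := fun t => (C + K / r ^ 3) * t + (Rabs (pp_log (t - e * sig t) - pp_log_main (t - e * sig t))
       + Rabs (pp_log t - pp_log_main t))).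
  - apply Rmin_glb_lt; lra.
  - intros t Ht. pose proof (Rmin_l (r / 2) t1). pose proof (Rmin_r (r / 2) t1).
    assert (Hs : 0 < sig t <= t / 2) by (apply sig_bounds; fold r; lra).
    pose proof (pp_log_main_diff e t He ltac:(fold r; lra)) as HM. fold r C in HM.
    set (s := sig t) in *.
    assert (Aes : Rabs (e * s) = s).
    { rewrite Rabs_mult. replace (Rabs e) with 1 by (destruct He; subst; [rewrite Rabs_pos_eq|rewrite Rabs_left]; lra).
      rewrite Rmult_1_l. apply Rabs_pos_eq. lra. }
    assert (Ee : e * e = 1) by (destruct He; subst; ring).
    pose proof (pp_log_taylor t (e * s) ltac:(lra) ltac:(lra)) as HT. rewrite Aes in HT.
    replace ((e * s) ^ 2) with (s ^ 2) in HT by (replace ((e * s) ^ 2) with ((e * e) * s ^ 2) by ring; rewrite Ee; ring).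
    destruct (H3 t ltac:(lra)) as [_ [_ H3']].
    assert (B3 : s ^ 3 * kap 3 (t / 2) <= K / r ^ 3 * t).
    { apply Rle_trans with (s ^ 3 * (K / t ^ 5)).
      - apply Rmult_le_compat_l; [apply pow_le; lra|exact H3'].
      - right. unfold s, sig. fold r. field. lra. }
    set (a := pp_log (t - e * s)) in *. set (b := pp_log t) in *.
    set (a' := pp_log_main (t - e * s)) in *. set (b' := pp_log_main t) in *.
    set (N := 2 * zc / t ^ 3) in *.
    replace (e * ((kap 1 t - N) * s) + (kap 2 t * s ^ 2 - 1) / 2) with
      (- (a - (b + e * s * kap 1 t + s ^ 2 / 2 * kap 2 t)) + (a' - b' - (e * (N * s) + / 2)) + ((a - a') - (b - b'))) by field.
    eapply Rle_trans; [apply Rabs_triang|]. apply Rplus_le_compat.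
    + eapply Rle_trans; [apply Rabs_triang|]. rewrite Rabs_Ropp. lra.
    + unfold Rminus at 1. eapply Rle_trans; [apply Rabs_triang|]. rewrite Rabs_Ropp. lra.
  - apply small_plus; [apply small_scal, small_id|].
    assert (SA : forall g, small g -> small (fun t => Rabs (g t))).
    { intros g Hg eps Heps. destruct (Hg eps Heps) as [d [Hd H]]. exists d. split; [exact Hd|].
      intros t Ht. rewrite Rabs_Rabsolu. now apply H. }
    apply small_plus.
    + apply SA. apply (small_comp (fun t => pp_log t - pp_log_main t) (fun t => t - e * sig t) (r / 2));
        [lra| |exact pp_log_small].
      intros t Ht. assert (Hs : 0 < sig t <= t / 2) by (apply sig_bounds; fold r; lra).
      destruct He; subst; lra.
    + apply SA, pp_log_small.
Qed.

(** Odd part in [e] of [cumulants_combined]. *)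
Lemma kap_1_asymp : small (fun t => (kap 1 t - 2 * zc / t ^ 3) * sig t).
Proof.
  apply small_ext_loc with (t0 := 1) (g := fun t =>
    / 2 * (1 * ((kap 1 t - 2 * zc / t ^ 3) * sig t) + (kap 2 t * sig t ^ 2 - 1) / 2)
    + - / 2 * (-1 * ((kap 1 t - 2 * zc / t ^ 3) * sig t) + (kap 2 t * sig t ^ 2 - 1) / 2)).
  - lra.
  - intros t Ht. field. lra.
  - apply small_plus; apply small_scal, cumulants_combined; auto.
Qed.

(** Even part in [e] of [cumulants_combined]. *)
Lemma kap_2_asymp : small (fun t => kap 2 t * sig t ^ 2 - 1).
Proof.
  apply small_ext_loc with (t0 := 1) (g := fun t =>
    (1 * ((kap 1 t - 2 * zc / t ^ 3) * sig t) + (kap 2 t * sig t ^ 2 - 1) / 2)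
    + (-1 * ((kap 1 t - 2 * zc / t ^ 3) * sig t) + (kap 2 t * sig t ^ 2 - 1) / 2)).
  - lra.
  - intros t Ht. field. lra.
  - apply small_plus; apply cumulants_combined; auto.
Qed.

(** * The generating function on the circle of radius [exp (- t)] *)

(** [log F (exp (- t)) - log F (exp (- t + i th))] is
    [circ_re t th - i circ_im t th]. *)
Definition circ_re (t th : R) : R := Series (fun k => wt t k * (1 - cos (INR k * th))).
Definition circ_im (t th : R) : R := Series (fun k => wt t k * sin (INR k * th)).

Lemma ex_series_wt t : 0 < t -> ex_series (wt t).
Proof.
  intros Ht. eapply ex_series_ext; [|apply (ex_series_kap 0 t Ht)]. intros k. apply Rmult_1_l.
Qed.

Lemma ex_series_wt_bounded t C (f : nat -> R) : 0 < t -> (forall k, Rabs (f k) <= C) ->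
  ex_series (fun k => wt t k * f k).
Proof.
  intros Ht Hf. apply (ex_series_dominated (fun k => C * wt t k)).
  - intros k. rewrite Rabs_mult, (Rabs_pos_eq (wt t k)), Rmult_comm by apply wt_nonneg.
    apply Rmult_le_compat_r; [apply wt_nonneg|apply Hf].
  - apply ex_series_Rscal. now apply ex_series_wt.
Qed.

Lemma ex_series_circ_re t th : 0 < t -> ex_series (fun k => wt t k * (1 - cos (INR k * th))).
Proof.
  intros Ht. apply ex_series_wt_bounded with 2; [exact Ht|]. intros k.
  pose proof (COS_bound (INR k * th)). apply Rabs_le. lra.
Qed.

Lemma ex_series_circ_im t th : 0 < t -> ex_series (fun k => wt t k * sin (INR k * th)).
Proof.
  intros Ht. apply ex_series_wt_bounded with 1; [exact Ht|]. intros k.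
  apply Rabs_le. apply SIN_bound.
Qed.

Lemma circ_re_nonneg t th : 0 < t -> 0 <= circ_re t th.
Proof.
  intros Ht. apply Series_nonneg; [|now apply ex_series_circ_re]. intros k.
  pose proof (COS_bound (INR k * th)). apply Rmult_le_pos; [apply wt_nonneg|lra].
Qed.

Lemma circ_re_taylor t th : 0 < t -> Rabs (circ_re t th - th ^ 2 / 2 * kap 2 t) <= Rabs th ^ 3 * kap 3 t.
Proof.
  intros Ht. unfold circ_re, kap. rewrite <- !Series_scal_l. apply Series_dist_le.
  - now apply ex_series_circ_re.
  - now apply ex_series_Rscal, ex_series_kap.
  - now apply ex_series_Rscal, ex_series_kap.
  - intros k. pose proof (cos_taylor_2 (INR k * th)) as H. rewrite Rabs_mult, (Rabs_pos_eq (INR k)) in H by apply pos_INR.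
    replace (wt t k * (1 - cos (INR k * th)) - th ^ 2 / 2 * (INR k ^ 2 * wt t k)) with
      (wt t k * (1 - cos (INR k * th) - (INR k * th) ^ 2 / 2)) by field.
    rewrite Rabs_mult, (Rabs_pos_eq (wt t k)) by apply wt_nonneg.
    replace (Rabs th ^ 3 * (INR k ^ 3 * wt t k)) with (wt t k * (INR k * Rabs th) ^ 3) by ring.
    apply Rmult_le_compat_l; [apply wt_nonneg|exact H].
Qed.

Lemma circ_im_taylor t th : 0 < t -> Rabs (circ_im t th - th * kap 1 t) <= Rabs th ^ 3 * kap 3 t.
Proof.
  intros Ht. unfold circ_im, kap. rewrite <- !Series_scal_l. apply Series_dist_le.
  - now apply ex_series_circ_im.
  - now apply ex_series_Rscal, ex_series_kap.
  - now apply ex_series_Rscal, ex_series_kap.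
  - intros k. pose proof (sin_taylor_1 (INR k * th)) as H. rewrite Rabs_mult, (Rabs_pos_eq (INR k)) in H by apply pos_INR.
    replace (wt t k * sin (INR k * th) - th * (INR k ^ 1 * wt t k)) with
      (wt t k * (sin (INR k * th) - INR k * th)) by ring.
    rewrite Rabs_mult, (Rabs_pos_eq (wt t k)) by apply wt_nonneg.
    replace (Rabs th ^ 3 * (INR k ^ 3 * wt t k)) with (wt t k * (INR k * Rabs th) ^ 3) by ring.
    apply Rmult_le_compat_l; [apply wt_nonneg|exact H].
Qed.

Lemma ex_series_INR_pow q : 0 <= q < 1 -> ex_series (fun k => INR k * q ^ k).
Proof.
  intros Hq. apply (ex_pseries_R INR q), CV_radius_inside, lt_CV_radius.
  - rewrite (CV_radius_ext _ (PS_D (fun _ => 1))).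
    + rewrite CV_radius_PS_D. apply CV_radius_bounded_ge_1 with 1. intros. rewrite Rabs_R1. lra.
    + intros n. symmetry. apply Rmult_1_r.
  - rewrite Rabs_pos_eq; lra.
Qed.

(** Multiplying twice by [1 - z] turns [sum k z^k] into [z]. *)
Lemma Csum_index_pow z : Cmod z < 1 ->
  exists l, Cser (fun k => (RtoC (INR k) * z ^ k)%C) l /\ ((1 - z) * (1 - z) * l = z)%C.
Proof.
  intros Hz. pose proof (Cmod_ge_0 z) as Hz0.
  set (l := Csum (fun k => (RtoC (INR k) * z ^ k)%C)). exists l.
  assert (Hl : Cser (fun k => (RtoC (INR k) * z ^ k)%C) l).
  { apply Csum_correct with (fun k => INR k * Cmod z ^ k); [|apply ex_series_INR_pow; lra].
    intros k. rewrite Cmod_mult, Cmod_R, Cmod_pow, Rabs_pos_eq by apply pos_INR. lra. }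
  split; [exact Hl|].
  pose proof (Cser_minus _ _ _ _ Hl (Cser_incr (fun k => RtoC (INR k)) z l Hl)) as H1.
  apply (Cser_ext _ (fun k => ((match k with O => 0 | S _ => 1 end) * z ^ k)%C)) in H1.
  2:{ intros [|k]; [simpl; ring|]. rewrite S_INR, RtoC_plus. ring. }
  pose proof (Cser_minus _ _ _ _ H1 (Cser_incr (fun k => match k with O => 0 | S _ => 1 end)%C z _ H1)) as H2.
  apply (Cser_ext _ (fun k => (RtoC (PS_X 1 k) * z ^ k)%C)) in H2.
  2:{ intros [|[|k]]; unfold PS_X; simpl; ring. }
  pose proof (Cser_unique _ _ H2) as E2. rewrite (Cser_unique _ _ (Cser_X1 z)) in E2.
  transitivity (l - z * l - z * (l - z * l))%C; [ring|symmetry; exact E2].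
Qed.

(** The coefficients of the logarithm are at least [2 k], and
    [sum k z^k = z / (1 - z)^2] has modulus at most [q / |1 - z|^2], which is
    much smaller than its value [q / (1 - q)^2] on the positive axis. *)
Lemma circ_re_lower t th : 0 < t <= / 2 -> - PI <= th <= PI ->
  th ^ 2 / (t ^ 2 * (12 * t ^ 2 + th ^ 2)) <= circ_re t th.
Proof.
  intros Ht Hth. pose proof (exp_neg_bounds t ltac:(lra)) as Hq. pose proof (one_minus_le_exp t) as Hq1.
  set (q := exp (- t)) in *.
  assert (Ez : Cmod (RtoC q * cis th)%C = q) by (apply Cmod_circle; lra).
  set (z := (RtoC q * cis th)%C) in *.
  destruct (Csum_index_pow z ltac:(lra)) as [l [Hl El]].
  destruct (Csum_index_pow (RtoC q)) as [m [Hm Em]]; [rewrite Cmod_R, Rabs_pos_eq; lra|].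
  set (b := (1 - q) ^ 2). set (W := 2 * q * (1 - cos th)).
  assert (Hb : 0 < b <= t ^ 2) by (unfold b; split; [apply pow_lt; lra|nra]).
  pose proof (one_minus_cos_lower th Hth) as HW.
  assert (HW' : th ^ 2 / 12 <= W) by (unfold W; nra).
  assert (Hz2 : Cmod (1 - z)%C ^ 2 = b + W).
  { rewrite Cmod2_alt. unfold z, cis, b, W. simpl. pose proof (sin2_cos2 th) as T. unfold Rsqr in T. nra. }
  assert (Hbw : 0 < b + W) by (pose proof (pow2_ge_0 th); lra).
  assert (B1 : Re l <= q / (b + W)).
  { eapply Rle_trans; [apply Rle_abs|]. eapply Rle_trans; [apply re_le_Cmod|].
    apply le_div_of_mul_le; [exact Hbw|]. apply (f_equal Cmod) in El.
    rewrite !Cmod_mult, Ez in El. rewrite <- Hz2. right. rewrite <- El. ring. }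
  assert (B2 : Re m = q / b).
  { apply (f_equal Re) in Em. destruct m as [x y]. unfold RtoC in Em. simpl in Em |- *.
    apply Rmult_eq_reg_r with b; [|lra]. unfold Rdiv. rewrite Rmult_assoc, Rinv_l by lra.
    rewrite Rmult_1_r, <- Em at 1. unfold b. ring. }
  assert (B3 : 2 * (Re m - Re l) <= circ_re t th).
  { destruct Hl as [Hl _]. destruct Hm as [Hm _].
    pose proof (is_series_minus (V := R_NormedModule) _ _ _ _ Hm Hl) as D.
    apply (is_series_scal (V := R_NormedModule) 2) in D.
    assert (E : forall k, scal (V := R_NormedModule) 2
        (minus (Re (RtoC (INR k) * RtoC q ^ k)%C) (Re (RtoC (INR k) * z ^ k)%C))
      = 2 * INR k * exp (- (INR k * t)) * (1 - cos (INR k * th))).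
    { intros k. unfold z. rewrite circle_pow, <- RtoC_pow. unfold q. rewrite exp_neg_pow.
      unfold cis. set (e := exp (- (INR k * t))).
      change (2 * (Re (RtoC (INR k) * RtoC e)%C - Re (RtoC (INR k) * (RtoC e * (cos (INR k * th), sin (INR k * th))))%C)
        = 2 * INR k * e * (1 - cos (INR k * th))). simpl. ring. }
    apply (is_series_ext _ _ _ E) in D. apply is_series_unique in D.
    eapply Rle_trans; [right; symmetry; exact D|].
    apply Series_le; [|apply ex_series_circ_re; lra].
    intros k. pose proof (COS_bound (INR k * th)). pose proof (exp_pos (- (INR k * t))). pose proof (pos_INR k).
    split.
    - apply Rmult_le_pos; [apply Rmult_le_pos; lra|lra].
    - unfold wt. apply Rmult_le_compat_r; [lra|]. apply Rmult_le_compat_r; [lra|]. apply pp_log_coef_ge. }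
  eapply Rle_trans; [|exact B3].
  apply Rle_trans with (2 * (q / b - q / (b + W))); [|lra].
  replace (2 * (q / b - q / (b + W))) with (2 * q * (W / (b * (b + W)))) by (field; lra).
  assert (V0 : 0 <= W) by (pose proof (pow2_ge_0 th); lra).
  assert (Vt : 0 < t ^ 2) by (apply pow_lt; lra).
  assert (X1 : th ^ 2 / (t ^ 2 * (12 * t ^ 2 + th ^ 2)) <= W / (b * (b + W))).
  { pose proof (pow2_ge_0 th) as Hth2. set (x := th ^ 2) in *. set (T := t ^ 2) in *.
    apply div_le_of_le_mul; [apply Rmult_lt_0_compat; lra|].
    replace (W / (b * (b + W)) * (T * (12 * T + x))) with (W * (T * (12 * T + x)) / (b * (b + W))) by (field; lra).
    apply le_div_of_mul_le; [apply Rmult_lt_0_compat; lra|].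
    (* [x b (b + W) <= W T (12 T + x)], from [b <= T] and [x <= 12 W] *)
    assert (x * (b * b) <= W * (T * (12 * T))).
    { apply Rle_trans with ((12 * W) * (T * T)); [|right; ring]. apply Rmult_le_compat; nra. }
    assert (x * (b * W) <= x * (T * W)).
    { apply Rmult_le_compat_l; [lra|]. apply Rmult_le_compat_r; lra. }
    replace (x * (b * (b + W))) with (x * (b * b) + x * (b * W)) by ring.
    replace (W * (T * (12 * T + x))) with (W * (T * (12 * T)) + x * (T * W)) by ring. lra. }
  assert (X0 : 0 <= W / (b * (b + W))).
  { apply Rmult_le_pos; [exact V0|]. left. apply Rinv_0_lt_compat, Rmult_lt_0_compat; lra. }
  nra.
Qed.

(** * The saddle point integral *)

(** The Fourier coefficient of order [n] of [F] on the circle of radius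
    [exp (- t)], normalized by [F (exp (- t))]. *)
Lemma pp_integral n t : 0 < t ->
  is_RInt (fun th => exp (- circ_re t th) * cos (circ_im t th - INR n * th)) (- PI) PI
    (2 * PI * (pp n * exp (- (INR n * t)) * exp (- pp_log t))).
Proof.
  intros Ht. pose proof (exp_neg_bounds t Ht) as Hq.
  set (A := fun k => RtoC (pp k * exp (- (INR k * t)))).
  assert (HA : ex_series (fun k => Cmod (A k))).
  { assert (H : Rbar_lt (Rabs (exp (- t))) (CV_radius pp)).
    { apply lt_CV_radius; [apply CV_radius_pp|rewrite Rabs_pos_eq; lra]. }
    apply CV_radius_inside, ex_pseries_R in H.
    eapply ex_series_ext; [|exact H]. intros k. unfold A. cbv beta.
    rewrite Cmod_R, Rabs_pos_eq, exp_neg_pow; [reflexivity|].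
    apply Rmult_le_pos; [apply pp_nonneg|left; apply exp_pos]. }
  pose proof (is_RInt_fourier A n HA) as H.
  apply (is_RInt_scal (V := R_NormedModule) _ _ _ (exp (- pp_log t))) in H.
  match type of H with is_RInt _ _ _ ?v =>
    replace (2 * PI * (pp n * exp (- (INR n * t)) * exp (- pp_log t))) with v end.
  2:{ unfold A. change (exp (- pp_log t) * (2 * PI * (pp n * exp (- (INR n * t)))) =
        2 * PI * (pp n * exp (- (INR n * t)) * exp (- pp_log t))). ring. }
  eapply is_RInt_ext; [|exact H]. intros th _. cbv beta.
  set (z := (RtoC (exp (- t)) * cis th)%C).
  assert (Hz : Cmod z < 1) by (unfold z; rewrite Cmod_circle; lra).
  assert (Ez : forall k, (z ^ k)%C = (RtoC (exp (- (INR k * t))) * cis (INR k * th))%C).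
  { intros k. unfold z. now rewrite circle_pow, exp_neg_pow. }
  pose proof (Cser_scal (cis (- (INR n * th))) _ _ (pp_generating_Cexp z Hz)) as [HR _].
  assert (ES : Series (fun k => fourier_term A n k th) =
    Re (cis (- (INR n * th)) * Cexp (Csum (fun k => (RtoC (pp_log_coef k) * z ^ k)%C)))%C).
  { apply is_series_unique. eapply is_series_ext; [|exact HR]. intros k. cbv beta.
    rewrite fourier_term_eq, Ez. unfold A. rewrite RtoC_mult. f_equal. ring. }
  rewrite ES.
  assert (EC : Csum (fun k => (RtoC (pp_log_coef k) * z ^ k)%C) = (pp_log t - circ_re t th, circ_im t th)).
  { unfold Csum. f_equal.
    - rewrite pp_log_kap. unfold kap, circ_re.
      rewrite <- Series_minus by (apply ex_series_kap || apply ex_series_circ_re; exact Ht).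
      apply Series_ext. intros k. rewrite Ez. unfold wt, cis. simpl. ring.
    - unfold circ_im. apply Series_ext. intros k. rewrite Ez. unfold wt, cis. simpl. ring. }
  rewrite EC. unfold cis, Cexp. simpl.
  rewrite cos_minus, cos_neg, sin_neg.
  assert (EE : exp (- pp_log t) * exp (pp_log t - circ_re t th) = exp (- circ_re t th))
    by (rewrite <- exp_plus; f_equal; ring).
  rewrite <- EE. change scal with Rmult. ring.
Qed.

(** The integrand of [pp_integral] on the scale of the standard deviation. *)
Definition saddle_fun (t : R) (n : nat) (u : R) : R :=
  exp (- circ_re t (sig t * u)) * cos (circ_im t (sig t * u) - INR n * (sig t * u)).

Lemma saddle_integral n t : 0 < t ->
  is_RInt (saddle_fun t n) (- (PI / sig t)) (PI / sig t)
    (2 * PI * (pp n * exp (- (INR n * t)) * exp (- pp_log t)) / sig t).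
Proof.
  intros Ht. assert (Hs : 0 < sig t).
  { destruct sqrt_zc. apply Rdiv_lt_0_compat; [apply pow_lt|]; assumption. }
  pose proof (pp_integral n t Ht) as H.
  set (f := fun th => exp (- circ_re t th) * cos (circ_im t th - INR n * th)) in H.
  set (l := 2 * PI * (pp n * exp (- (INR n * t)) * exp (- pp_log t))) in *.
  assert (H' : is_RInt f (sig t * - (PI / sig t) + 0) (sig t * (PI / sig t) + 0) l).
  { replace (sig t * - (PI / sig t) + 0) with (- PI) by (field; lra).
    replace (sig t * (PI / sig t) + 0) with PI by (field; lra). exact H. }
  apply (is_RInt_comp_lin (V := R_NormedModule)) in H'.
  apply (is_RInt_scal (V := R_NormedModule) _ _ _ (/ sig t)) in H'.
  replace (l / sig t) with (scal (V := R_NormedModule) (/ sig t) l).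
  2:{ change (/ sig t * l = l / sig t). unfold Rdiv. ring. }
  eapply is_RInt_ext; [|exact H']. intros u _. cbv beta.
  change (/ sig t * (sig t * f (sig t * u + 0)) = saddle_fun t n u).
  unfold f, saddle_fun. rewrite Rplus_0_r. field. lra.
Qed.

Lemma exp_neg_lipschitz x y : 0 <= x -> 0 <= y -> Rabs (exp (- x) - exp (- y)) <= Rabs (x - y).
Proof.
  assert (G : forall x y, 0 <= x <= y -> Rabs (exp (- x) - exp (- y)) <= Rabs (x - y)).
  { intros a b Hab. rewrite Rabs_minus_sym, (Rabs_minus_sym a).
    rewrite (Rabs_pos_eq (b - a)) by lra. rewrite <- (Rmult_1_l (b - a)).
    apply (mean_value_inequality (fun x => exp (- x)) (fun x => - exp (- x))); [lra| |].
    - intros z _. auto_derive; [exact I|ring].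
    - intros z Hz. rewrite Rabs_Ropp, Rabs_pos_eq by (left; apply exp_pos).
      rewrite <- exp_0. apply exp_le_compat. lra. }
  intros Hx Hy. destruct (Rle_lt_dec x y); [apply G; lra|].
  rewrite Rabs_minus_sym, (Rabs_minus_sym x). apply G. lra.
Qed.

(** Taylor expansion to second order: the coefficients are given by
    [kap_1_asymp] and [kap_2_asymp], and the error is of order
    [sig t ^ 3 * kap 3 t = O(t)]. *)
Lemma saddle_fun_central U eps : 0 < U -> 0 < eps -> exists d, 0 < d /\
  forall t n u, 0 < t < d -> INR n = 2 * zc / t ^ 3 -> - U <= u <= U ->
  Rabs (saddle_fun t n u - gauss u) <= eps.
Proof.
  intros HU He. destruct sqrt_zc as [R0 R2]. set (r := sqrt (6 * zc)) in *.
  destruct kap_3_upper as [K [t1 [HK [Ht1 H3]]]].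
  assert (Sm : small (fun t => (U ^ 2 / 2 * Rabs (kap 2 t * sig t ^ 2 - 1) + U * Rabs ((kap 1 t - 2 * zc / t ^ 3) * sig t))
     + (2 * U ^ 3 * (K / r ^ 3)) * t)).
  { assert (SA : forall g, small g -> small (fun t => Rabs (g t))).
    { intros g Hg e Hep. destruct (Hg e Hep) as [d [Hd H]]. exists d. split; [exact Hd|].
      intros t Ht. rewrite Rabs_Rabsolu. now apply H. }
    apply small_plus; [apply small_plus|].
    - apply small_scal, SA, kap_2_asymp.
    - apply small_scal, SA, kap_1_asymp.
    - apply small_scal, small_id. }
  destruct (Sm eps He) as [d [Hd HS]].
  exists (Rmin d t1). split; [now apply Rmin_glb_lt|]. intros t n u Ht Hn Hu.
  pose proof (Rmin_l d t1). pose proof (Rmin_r d t1).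
  specialize (HS t ltac:(lra)). destruct (H3 t ltac:(lra)) as [[K0 K3] _].
  eapply Rle_trans; [|apply HS]. eapply Rle_trans; [|apply Rle_abs].
  set (s := sig t) in *.
  assert (Hs : 0 < s) by (unfold s, sig; fold r; apply Rdiv_lt_0_compat; [apply pow_lt; lra|lra]).
  assert (Au : Rabs u <= U) by (apply Rabs_le; lra). pose proof (Rabs_pos u) as Pu.
  assert (Asu : Rabs (s * u) = s * Rabs u) by (rewrite Rabs_mult, (Rabs_pos_eq s) by lra; reflexivity).
  assert (B3 : Rabs (s * u) ^ 3 * kap 3 t <= U ^ 3 * (K / r ^ 3) * t).
  { rewrite Asu, Rpow_mult_distr.
    apply Rle_trans with (s ^ 3 * U ^ 3 * (K / t ^ 5)).
    - apply Rmult_le_compat; [|exact K0| |exact K3].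
      + apply Rmult_le_pos; apply pow_le; lra.
      + apply Rmult_le_compat_l; [apply pow_le; lra|]. apply pow_incr. lra.
    - right. unfold s, sig. fold r. field. lra. }
  pose proof (circ_re_taylor t (s * u) ltac:(lra)) as TX. pose proof (circ_im_taylor t (s * u) ltac:(lra)) as TY.
  unfold saddle_fun. fold s. set (X := circ_re t (s * u)) in *. set (Y := circ_im t (s * u) - INR n * (s * u)).
  assert (X0 : 0 <= X) by (apply circ_re_nonneg; lra).
  assert (BY : Rabs Y <= U * Rabs ((kap 1 t - 2 * zc / t ^ 3) * s) + U ^ 3 * (K / r ^ 3) * t).
  { unfold Y. rewrite Hn.
    replace (circ_im t (s * u) - 2 * zc / t ^ 3 * (s * u)) with
      (u * ((kap 1 t - 2 * zc / t ^ 3) * s) + (circ_im t (s * u) - s * u * kap 1 t)) by ring.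
    eapply Rle_trans; [apply Rabs_triang|]. rewrite Rabs_mult. apply Rplus_le_compat; [|lra].
    apply Rmult_le_compat_r; [apply Rabs_pos|exact Au]. }
  assert (BX : Rabs (X - u ^ 2 / 2) <= U ^ 2 / 2 * Rabs (kap 2 t * s ^ 2 - 1) + U ^ 3 * (K / r ^ 3) * t).
  { replace (X - u ^ 2 / 2) with (u ^ 2 / 2 * (kap 2 t * s ^ 2 - 1) + (X - (s * u) ^ 2 / 2 * kap 2 t)) by field.
    eapply Rle_trans; [apply Rabs_triang|]. rewrite Rabs_mult. apply Rplus_le_compat; [|lra].
    apply Rmult_le_compat_r; [apply Rabs_pos|]. rewrite Rabs_pos_eq by (pose proof (pow2_ge_0 u); lra). nra. }
  assert (EG : gauss u = exp (- (u ^ 2 / 2))) by (unfold gauss; f_equal; field).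
  rewrite EG.
  replace (exp (- X) * cos Y - exp (- (u ^ 2 / 2))) with
    (exp (- X) * (cos Y - 1) + (exp (- X) - exp (- (u ^ 2 / 2)))) by ring.
  eapply Rle_trans; [apply Rabs_triang|].
  pose proof (exp_neg_lipschitz X (u ^ 2 / 2) X0 ltac:(pose proof (pow2_ge_0 u); lra)) as L.
  assert (C1 : Rabs (exp (- X) * (cos Y - 1)) <= Rabs Y).
  { rewrite Rabs_mult, (Rabs_pos_eq (exp (- X))) by (left; apply exp_pos).
    assert (exp (- X) <= 1) by (rewrite <- exp_0; apply exp_le_compat; lra).
    pose proof (exp_pos (- X)). pose proof (Rabs_cos_minus_1_le Y). pose proof (Rabs_pos (cos Y - 1)). nra. }
  lra.
Qed.

(** For [|th| <= t] the bound of [circ_re_lower] is quadratic in [u]; beyond, it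
    is of order [t^(-2)], hence linear in [u] up to the end of the interval. *)
Lemma saddle_fun_tail : exists c t0, 0 < c /\ 0 < t0 /\
  forall t n u, 0 < t < t0 -> - (PI / sig t) <= u <= PI / sig t ->
  Rabs (saddle_fun t n u) <= exp (c - c * Rabs u).
Proof.
  destruct sqrt_zc as [R0 R2]. set (r := sqrt (6 * zc)) in *.
  set (c := Rmin (/ (13 * r ^ 2)) (/ (52 * r))).
  assert (P1 : 0 < 13 * r ^ 2) by (assert (0 < r ^ 2) by (apply pow_lt; lra); lra).
  assert (Hc : 0 < c) by (apply Rmin_glb_lt; apply Rinv_0_lt_compat; lra).
  exists c, (/ 2). split; [exact Hc|]. split; [lra|]. intros t n u Ht Hu.
  assert (T2 : 0 < t ^ 2) by (apply pow_lt; lra).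
  assert (Hs : 0 < sig t) by (unfold sig; fold r; apply Rdiv_lt_0_compat; lra).
  set (s := sig t) in *. set (th := s * u).
  assert (Hth : - PI <= th <= PI).
  { unfold th. replace (- PI) with (s * - (PI / s)) by (field; lra).
    replace PI with (s * (PI / s)) at 2 by (field; lra). split; apply Rmult_le_compat_l; lra. }
  pose proof (circ_re_lower t th ltac:(lra) Hth) as HL.
  unfold saddle_fun. fold s th. set (X := circ_re t th) in *.
  assert (HX : c * Rabs u - c <= X).
  { eapply Rle_trans; [|exact HL].
    assert (Eth : th ^ 2 = t ^ 4 * u ^ 2 / r ^ 2) by (unfold th, s, sig; fold r; field; lra).
    pose proof (pow2_ge_0 th) as Hth2. pose proof (Rabs_pos u) as Pu.
    assert (Hu2 : u ^ 2 = Rabs u ^ 2) by (symmetry; apply pow2_abs).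
    destruct (Rle_lt_dec (th ^ 2) (t ^ 2)) as [h|h].
    - apply Rle_trans with (u ^ 2 / (13 * r ^ 2)).
      + assert (c <= / (13 * r ^ 2)) by apply Rmin_l.
        apply Rle_trans with (c * u ^ 2).
        * rewrite Hu2. pose proof (pow2_ge_0 (Rabs u - / 2)).
          apply Rle_trans with (c * (Rabs u - 1)); [lra|]. apply Rmult_le_compat_l; nra.
        * rewrite Rmult_comm. apply Rmult_le_compat_l; [apply pow2_ge_0|assumption].
      + apply le_div_of_mul_le; [apply Rmult_lt_0_compat; lra|].
        apply Rle_trans with (u ^ 2 / (13 * r ^ 2) * (t ^ 2 * (13 * t ^ 2))).
        * apply Rmult_le_compat_l; [apply Rmult_le_pos; [apply pow2_ge_0|left; now apply Rinv_0_lt_compat]|].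
          apply Rmult_le_compat_l; lra.
        * rewrite Eth. right. field. lra.
    - apply Rle_trans with (/ (13 * t ^ 2)).
      + assert (c <= / (52 * r)) by apply Rmin_r.
        assert (HP : Rabs u <= 4 * r / t ^ 2).
        { pose proof PI_4. apply Rle_trans with (PI / s); [apply Rabs_le; lra|].
          apply Rle_trans with (4 / s).
          - apply Rmult_le_compat_r; [left; now apply Rinv_0_lt_compat|lra].
          - right. unfold s, sig. fold r. field. lra. }
        apply Rle_trans with (/ (52 * r) * (4 * r / t ^ 2)).
        * apply Rle_trans with (c * Rabs u); [lra|]. apply Rmult_le_compat; lra.
        * right. field. lra.
      + apply le_div_of_mul_le; [apply Rmult_lt_0_compat; lra|].
        apply Rle_trans with (/ (13 * t ^ 2) * (t ^ 2 * (13 * th ^ 2))).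
        * apply Rmult_le_compat_l; [left; apply Rinv_0_lt_compat; lra|]. apply Rmult_le_compat_l; lra.
        * right. field. lra. }
  rewrite Rabs_mult, (Rabs_pos_eq (exp (- X))) by (left; apply exp_pos).
  apply Rle_trans with (exp (- X) * 1).
  - apply Rmult_le_compat_l; [left; apply exp_pos|]. apply Rabs_le. apply COS_bound.
  - rewrite Rmult_1_r. apply exp_le_compat. lra.
Qed.

Lemma RInt_exp_tail (f : R -> R) c U V : 0 < c -> U <= V -> ex_RInt f U V ->
  (forall u, U <= u <= V -> Rabs (f u) <= exp (c - c * u)) -> Rabs (RInt f U V) <= exp (c - c * U) / c.
Proof.
  intros Hc HUV Hex Hf.
  assert (HI : is_RInt (fun u => exp (c - c * u)) U V (exp (c - c * U) / c - exp (c - c * V) / c)).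
  { replace (exp (c - c * U) / c - exp (c - c * V) / c) with
      (minus (G := R_AbelianGroup) (- (exp (c - c * V) / c)) (- (exp (c - c * U) / c))).
    2:{ change (- (exp (c - c * V) / c) - - (exp (c - c * U) / c) = exp (c - c * U) / c - exp (c - c * V) / c). ring. }
    apply (is_RInt_derive (V := R_CompleteNormedModule) (fun u => - (exp (c - c * u) / c)) (fun u => exp (c - c * u))).
    - intros u _. auto_derive; [lra|]. unfold Rminus. field. lra.
    - intros u _. apply (ex_derive_continuous (V := R_NormedModule)). auto_derive. exact I. }
  apply Rle_trans with (exp (c - c * U) / c - exp (c - c * V) / c).
  - apply (norm_RInt_le (V := R_NormedModule) f (fun u => exp (c - c * u)) U V); [exact HUV|exact Hf| |exact HI].
    now apply (RInt_correct (V := R_CompleteNormedModule)).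
  - assert (0 < exp (c - c * V) / c) by (apply Rdiv_lt_0_compat; [apply exp_pos|exact Hc]). lra.
Qed.

Lemma RInt_exp_tail_left (f : R -> R) c U V : 0 < c -> U <= V -> ex_RInt f (- V) (- U) ->
  (forall u, U <= u <= V -> Rabs (f (- u)) <= exp (c - c * u)) -> Rabs (RInt f (- V) (- U)) <= exp (c - c * U) / c.
Proof.
  intros Hc HUV Hex Hf.
  pose proof (is_RInt_comp_opp (V := R_NormedModule) f V U _ (RInt_correct (V := R_CompleteNormedModule) _ _ _ Hex)) as H.
  apply is_RInt_swap, is_RInt_opp in H.
  assert (H' : is_RInt (fun u => f (- u)) U V (RInt f (- V) (- U))).
  { rewrite <- (Ropp_involutive (RInt f (- V) (- U))). eapply is_RInt_ext; [|exact H].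
    intros u _. change (- - f (- u) = f (- u)). apply Ropp_involutive. }
  rewrite <- (is_RInt_unique _ _ _ _ H'). apply RInt_exp_tail; try assumption.
  eexists. exact H'.
Qed.

(** Dominated convergence of the rescaled integral to the Gaussian one. *)
Lemma saddle_point eps : 0 < eps -> exists d, 0 < d /\
  forall t n, 0 < t < d -> INR n = 2 * zc / t ^ 3 ->
  Rabs (2 * PI * (pp n * exp (- (INR n * t)) * exp (- pp_log t)) / sig t - sqrt (2 * PI)) <= eps.
Proof.
  intros He. destruct saddle_fun_tail as [c [t0 [Hc [Ht0 HT]]]].
  destruct (RInt_gauss_limit (eps / 4) ltac:(lra)) as [U0 [HU0 HG]].
  destruct sqrt_zc as [R0 R2]. set (r := sqrt (6 * zc)) in *.
  set (U := Rmax U0 (8 * exp c / (c ^ 2 * eps))).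
  assert (HU1 : U0 <= U) by apply Rmax_l. assert (HU : 0 < U) by lra.
  assert (Hce : 0 < c ^ 2 * eps) by (apply Rmult_lt_0_compat; [apply pow_lt|]; lra).
  assert (HU2 : 8 * exp c <= U * (c ^ 2 * eps)).
  { apply Rle_trans with (8 * exp c / (c ^ 2 * eps) * (c ^ 2 * eps)).
    - right. field. split; lra.
    - apply Rmult_le_compat_r; [lra|apply Rmax_r]. }
  assert (HE : exp (c - c * U) / c <= eps / 8).
  { apply div_le_of_le_mul; [exact Hc|]. unfold Rminus. rewrite exp_plus, exp_Ropp.
    assert (0 < c * U) by nra. pose proof (exp_ineq1_le (c * U)). pose proof (exp_pos c).
    apply div_le_of_le_mul; [apply exp_pos|].
    apply Rle_trans with (eps / 8 * c * (c * U)); [|apply Rmult_le_compat_l; nra].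
    replace (eps / 8 * c * (c * U)) with (U * (c ^ 2 * eps) / 8) by field. lra. }
  destruct (saddle_fun_central U (eps / (8 * U)) HU) as [d [Hd HC]].
  { apply Rdiv_lt_0_compat; lra. }
  assert (Hru : 0 < 3 * r / U) by (apply Rdiv_lt_0_compat; lra).
  exists (Rmin (Rmin d t0) (Rmin 1 (3 * r / U))).
  split; [repeat apply Rmin_glb_lt; lra|]. intros t n Ht Hn.
  pose proof (Rmin_l (Rmin d t0) (Rmin 1 (3 * r / U))). pose proof (Rmin_r (Rmin d t0) (Rmin 1 (3 * r / U))).
  pose proof (Rmin_l d t0). pose proof (Rmin_r d t0).
  pose proof (Rmin_l 1 (3 * r / U)). pose proof (Rmin_r 1 (3 * r / U)).
  set (V := PI / sig t).
  assert (HV : U <= V).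
  { unfold V, sig. fold r. replace (PI / (t ^ 2 / r)) with (PI * r / t ^ 2) by (field; lra).
    apply le_div_of_mul_le; [apply pow_lt; lra|].
    pose proof PI2_3_2. assert (Htu : t * U <= 3 * r).
    { apply Rle_trans with (3 * r / U * U); [apply Rmult_le_compat_r; lra|right; field; lra]. }
    assert (t ^ 2 <= t) by nra. assert (U * t ^ 2 <= U * t) by (apply Rmult_le_compat_l; lra). nra. }
  pose proof (saddle_integral n t ltac:(lra)) as HI. fold V in HI.
  set (J := 2 * PI * (pp n * exp (- (INR n * t)) * exp (- pp_log t)) / sig t) in *.
  set (f := saddle_fun t n) in *.
  assert (X1 : ex_RInt f (- V) V) by (eexists; exact HI).
  assert (X2 : ex_RInt f (- V) (- U)) by (apply (ex_RInt_Chasles_1 f (- V) (- U) V); [lra|exact X1]).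
  assert (X3 : ex_RInt f (- U) V) by (apply (ex_RInt_Chasles_2 f (- V) (- U) V); [lra|exact X1]).
  assert (X4 : ex_RInt f (- U) U) by (apply (ex_RInt_Chasles_1 f (- U) U V); [lra|exact X3]).
  assert (X5 : ex_RInt f U V) by (apply (ex_RInt_Chasles_2 f (- U) U V); [lra|exact X3]).
  assert (EJ : J = RInt f (- V) (- U) + (RInt f (- U) U + RInt f U V)).
  { rewrite <- (is_RInt_unique _ _ _ _ HI).
    rewrite <- (RInt_Chasles f (- V) (- U) V X2 X3), <- (RInt_Chasles f (- U) U V X4 X5). reflexivity. }
  assert (B1 : Rabs (RInt f (- V) (- U)) <= exp (c - c * U) / c).
  { apply RInt_exp_tail_left; try assumption. intros u Hu.
    replace (c * u) with (c * Rabs (- u)) by (rewrite Rabs_Ropp, Rabs_pos_eq; lra).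
    apply HT; [lra|]. fold V. lra. }
  assert (B2 : Rabs (RInt f U V) <= exp (c - c * U) / c).
  { apply RInt_exp_tail; try assumption. intros u Hu.
    replace (c * u) with (c * Rabs u) by (rewrite Rabs_pos_eq; lra).
    apply HT; [lra|]. fold V. lra. }
  assert (B3 : Rabs (RInt f (- U) U - RInt gauss (- U) U) <= eps / 4).
  { pose proof (ex_RInt_gauss (- U) U) as XG.
    pose proof (RInt_minus f gauss (- U) U X4 XG) as EM.
    eapply Rle_trans; [right; apply f_equal; symmetry; exact EM|].
    apply Rle_trans with ((U - - U) * (eps / (8 * U))); [|right; field; lra].
    apply (norm_RInt_le (V := R_NormedModule) (fun u => minus (f u) (gauss u)) (fun _ => eps / (8 * U)) (- U) U).
    - lra.
    - intros u Hu. apply HC; [lra|exact Hn|exact Hu].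
    - apply (RInt_correct (V := R_CompleteNormedModule)). now apply (ex_RInt_minus (V := R_NormedModule)).
    - apply (is_RInt_const (V := R_NormedModule) (- U) U (eps / (8 * U))). }
  specialize (HG U HU1).
  rewrite EJ.
  apply Rabs_le_inv in B1. apply Rabs_le_inv in B2. apply Rabs_le_inv in B3. apply Rabs_le_inv in HG.
  apply Rabs_le. lra.
Qed.

(** * The asymptotic formula *)

(** The solution [t] of [n = 2 zc / t^3], up to lower order the critical point of
    [n t + log F (exp (- t))]. *)
Definition saddle_pt (n : nat) : R := Rpower (2 * zc / INR n) (1 / 3).

Lemma saddle_pt_pos n : 0 < saddle_pt n.
Proof. apply exp_pos. Qed.

Lemma saddle_pt_eq n : (1 <= n)%nat -> INR n = 2 * zc / saddle_pt n ^ 3.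
Proof.
  intros Hn. assert (0 < INR n) by (apply lt_0_INR; lia). pose proof zc_pos.
  assert (E : saddle_pt n ^ 3 = 2 * zc / INR n).
  { unfold saddle_pt. rewrite <- Rpower_pow by apply exp_pos. rewrite Rpower_mult.
    replace (1 / 3 * INR 3) with 1 by (simpl; field). apply Rpower_1.
    apply Rdiv_lt_0_compat; lra. }
  rewrite E. field. split; lra.
Qed.

Lemma saddle_pt_small d : 0 < d -> exists N, forall n, (N <= n)%nat -> (1 <= n)%nat /\ 0 < saddle_pt n < d.
Proof.
  intros Hd. pose proof zc_pos as Hz. assert (P3 : 0 < d ^ 3) by (apply pow_lt; lra).
  destruct (INR_unbounded (2 * zc / d ^ 3)) as [N HN].
  exists (S N). intros n Hn. split; [lia|]. split; [apply saddle_pt_pos|].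
  assert (HNn : INR N <= INR n) by (apply le_INR; lia).
  pose proof (saddle_pt_eq n ltac:(lia)) as E. pose proof (saddle_pt_pos n) as Hp.
  destruct (Rlt_le_dec (saddle_pt n) d) as [h|h]; [exact h|]. exfalso.
  assert (d ^ 3 <= saddle_pt n ^ 3) by (apply pow_incr; lra).
  assert (2 * zc / saddle_pt n ^ 3 <= 2 * zc / d ^ 3).
  { apply Rmult_le_compat_l; [lra|]. apply Rinv_le_contravar; lra. }
  lra.
Qed.

Lemma is_lim_seq_of_eps (a : nat -> R) (l : R) :
  (forall eps, 0 < eps -> exists N, forall n, (N <= n)%nat -> Rabs (a n - l) <= eps) -> is_lim_seq a l.
Proof.
  intros H. apply is_lim_seq_spec. intros eps. pose proof (cond_pos eps).
  destruct (H (eps / 2) ltac:(lra)) as [N HN]. exists N. intros n Hn. specialize (HN n Hn). lra.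
Qed.

Lemma saddle_sequence :
  is_lim_seq (fun n => 2 * PI * (pp n * exp (- (INR n * saddle_pt n)) * exp (- pp_log (saddle_pt n))) / sig (saddle_pt n))
    (sqrt (2 * PI)).
Proof.
  apply is_lim_seq_of_eps. intros eps He. destruct (saddle_point eps He) as [d [Hd H]].
  destruct (saddle_pt_small d Hd) as [N HN]. exists N. intros n Hn. destruct (HN n Hn) as [H1 H2].
  apply H; [exact H2|]. now apply saddle_pt_eq.
Qed.

Lemma main_sequence :
  is_lim_seq (fun n => exp (pp_log (saddle_pt n) - pp_log_main (saddle_pt n))) 1.
Proof.
  rewrite <- exp_0.
  apply (is_lim_seq_continuous exp (fun n => pp_log (saddle_pt n) - pp_log_main (saddle_pt n)) 0).
  - apply derivable_continuous_pt, derivable_pt_exp.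
  - apply is_lim_seq_of_eps. intros eps He. destruct (pp_log_small eps He) as [d [Hd H]].
    destruct (saddle_pt_small d Hd) as [N HN]. exists N. intros n Hn. destruct (HN n Hn) as [H1 H2].
    rewrite Rminus_0_r. apply H. exact H2.
Qed.

Lemma sqrt_exp x : 0 < x -> sqrt x = exp (/ 2 * ln x).
Proof. intros Hx. rewrite <- (Rpower_sqrt x Hx). reflexivity. Qed.

(** The Gaussian approximation at the saddle point, evaluated: every factor is
    the exponential of a combination of logarithms, except for
    [n t + zc / t^2 = (3 / 2) n t]. *)
Lemma saddle_closed_form z3 n : 8 * Series (odd_coef 3) = 7 * z3 -> (1 <= n)%nat ->
  exp (- / 6 + em_const) * Rpower (7 * z3) (7 / 36) /
    (Rpower 2 (7 / 9) * sqrt (3 * PI) * Rpower (INR n) (25 / 36)) *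
    exp (3 / Rpower 2 (4 / 3) * Rpower (7 * z3) (1 / 3) * Rpower (INR n) (2 / 3)) =
  exp (INR n * saddle_pt n + pp_log_main (saddle_pt n)) * sqrt (2 * PI) * sig (saddle_pt n) / (2 * PI).
Proof.
  intros Hz Hn. assert (N0 : 0 < INR n) by (apply lt_0_INR; lia). pose proof zc_pos as Z0.
  pose proof PI_RGT_0 as HP.
  assert (Ez : zc = 7 * z3 / 4) by (unfold zc; lra).
  set (A := 7 * z3) in *. assert (A0 : 0 < A) by lra.
  set (t := saddle_pt n). assert (T0 : 0 < t) by apply saddle_pt_pos.
  pose proof (saddle_pt_eq n Hn) as En. fold t in En.
  assert (Lt : ln t = 1 / 3 * (ln A - ln 2 - ln (INR n))).
  { unfold t, saddle_pt, Rpower. rewrite ln_exp. f_equal. rewrite Ez.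
    replace (2 * (A / 4) / INR n) with (A / 2 / INR n) by (field; lra).
    rewrite !ln_div by lra. reflexivity. }
  assert (Et : INR n * t = exp (2 / 3 * ln (INR n) + 1 / 3 * ln A - 1 / 3 * ln 2)).
  { rewrite <- (exp_ln t T0), <- (exp_ln (INR n) N0) at 1. rewrite <- exp_plus, Lt. f_equal. field. }
  assert (E1 : 3 / Rpower 2 (4 / 3) * Rpower A (1 / 3) * Rpower (INR n) (2 / 3) = INR n * t + zc / t ^ 2).
  { assert (Hzt : zc / t ^ 2 = INR n * t / 2) by (rewrite En; field; lra).
    rewrite Hzt, Et. unfold Rpower, Rdiv. rewrite <- exp_Ropp.
    replace (exp (2 * / 3 * ln (INR n) + 1 * / 3 * ln A - 1 * / 3 * ln 2))
      with (exp (2 * / 3 * ln (INR n)) * exp (1 * / 3 * ln A) * exp (- (4 * / 3 * ln 2)) * 2).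
    - field.
    - transitivity (exp (2 * / 3 * ln (INR n)) * exp (1 * / 3 * ln A) * exp (- (4 * / 3 * ln 2)) * exp (ln 2)).
      + rewrite (exp_ln 2) by lra. reflexivity.
      + rewrite <- !exp_plus. f_equal. field. }
  rewrite E1.
  assert (S6 : sqrt (6 * zc) = exp (/ 2 * (ln A + ln 3 - ln 2))).
  { rewrite sqrt_exp by lra. f_equal. f_equal. rewrite Ez.
    replace (6 * (A / 4)) with (A * 3 / 2) by field. rewrite ln_div, ln_mult by lra. reflexivity. }
  assert (L2 : ln (t / 2) = ln t - ln 2) by (apply ln_div; lra).
  unfold sig, pp_log_main. rewrite S6, L2.
  assert (E2 : t ^ 2 = exp (2 * ln t)).
  { replace (2 * ln t) with (ln t + ln t) by ring. rewrite exp_plus, exp_ln by exact T0. ring. }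
  assert (E3 : 2 * PI = exp (ln 2 + ln PI)) by (rewrite exp_plus, !exp_ln by lra; reflexivity).
  assert (E4 : sqrt (2 * PI) = exp (/ 2 * (ln 2 + ln PI))) by (rewrite sqrt_exp, ln_mult by lra; reflexivity).
  assert (E5 : sqrt (3 * PI) = exp (/ 2 * (ln 3 + ln PI))) by (rewrite sqrt_exp, ln_mult by lra; reflexivity).
  rewrite E4, E5, E3. set (w := zc / t ^ 2). rewrite E2. unfold Rpower, Rdiv.
  rewrite <- !exp_plus, <- !exp_Ropp, <- !exp_plus. f_equal. rewrite Lt. field.
Qed.

Theorem corollary1p4 (zeta : C -> C) (Hzeta : is_Riemann_zeta zeta) :
  asymp_equiv pp
    (fun n : nat =>
       exp (Re (C_derive zeta (RtoC (-1)))) *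
         Rpower (7 * Re (zeta (RtoC 3))) (7 / 36) /
         (Rpower 2 (7 / 9) * sqrt (3 * PI) * Rpower (INR n) (25 / 36)) *
         exp (3 / Rpower 2 (4 / 3) *
                Rpower (7 * Re (zeta (RtoC 3))) (1 / 3) *
                Rpower (INR n) (2 / 3))).
Proof.
  rewrite (zeta_derive_m1 zeta Hzeta).
  pose proof (Series_odd_coef_3 _ (zeta_3 zeta Hzeta)) as H3.
  set (z3 := Re (zeta (RtoC 3))) in *.
  pose proof PI_RGT_0 as HP. assert (S0 : 0 < sqrt (2 * PI)) by (apply sqrt_lt_R0; lra).
  pose proof (is_lim_seq_mult' _ _ _ _ saddle_sequence main_sequence) as H.
  apply (is_lim_seq_scal_l _ (/ sqrt (2 * PI))) in H.
  replace (Rbar_mult (/ sqrt (2 * PI)) (sqrt (2 * PI) * 1)) with (Finite 1) in H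
    by (simpl; f_equal; field; lra).
  unfold asymp_equiv. eapply is_lim_seq_ext_loc; [|exact H].
  exists 1%nat. intros n Hn. cbv beta. rewrite (saddle_closed_form z3 n H3 Hn).
  set (t := saddle_pt n).
  assert (Hs : 0 < sig t).
  { destruct sqrt_zc. apply Rdiv_lt_0_compat; [apply pow_lt, saddle_pt_pos|assumption]. }
  replace (exp (INR n * t + pp_log_main t)) with (/ (exp (- (INR n * t)) * exp (- pp_log_main t))).
  2:{ rewrite <- exp_plus, <- exp_Ropp. f_equal. ring. }
  unfold Rminus. rewrite (exp_plus (pp_log t)), (exp_Ropp (pp_log t)).
  pose proof (exp_pos (- (INR n * t))). pose proof (exp_pos (- pp_log_main t)). pose proof (exp_pos (pp_log t)).
  field. repeat split; lra.
Qed.
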